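(* Let $\pi:M\to B$ be a fiber bundle with $M$ a 5-dimensional manifold with volume form $\Omega$ and $B$ an oriented 2-manifold with area form $\omega$. Let $\Pi=\kappa\,\mathrm{hor}^\gamma\psi+P_\beta$ be the almost coupling Poisson tensor on $M$ associated to a Poisson triple $(\gamma,\kappa,\beta)$. Suppose that $d_{0,1}\beta=0$. Then: (i) in the coupling domain $M^\Pi=M\setminus\mathcal Z(\kappa)$, where $\mathcal Z(\kappa)=\{\kappa=0\}$, $\Pi$ is unimodular if and only if $\theta$ is $d_{1,0}$-exact in the sense that $$\theta=-d_{1,0}h$$ for a certain Casimir function $h\in\mathrm{Casim}(M^\Pi,P_\beta)$. The volume form on $M^\Pi$ given by $$\Omega_1^{\mathrm{inv}}=\frac{e^h}{\kappa}\,\pi^*\omega\wedge\Omega^{\mathrm V}$$ is (then) invariant with respect to the flows of all Hamiltonian vector fields of $\Pi$; (ii) in the open domain $\mathrm{Int}\,\mathcal Z(\kappa)$ of $M$, $\Pi=P_\beta$ is unimodular and the corresponding invariant volume form is $$\Omega_2^{\mathrm{inv}}=\pi^*\omega\wedge\Omega^{\mathrm V}.$$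
   Context: All objects are smooth. A fiber bundle $\pi:M\to B$ is a surjective submersion; $\mathbb V=\ker d\pi\subset TM$ is the vertical subbundle (rank 3 here). An Ehresmann connection is a bundle morphism $\gamma:TM\to\mathbb V$ with $\gamma|_{\mathbb V}=\mathrm{id}$; $\mathbb H=\ker\gamma$ is the horizontal subbundle, so $TM=\mathbb H\oplus\mathbb V$ and $T^*M=\mathbb V^\circ\oplus\mathbb H^\circ$ (annihilators). These splittings bigrade multivector fields and forms: a multivector field has bidegree $(p,q)$ if it is a section of $\wedge^p\mathbb H\otimes\wedge^q\mathbb V$, and a form has bidegree $(p,q)$ if it is a section of $\wedge^p\mathbb V^\circ\otimes\wedge^q\mathbb H^\circ$. The exterior differential splits as $d=d_{1,0}+d_{0,1}+d_{2,-1}$, where for a $(p,q)$-form $\alpha$, $d_{i,j}\alpha$ is the bidegree $(p+i,q+j)$ component of $d\alpha$. For a multivector field $\psi$ on $B$, $\mathrm{hor}^\gamma\psi$ is its $\gamma$-horizontal lift. Interior products: $\mathbf i_{X\wedge Y}=\mathbf i_X\circ\mathbf i_Y$ for vector fields acting on forms; similarly $\mathbf i_{\alpha\wedge\alpha'}=\mathbf i_\alpha\circ\mathbf i_{\alpha'}$ for 1-forms acting on multivector fields, with $\mathbf i_\alpha$ inserting $\alpha$ in the first slot. Let $\Omega^{\mathrm H}=\pi^*\omega$ and let $\Omega^{\mathrm V}\in\Gamma\wedge^3\mathbb H^\circ$ be the unique form with $\Omega=\Omega^{\mathrm H}\wedge\Omega^{\mathrm V}$. Let $Q_{\mathrm H}\in\Gamma\wedge^2\mathbb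 H$, $Q_{\mathrm V}\in\Gamma\wedge^3\mathbb V$ be determined by $\mathbf i_{Q_{\mathrm H}}\Omega^{\mathrm H}=1$, $\mathbf i_{Q_{\mathrm V}}\Omega^{\mathrm V}=1$, and let $\psi\in\Gamma\wedge^2TB$ satisfy $\mathbf i_\psi\omega=-1$. Put $P_\beta=-\mathbf i_\beta Q_{\mathrm V}$, $\theta=-\mathbf i_{Q_{\mathrm V}}d_{1,0}\Omega^{\mathrm V}$, $\varrho=\mathbf i_{Q_{\mathrm H}}d_{2,-1}\Omega^{\mathrm V}$. A triple $(\gamma,\kappa,\beta)$, consisting of an Ehresmann connection $\gamma$, $\kappa\in C^\infty(M)$ and $\beta\in\Gamma\mathbb H^\circ$, is a Poisson triple (relative to $(\Omega,\omega)$) if $$d_{0,1}\beta\wedge\beta=0,\quad \kappa\,(d_{1,0}\beta-\theta\wedge\beta)=0,\quad d_{0,1}\kappa\wedge\beta-\kappa^2\varrho=0.$$ In that case $\Pi=\kappa\,\mathrm{hor}^\gamma\psi+P_\beta$ and $P_\beta$ are Poisson tensors. For a Poisson tensor $P$ and an open set $U$, $\mathrm{Casim}(U,P)=\{h\in C^\infty(U):\mathbf i_{dh}P=0\}$. The Hamiltonian vector field of $f$ is $X_f=\mathbf i_{df}P$. The modular vector field $Z^\Omega$ of a Poisson tensor relative to a volume form $\Omega$ is defined by $\mathcal L_{Z^\Omega}f=\mathrm{div}_\Omega(X_f)$; the Poisson tensor is unimodular if $Z^\Omega$ is Hamiltonian (equivalently, there is a volume form invariant under all Hamiltonian flows). A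 volume form is a nowhere vanishing top-degree form. *)

(* Defs.v *)
From HB Require Import structures.
From mathcomp Require Import all_boot all_order all_algebra.
From mathcomp Require Import perm.
From mathcomp Require Import all_classical all_reals all_analysis.
Set Implicit Arguments.
Unset Strict Implicit.
Unset Printing Implicit Defensive.
Import Order.TTheory GRing.Theory Num.Theory.
Import numFieldNormedType.Exports.
Local Open Scope classical_set_scope.
Local Open Scope ring_scope.

(** * Multilinear algebra on R^n

    Vectors and covectors are both row vectors; a covector is given by its
    components in the dual basis, so that [pairing a v] is the value a(v).  An
    element of the k-th exterior power of the dual of R^n (resp. of R^n) is an
    alternating k-linear function of k vectors (resp. of k covectors). *)

Section MultilinearAlgebra.
Variables (R : realType) (n : nat).
Notation E := 'rV[R]_n.

Definition basis_vec (i : 'I_n) : E := delta_mx 0 i.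

Definition pairing (a v : E) : R := \sum_i a 0 i * v 0 i.

Definition annihilator (D : set E) : set E :=
  [set a | forall v, D v -> pairing a v = 0].

Definition update k (v : 'I_k -> E) (i : 'I_k) (u : E) : 'I_k -> E :=
  fun j => if j == i then u else v j.

Definition alternating k (T : ('I_k -> E) -> R) : Prop :=
  (forall v i (a : R) u w,
     T (update v i (a *: u + w)) = a * T (update v i u) + T (update v i w)) /\
  (forall v i j, i != j -> v i = v j -> T v = 0).

(* For an alternating T on vectors this says that T belongs to the k-th
   exterior power of the annihilator of D; for an alternating T on covectors
   and D the annihilator of a subspace H, that T belongs to the k-th exterior
   power of H. *)
Definition kills k (D : set E) (T : ('I_k -> E) -> R) : Prop :=
  forall v i, D (v i) -> T v = 0.

Definition push k (u : E) (v : 'I_k -> E) : 'I_k.+1 -> E :=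
  fun i => if unlift ord0 i is Some j then v j else u.

(* Insertion in the first slot: i_v of a form, or i_a of a multivector. *)
Definition insert k (u : E) (T : ('I_k.+1 -> E) -> R) : ('I_k -> E) -> R :=
  fun v => T (push u v).

Definition wedge_prod p q (a : ('I_p -> E) -> R) (b : ('I_q -> E) -> R) :
    ('I_(p + q) -> E) -> R :=
  fun v => (p`! * q`!)%:R^-1 *
    \sum_(s : 'S_(p + q)) (-1) ^+ s *
      (a (fun i => v (s (lshift q i))) * b (fun j => v (s (rshift p j)))).

(* Interior product i_Q of a form by a multivector, for the convention
   i_(X1 /\ .. /\ Xk) = i_X1 o .. o i_Xk: as i_X fills the first slot, Xk is
   inserted first and the vectors enter the form in reverse order. *)
Definition contract k m (Q : ('I_k -> E) -> R) (a : ('I_(k + m) -> E) -> R) :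
    ('I_m -> E) -> R :=
  fun w => (k`!)%:R^-1 *
    \sum_(I : {ffun 'I_k -> 'I_n})
      Q (fun i => basis_vec (I i)) *
      a (fun l => match fintype.split l with
                  | inl i => basis_vec (I (rev_ord i))
                  | inr j => w j
                  end).

(* Covector of a 1-form. *)
Definition covector (a : ('I_1 -> E) -> R) : E :=
  \row_j a (fun=> basis_vec j).

Fixpoint Ck (k : nat) (O : set E) (f : E -> R) : Prop :=
  (forall y, O y -> {for y, continuous f}) /\
  if k is k'.+1 then
    forall i, (forall y, O y -> derivable f y (basis_vec i)) /\
              Ck k' O (fun y => 'D_(basis_vec i) f y)
  else True.

(* Used on open sets O only. *)
Definition Cinfty (O : set E) (f : E -> R) : Prop := forall k, Ck k O f.

End MultilinearAlgebra.

(** * Smooth manifolds *)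

(* The atlas is given with a preferred chart around each point x: [chart x] is
   defined on [chart_dom x], and [chart_inv x] is its inverse; both are junk
   outside of these sets. *)
Record manifold (R : realType) (n : nat) := Manifold {
  space :> topologicalType;
  space_hausdorff : hausdorff_space space;
  space_countable : @second_countable space;
  chart_dom : space -> set space;
  chart : space -> space -> 'rV[R]_n;
  chart_inv : space -> 'rV[R]_n -> space;
  chart_dom_open : forall x, open (chart_dom x);
  chart_dom_mem : forall x, chart_dom x x;
  chart_img_open : forall x, open (chart x @` chart_dom x);
  chart_continuous : forall x y, chart_dom x y -> {for y, continuous (chart x)};
  chart_inv_continuous : forall x u, (chart x @` chart_dom x) u ->
    {for u, continuous (chart_inv x)};
  chartK : forall x y, chart_dom x y -> chart_inv x (chart x y) = y;
  chart_compatible : forall x y (j : 'I_n),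
    Cinfty (chart x @` (chart_dom x `&` chart_dom y))
           (fun u => chart y (chart_inv x u) 0 j) }.

Arguments chart_dom {R n m}.
Arguments chart {R n m}.
Arguments chart_inv {R n m}.

(** Smoothness always refers to an open set [U]; functions, vector fields and
    forms on [U] are total functions whose values outside [U] are irrelevant. *)
Section Manifold.
Variables (R : realType) (n : nat) (M : manifold R n).
Notation E := 'rV[R]_n.

Definition smooth (U : set M) (f : M -> R) : Prop :=
  forall x, Cinfty (chart x @` (chart_dom x `&` U)) (f \o chart_inv x).

(* The tangent space at x is R^n, through the coordinates of [chart x];
   [dir f x v] is the derivative of f along the tangent vector v at x. *)
Definition dir (f : M -> R) (x : M) (v : E) : R :=
  'D_v (f \o chart_inv x) (chart x x).

Definition vfield := M -> E.
Definition dform (k : nat) := M -> ('I_k -> E) -> R.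
Definition mvector (k : nat) := M -> ('I_k -> E) -> R.

Definition fn_form (f : M -> R) : dform 0 := fun x _ => f x.

Definition smooth_vfield (U : set M) (X : vfield) : Prop :=
  forall (W : set M) (f : M -> R), open W -> W `<=` U -> smooth W f ->
    smooth W (fun y => dir f y (X y)).

Definition smooth_form k (U : set M) (a : dform k) : Prop :=
  (forall x, U x -> alternating (a x)) /\
  forall (W : set M) (X : 'I_k -> vfield), open W -> W `<=` U ->
    (forall i, smooth_vfield W (X i)) ->
    smooth W (fun y => a y (fun i => X i y)).

(* The value of the field at y whose components in the coordinates [chart x]
   are constant, equal to those of the tangent vector v at x.  It is a smooth
   field on [chart_dom x] extending v. *)
Definition const_field (x : M) (v : E) : vfield :=
  fun y => \row_j 'D_v (fun u => chart y (chart_inv x u) 0 j) (chart x y).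

(* Exterior derivative at x, in the coordinates [chart x]: Koszul's formula on
   coordinate-constant fields, all of whose brackets vanish. *)
Definition ext_d k (a : dform k) : dform k.+1 :=
  fun x v => \sum_(i < k.+1) (-1) ^+ i *
    dir (fun y => a y (fun j => const_field x (v (lift i j)) y)) x (v i).

Definition differential (f : M -> R) (x : M) : E :=
  covector (ext_d (fn_form f) x).

Definition smooth_mvector k (U : set M) (Q : mvector k) : Prop :=
  (forall x, U x -> alternating (Q x)) /\
  forall (W : set M) (f : 'I_k -> M -> R), open W -> W `<=` U ->
    (forall i, smooth W (f i)) ->
    smooth W (fun y => Q y (fun i => differential (f i) y)).

(* On a surface this is an area form; it fixes the orientation. *)
Definition volume_form (U : set M) (Om : dform n) : Prop :=
  smooth_form U Om /\ forall x, U x -> exists v, Om x v != 0.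

(* [X, Y] at x; the j-th component is its action on the j-th coordinate of
   [chart x]. *)
Definition bracket (X Y : vfield) : vfield :=
  fun x => \row_j
    let c := fun y => chart x y 0 j in
    (dir (fun y => dir c y (Y y)) x (X x) -
     dir (fun y => dir c y (X y)) x (Y x)).

(* (L_X a)(V_1, .., V_k) =
     X (a (V_1, .., V_k)) - sum_i a (V_1, .., [X, V_i], .., V_k). *)
Definition lie k (X : vfield) (a : dform k) : dform k :=
  fun x v =>
    dir (fun y => a y (fun j => const_field x (v j) y)) x (X x) -
    \sum_i a x (update v i (bracket X (const_field x (v i)) x)).

(* A smooth flow of X on U, on an open flow domain D; the maximal flow and all
   its restrictions are of this form.  Joint smoothness in time and space is
   tested in charts, with coordinates (t, u). *)
Record is_flow (U : set M) (X : vfield) (D : set (R * M)%type)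
    (phi : R -> M -> M) : Prop := IsFlow {
  flow_open : open D;
  flow_dom : forall t x, D (t, x) -> U x /\ U (phi t x);
  flow_interval : forall x, is_interval [set t | D (t, x)];
  flow_start : forall t x, D (t, x) -> D (0, x) /\ phi 0 x = x;
  flow_continuous : forall t x, D (t, x) ->
    {for (t, x), continuous (fun p : (R * M)%type => phi p.1 p.2)};
  flow_smooth : forall (V : set M) (f : M -> R) (x0 : M), open V ->
    smooth V f ->
    Cinfty [set z : 'rV[R]_(1 + n) | exists t x,
              [/\ z = row_mx t%:M (chart x0 x), chart_dom x0 x,
                  D (t, x) & V (phi t x)]]
           (fun z => f (phi (lsubmx z 0 0) (chart_inv x0 (rsubmx z))));
  flow_ode : forall t x (V : set M) (f : M -> R), D (t, x) ->
    open V -> V (phi t x) -> smooth V f ->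
    is_derive t 1 (fun s => f (phi s x)) (dir f (phi t x) (X (phi t x))) }.

End Manifold.

Section Maps.
Variables (R : realType) (m n : nat) (M : manifold R m) (N : manifold R n).

Definition smooth_map (U : set M) (F : M -> N) : Prop :=
  (forall x, U x -> {for x, continuous F}) /\
  forall (V : set N) (f : N -> R), open V -> smooth V f ->
    smooth (U `&` F @^-1` V) (f \o F).

Definition tangent_map (F : M -> N) (x : M) (v : 'rV[R]_m) : 'rV[R]_n :=
  \row_j dir (fun y => chart (F x) (F y) 0 j) x v.

Definition pullback k (F : M -> N) (a : dform N k) : dform M k :=
  fun x v => a (F x) (fun i => tangent_map F x (v i)).

Definition fiber_bundle (F : M -> N) : Prop :=
  [/\ smooth_map setT F,
      (forall b, exists x, F x = b) &
      (forall x w, exists v, tangent_map F x v = w)].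

End Maps.

Definition flow_invariant (R : realType) n (M : manifold R n) k (U : set M)
    (X : vfield M) (a : dform M k) : Prop :=
  forall D phi, is_flow U X D phi ->
  forall t x, D (t, x) -> pullback (phi t) a x = a x.

(** * Poisson calculus *)

Section Poisson.
Variables (R : realType) (n : nat) (M : manifold R n).

(* X_f = i_df P, as the vector whose j-th component is P (df, e^j). *)
Definition ham (P : mvector M 2) (f : M -> R) : vfield M :=
  fun x => \row_j insert (differential f x) (P x) (fun=> basis_vec R j).

Definition casimir (U : set M) (P : mvector M 2) (h : M -> R) : Prop :=
  smooth U h /\ forall x, U x -> ham P h x = 0.

Definition is_divergence (U : set M) (Om : dform M n) (X : vfield M)
    (delta : M -> R) : Prop :=
  forall x, U x -> forall v, lie X Om x v = delta x * Om x v.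

Definition modular_vfield (U : set M) (Om : dform M n) (P : mvector M 2)
    (Z : vfield M) : Prop :=
  smooth_vfield U Z /\
  forall f, smooth U f -> is_divergence U Om (ham P f) (fun x => dir f x (Z x)).

(* Another choice of Om changes the modular field by a Hamiltonian field, so
   unimodularity does not depend on Om. *)
Definition unimodular (U : set M) (Om : dform M n) (P : mvector M 2) : Prop :=
  exists Z, modular_vfield U Om P Z /\
  exists f, smooth U f /\ forall x, U x -> Z x = ham P f x.

Definition invariant_volume (U : set M) (P : mvector M 2) (Om : dform M n) :
    Prop :=
  volume_form U Om /\ forall f, smooth U f -> flow_invariant U (ham P f) Om.

End Poisson.

(** * Connections and Poisson triples *)

Section Connection.
Variables (R : realType) (m n : nat) (M : manifold R m) (B : manifold R n).
Variable (pi : M -> B).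

Definition vertical (x : M) : set 'rV[R]_m :=
  [set v | tangent_map pi x v = 0].

(* An Ehresmann connection is a field of matrices acting on tangent (row)
   vectors by v |-> v *m g x. *)
Definition connection (g : M -> 'M[R]_m) : Prop :=
  [/\ (forall x v, vertical x (v *m g x)),
      (forall x v, vertical x v -> v *m g x = v) &
      (forall (W : set M) (X : vfield M), open W -> smooth_vfield W X ->
         smooth_vfield W (fun x => X x *m g x))].

Variable (g : M -> 'M[R]_m).

Definition horizontal (x : M) : set 'rV[R]_m := [set v | v *m g x = 0].

(* Component of bidegree (p, k - p) of a k-form. *)
Definition bicomp k (p : nat) (a : dform M k) : dform M k :=
  fun x v => \sum_(S : {set 'I_k} | #|S| == p)
    a x (fun i => if i \in S then v i - v i *m g x else v i *m g x).

(* d_{1,0}, d_{0,1} and d_{2,-1} of a k-form of bidegree (p, k - p). *)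
Definition d10 k (p : nat) (a : dform M k) : dform M k.+1 :=
  bicomp p.+1 (ext_d a).
Definition d01 k (p : nat) (a : dform M k) : dform M k.+1 :=
  bicomp p (ext_d a).
Definition d2m1 k (p : nat) (a : dform M k) : dform M k.+1 :=
  bicomp p.+2 (ext_d a).

(* The unique horizontal vector at x above the tangent vector w at pi x. *)
Definition hor_vec (x : M) (w : 'rV[R]_n) : 'rV[R]_m :=
  get [set v | horizontal x v /\ tangent_map pi x v = w].

(* Horizontal lift: image of psi under the lift of tangent vectors, i.e. psi
   evaluated on the covectors of B obtained by composition with that lift. *)
Definition hor_lift k (psi : mvector B k) : mvector M k :=
  fun x a => psi (pi x)
    (fun i => \row_j pairing (a i) (hor_vec x (basis_vec R j))).

End Connection.

Section PoissonTriple.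
Variables (R : realType) (M : manifold R 5) (B : manifold R 2) (pi : M -> B).
Variables (Om : dform M 5) (om : dform B 2) (g : M -> 'M[R]_5).

Definition OmH : dform M 2 := pullback pi om.

(* The vertical form and the multivector fields determined by the volume form
   Om, the area form om and the connection g. *)
Record bundle_data (OmV : dform M 3) (QH : mvector M 2) (QV : mvector M 3)
    (psi : mvector B 2) : Prop := BundleData {
  OmV_smooth : smooth_form setT OmV;
  OmV_vertical : forall x, kills (horizontal g x) (OmV x);
  OmV_def : forall x, Om x = wedge_prod (OmH x) (OmV x);
  QH_smooth : smooth_mvector setT QH;
  QH_horizontal : forall x, kills (annihilator (horizontal g x)) (QH x);
  QH_def : forall x, contract (m := 0) (QH x) (OmH x) = fun=> 1;
  QV_smooth : smooth_mvector setT QV;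
  QV_vertical : forall x, kills (annihilator (vertical pi x)) (QV x);
  QV_def : forall x, contract (m := 0) (QV x) (OmV x) = fun=> 1;
  psi_smooth : smooth_mvector setT psi;
  psi_def : forall b, contract (m := 0) (psi b) (om b) = fun=> -1 }.

(* P_beta = - i_beta Q_V. *)
Definition vertical_tensor (QV : mvector M 3) (beta : dform M 1) :
    mvector M 2 :=
  fun x a => - insert (covector (beta x)) (QV x) a.

(* theta = - i_{Q_V} d_{1,0} Omega^V and rho = i_{Q_H} d_{2,-1} Omega^V. *)
Definition theta (OmV : dform M 3) (QV : mvector M 3) : dform M 1 :=
  fun x v => - contract (m := 1) (QV x) (d10 g 0 OmV x) v.

Definition rho (OmV : dform M 3) (QH : mvector M 2) : dform M 2 :=
  fun x => contract (m := 2) (QH x) (d2m1 g 0 OmV x).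

Record poisson_triple (OmV : dform M 3) (QH : mvector M 2) (QV : mvector M 3)
    (kappa : M -> R) (beta : dform M 1) : Prop := PoissonTriple {
  triple_connection : connection pi g;
  triple_kappa : smooth setT kappa;
  triple_beta : smooth_form setT beta;
  triple_beta_vertical : forall x, kills (horizontal g x) (beta x);
  triple_eq1 : forall x v, wedge_prod (d01 g 0 beta x) (beta x) v = 0;
  triple_eq2 : forall x v,
    kappa x * (d10 g 0 beta x v - wedge_prod (theta OmV QV x) (beta x) v) = 0;
  triple_eq3 : forall x v,
    wedge_prod (d01 g 0 (fn_form kappa) x) (beta x) v
      - kappa x ^+ 2 * rho OmV QH x v = 0 }.

Definition coupling_tensor (QV : mvector M 3) (psi : mvector B 2)
    (kappa : M -> R) (beta : dform M 1) : mvector M 2 :=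
  fun x a => kappa x * hor_lift pi g psi x a + vertical_tensor QV beta x a.

End PoissonTriple.

(* Main.v *)
From HB Require Import structures.
From mathcomp Require Import all_boot all_order all_algebra.
From mathcomp Require Import perm.
From mathcomp Require Import all_classical all_reals all_analysis.
From mathcomp Require Import zify ring lra.
Require Import Defs.
Set Implicit Arguments.
Unset Strict Implicit.
Unset Printing Implicit Defensive.
Import Order.TTheory GRing.Theory Num.Theory.
Import numFieldNormedType.Exports.
Local Open Scope classical_set_scope.
Local Open Scope ring_scope.

(** Let A = kappa Omega^V + beta /\ pi^* omega.  Up to a constant factor c this
    3-form is dual to Pi: Pi (a, b) Omega = c a /\ b /\ A.  Hence
    div_Omega (X_f) Omega = c df /\ dA, and for every function f0
    the difference between the modular field of Pi and the Hamiltonian field of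
    f0 is governed by the 4-form dA + df0 /\ A, in the sense that they agree iff
    df /\ (dA + df0 /\ A) = 0 for all f; similarly the volume form s Omega is
    invariant iff the same holds with df0 replaced by ds / s.  In a frame adapted
    to the splitting into horizontal and vertical vectors, d_{0,1} beta = 0 makes
    the contribution of d (beta /\ pi^* omega) disappear, and the equation
    d_{0,1} kappa /\ beta = kappa^2 rho of a Poisson triple eliminates
    d_{2,-1} Omega^V.  Where kappa <> 0, dA + df0 /\ A therefore vanishes iff
    theta = - lambda on horizontal vectors and lambda /\ beta = 0 on vertical
    ones, with lambda = d (f0 + ln |kappa|); the last condition says that
    h = f0 + ln |kappa| is a Casimir function of P_beta.  Where kappa vanishes
    identically, dA = 0.

    A top-degree form with vanishing Lie derivative is invariant because, in
    charts, t |-> det (Jacobian of the flow) * (coefficient of the form along the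
    flow line) has derivative zero. *)

(** Smoothness means iterated partial derivatives along basis vectors, so total differentiability,
    the chain rule and the symmetry of second derivatives are proved first. That symmetry yields the
    divergence formula: times the density of the volume form, the components of X_f are up to sign
    the coefficients of df /\ A, so the divergence is -d (df /\ A) = df /\ dA. The modular field is
    tested only by functions smooth on the whole domain, but the criterion is needed for every
    covector; bump functions close the gap. In an adapted frame a 4-form has five components, one
    per omitted frame vector. Omitting a horizontal vector gives the equation for theta, omitting a
    vertical one a component of lambda /\ beta. The constant c is not computed: c <> 0 because Omega
    vanishes nowhere. Signs: [contract] reverses the inserted vectors, an odd permutation for two
    and for three vectors alike, so on the frame Q_V is -1/mu and psi is 1/w; with P_beta = - i_beta
    Q_V both summands of Pi get the same sign. As kappa may be negative, ln |kappa| appears; e^h /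
    kappa still has logarithmic differential dh - d kappa / kappa. *)

Lemma diff_criterion (R : realType) (V W : normedModType R) (f : V -> W)
    (L : {linear V -> W}) (y : V) : continuous L ->
  (forall eps, 0 < eps ->
     \forall h \near 0, `|f (h + y) - f y - L h| <= eps * `|h|) ->
  differentiable f y /\ 'd f y = L :> (V -> W).
Proof.
move=> Lc fL.
have fE : f \o shift y = cst (f y) + L +o_ 0 id.
  apply/eqaddoP => eps /fL; apply: filterS => h; rewrite /= opprD addrA.
  by rewrite -![(_ + _ : _ -> _) _]/(_ + _) -![(- _ : _ -> _) _]/(- _).
have dE : 'd f y = L :> (V -> W) by exact: diff_unique.
by split=> //; apply/diff_locallyP; rewrite dE.
Qed.

(** * Smooth functions on R^n *)

Section EuclideanCalculus.
Variables (R : realType) (n : nat).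
Notation E := 'rV[R]_n.
Implicit Types (f g : E -> R) (O : set E) (y v : E).

Lemma line_derive f y v (t : R) : derivable f (y + t *: v) v ->
  is_derive t 1 (fun s => f (y + s *: v)) ('D_v f (y + t *: v)).
Proof.
move=> fv.
have e : (fun h : R => h^-1 *: (((fun s => f (y + s *: v)) \o shift t) (h *: 1)
      - f (y + t *: v))) =
    (fun h => h^-1 *: ((f \o shift (y + t *: v)) (h *: v) - f (y + t *: v))).
  apply/funext => h /=; congr (_ *: (f _ - _)).
  by rewrite [h%:A]mulr1 scalerDl addrCA addrA.
by split; rewrite /derivable /derive e.
Qed.

Lemma shift_derive f y c v : derivable f (y + c) v ->
  is_derive y v (fun z => f (z + c)) ('D_v f (y + c)).
Proof.
move=> fv.
have e : (fun h : R => h^-1 *: (((fun z => f (z + c)) \o shift y) (h *: v)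
      - f (y + c))) =
    (fun h => h^-1 *: ((f \o shift (y + c)) (h *: v) - f (y + c))).
  by apply/funext => h /=; rewrite addrA.
by split; rewrite /derivable /derive e.
Qed.

(** The one-variable mean value theorem on the line through [y], in a form indifferent to the sign
    of [c]: coordinate increments may be negative, while [MVT_segment] wants an ordered interval. *)
Lemma line_MVT f y v (c : R) :
  (forall t : R, `|t| <= `|c| -> derivable f (y + t *: v) v) ->
  exists2 t, `|t| <= `|c| &
    f (y + c *: v) - f y = c * 'D_v f (y + t *: v).
Proof.
move=> fv; pose phi s := f (y + s *: v).
have dphi (t : R) : `|t| <= `|c| -> is_derive t 1 phi ('D_v f (y + t *: v)).
  by move=> /fv; exact: line_derive.
have cphi (a b : R) : (forall t, t \in `[a, b] -> `|t| <= `|c|) ->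
    {within `[a, b], continuous phi}.
  by move=> ab; apply: derivable_within_continuous => t /ab /dphi [].
have e0 : f y = phi 0 by rewrite /phi scale0r addr0.
have [c0|c0] := leP 0 c.
  have sub t : t \in `[0, c] -> `|t| <= `|c|.
    by rewrite in_itv /= => /andP[t0 tc]; rewrite !ger0_norm.
  have [t tc e] := MVT_segment c0
    (fun t h => dphi t (sub t (subset_itv_oo_cc h))) (cphi _ _ sub).
  by exists t; [exact: sub|rewrite e0 [LHS]e subr0 mulrC].
have sub t : t \in `[c, 0] -> `|t| <= `|c|.
  by rewrite in_itv /= => /andP[ct t0]; rewrite !ler0_norm ?lerN2 // ltW.
have [t tc e] := MVT_segment (ltW c0)
  (fun t h => dphi t (sub t (subset_itv_oo_cc h))) (cphi _ _ sub).
exists t; first exact: sub.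
by rewrite e0 -[LHS]opprB e sub0r mulrN opprK mulrC.
Qed.

Lemma coord_le_norm y i : `|y 0 i| <= `|y|.
Proof.
rewrite [leRHS]/Num.norm /= mx_normrE.
exact: (le_bigmax _ (fun ij => `|y ij.1 ij.2|) (0, i)).
Qed.

Lemma norm_lt_coord y (d : R) : 0 < d -> (forall i, `|y 0 i| < d) -> `|y| < d.
Proof.
move=> d0 yd; rewrite [ltLHS]/Num.norm /= mx_normrE.
by apply/bigmax_ltP; split=> // -[i j] _ /=; rewrite ord1.
Qed.

(** Corners of a staircase from [y] to [y + h]: between [y + truncate i h] and [y + truncate i.+1 h]
    only coordinate [i] moves, so that a partial derivative controls the increment. *)
Definition truncate (k : nat) y : E := \row_j (if (j < k)%N then y 0 j else 0).

Lemma truncateS (i : 'I_n) y :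
  truncate i.+1 y = truncate i y + y 0 i *: basis_vec R i.
Proof.
apply/rowP => j; rewrite !mxE eqxx /= ltnS leq_eqVlt.
have [->|ij] := eqVneq j i; first by rewrite eqxx ltnn /= mulr1 add0r.
by rewrite (negbTE (_ : (j : nat) != i)) // mulr0 addr0.
Qed.

(** The increment of [f] is telescoped along the staircase of [truncate]. On each edge [line_MVT]
    replaces it by a partial derivative at a nearby point, and continuity of the partial derivatives
    moves that point to [y]. *)
Lemma C1_diff f y :
  (forall i, \forall z \near y, derivable f z (basis_vec R i)) ->
  (forall i, {for y, continuous ('D_(basis_vec R i) f)}) ->
  differentiable f y /\
  forall v, 'D_v f y = \sum_i v 0 i * 'D_(basis_vec R i) f y.
Proof.
move=> df cf.
pose L (v : E) : R := \sum_i v 0 i * 'D_(basis_vec R i) f y.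
have L_lin : linear L.
  move=> a u w; rewrite /L scaler_sumr -big_split /=; apply: eq_bigr => i _.
  by rewrite !mxE mulrDl -mulrA.
pose Lm := GRing.isLinear.Build _ _ _ _ _ L_lin.
pose Ll : {linear E -> R} := HB.pack L Lm.
have L_cont : continuous Ll.
  rewrite (_ : (Ll : E -> R) = \sum_i (fun v : E => v 0 i * 'D_(basis_vec R i) f y)).
    move=> x; apply: (@big_ind _ (fun g : E -> R => {for x, continuous g})).
    - exact: cst_continuous.
    - by move=> g h; exact: continuousD.
    - move=> i _; apply: (@continuousM R E (fun v : E => v 0 i)).
        exact: coord_continuous.
      exact: cst_continuous.
  by apply/funext => v; rewrite fct_sumE.
have [dfy dE] : differentiable f y /\ 'd f y = Ll :> (E -> R).
  apply: diff_criterion => // eps eps0.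
  (* Each of the [n] edges may cost this share of [eps]; [n.+1] keeps the divisor nonzero when [n]
     is 0. *)
  have e0 : 0 < eps / n.+1%:R by rewrite divr_gt0.
  have dn (i : 'I_n) : \forall z \near y, derivable f z (basis_vec R i) /\
      `|'D_(basis_vec R i) f z - 'D_(basis_vec R i) f y| <= eps / n.+1%:R.
    apply: filterI; first exact: df.
    have /cvgrPdist_le /(_ _ e0) := cf i.
    by apply: filterS => z; rewrite distrC.
  have [d /= d0 dP] := (nbhs_ballP _ _).1 (filter_forall _ dn).
  near=> h.
  have hd : `|h| < d.
    near: h; apply/nbhs_ballP; exists d => // z.
    by rewrite -ball_normE /ball_ /= sub0r normrN.
  (* The norm is the maximum of the coordinates, so the whole staircase stays in the ball that
     contains [y + h]. *)
  have inball (z : E) : (forall i, `|z 0 i| <= `|h|) -> ball y d (y + z).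
    move=> zh; rewrite -ball_normE /ball_ /= opprD addrA subrr sub0r normrN.
    by apply: norm_lt_coord => // i; rewrite (le_lt_trans (zh i)).
  have step (i : 'I_n) : exists2 c,
      `|c - 'D_(basis_vec R i) f y| <= eps / n.+1%:R &
      f (y + truncate i.+1 h) - f (y + truncate i h) = h 0 i * c.
    have inb (t : R) : `|t| <= `|h 0 i| ->
        ball y d (y + truncate i h + t *: basis_vec R i).
      move=> th; rewrite -addrA; apply: inball => j; rewrite !mxE eqxx /=.
      have [->|ij] := eqVneq j i.
        by rewrite ltnn mulr1 add0r (le_trans th) // coord_le_norm.
      rewrite mulr0 addr0; case: ifP => _; first exact: coord_le_norm.
      by rewrite normr0.
    have [t th e] := @line_MVT f (y + truncate i h) (basis_vec R i) (h 0 i)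
      (fun t th => (dP _ (inb t th) i).1).
    exists ('D_(basis_vec R i) f (y + truncate i h + t *: basis_vec R i)).
      exact: (dP _ (inb t th) i).2.
    by rewrite truncateS addrA.
  have /choice[c cP] : forall i : 'I_n, exists c,
      `|c - 'D_(basis_vec R i) f y| <= eps / n.+1%:R /\
      f (y + truncate i.+1 h) - f (y + truncate i h) = h 0 i * c.
    by move=> i; have [c] := step i; exists c.
  have tele : f (h + y) - f y = \sum_i h 0 i * c i.
    have -> : h + y = y + truncate n h.
      by rewrite addrC; congr (_ + _); apply/rowP => j; rewrite mxE ltn_ord.
    have {2}-> : y = y + truncate 0 h.
      rewrite -[LHS]addr0; congr (_ + _); apply/rowP => j.
      by rewrite !mxE ltn0.
    rewrite -(telescope_sumr (fun k => f (y + truncate k h))) // big_mkord.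
    by apply: eq_bigr => i _; rewrite (cP i).2.
  rewrite tele /L -sumrB.
  apply: (le_trans (ler_norm_sum _ _ _)).
  apply: (@le_trans _ _ (\sum_(i < n) (`|h| * (eps / n.+1%:R)))).
    apply: ler_sum => i _; rewrite -mulrBr normrM.
    by apply: ler_pM => //; [exact: coord_le_norm|exact: (cP i).1].
  rewrite sumr_const card_ord -[leLHS]mulr_natr -mulrA [leRHS]mulrC.
  apply: ler_wpM2l => //; rewrite mulrAC ler_pdivrMr ?ltr0n //.
  by apply: ler_wpM2l; [exact: ltW|rewrite ler_nat].
by split=> // v; rewrite deriveE // dE.
Unshelve. all: by end_near. Qed.

Lemma near_distC (F : 'rV[R]_n -> R) y eps : {for y, continuous F} -> 0 < eps ->
  \forall z \near y, `|F z - F y| <= eps.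
Proof.
by move=> /cvgrPdist_le /[apply]; apply: filterS => z; rewrite distrC.
Qed.

(** The mean value theorem is applied twice: in direction [v] to [g z = f (z + s *: w) - f z], then
    in direction [w] to ['D_v f]. The second difference becomes [s ^+ 2] times a mixed derivative at
    a point near [y]. *)
Lemma second_difference f y v w :
    (\forall z \near y, derivable f z v /\ derivable ('D_v f) z w) ->
    {for y, continuous ('D_w ('D_v f))} ->
  forall eps, 0 < eps -> \forall s \near (0 : R),
    `|f (y + s *: v + s *: w) - f (y + s *: v) - (f (y + s *: w) - f y)
      - s ^+ 2 * 'D_w ('D_v f) y| <= eps * s ^+ 2.
Proof.
move=> df cf eps eps0.
have cf' : \forall z \near y, `|'D_w ('D_v f) z - 'D_w ('D_v f) y| <= eps.
  exact: near_distC.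
have [d /= d0 dP] := (nbhs_ballP _ _).1 (filterI df cf').
pose K := `|v| + `|w| + 1.
have K0 : 0 < K by rewrite ltr_pwDr // addr_ge0.
have near_s : \forall s \near (0 : R), `|s| * K < d.
  apply/nbhs_ballP; exists (d / K) => [|s] /=; first by rewrite divr_gt0.
  by rewrite -ball_normE /ball_ /= sub0r normrN ltr_pdivlMr.
apply: filterS near_s => s sd.
have inb (a b : R) : `|a| <= `|s| -> `|b| <= `|s| ->
    ball y d (y + (a *: v + b *: w)).
  move=> as_ bs; rewrite -ball_normE /ball_ /= opprD addrA subrr sub0r normrN.
  apply: le_lt_trans sd; apply: (le_trans (ler_normD _ _)).
  rewrite !normrZ /K mulrDr mulr1 mulrDr -[leLHS]addr0 !lerD ?ler_wpM2r //.
pose g z := f (z + s *: w) - f z.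
have dg (t : R) : `|t| <= `|s| -> is_derive (y + t *: v) v g
    ('D_v f (y + t *: v + s *: w) - 'D_v f (y + t *: v)).
  move=> ts; apply: is_deriveB.
    have [dv _] := (dP _ (inb t s ts (lexx _))).1.
    by rewrite addrA in dv; exact: shift_derive.
  have s0 : `|0 : R| <= `|s| by rewrite normr0.
  have [dv _] := (dP _ (inb t 0 ts s0)).1.
  by rewrite scale0r addr0 in dv; exact: derivableP dv.
have [t ts ->] := @line_MVT g y v s (fun t ts => (dg t ts).(ex_derive)).
rewrite (dg t ts).(derive_val).
have [|r rs ->] := @line_MVT ('D_v f) (y + t *: v) w s.
  by move=> r rs; have [_] := (dP _ (inb t r ts rs)).1; rewrite addrA.
have := (dP _ (inb t r ts rs)).2; rewrite addrA /= => h.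
rewrite expr2 mulrA -mulrBr normrM [`|s * s|]ger0_norm -?expr2 ?sqr_ge0 //.
by rewrite mulrC ler_wpM2r // sqr_ge0.
Qed.

(** Exchanging the middle terms turns the second difference for the directions [w], [v] into the one
    for [v], [w]. *)
Lemma second_differenceC (a b c d e k : R) :
  `|a - b - (c - d) - e| <= k -> `|a - c - (b - d) - e| <= k.
Proof. by rewrite (_ : a - b - (c - d) - e = a - c - (b - d) - e) //; ring. Qed.

Lemma close_to_common (A a b S e : R) : 0 < S ->
  `|A - S * a| <= e / 2 * S -> `|A - S * b| <= e / 2 * S -> `|a - b| <= e.
Proof.
move=> S0 ha hb; rewrite -(ler_pM2l S0) -{1}(gtr0_norm S0) -normrM.
rewrite (_ : S * (a - b) = (A - S * b) - (A - S * a)); last by ring.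
apply: (le_trans (ler_normB _ _)); apply: (le_trans (lerD hb ha)).
by rewrite -mulrDl -splitr mulrC.
Qed.

(** Both mixed derivatives approximate the same second difference divided by [s ^+ 2], so they
    differ by at most [eps] for every positive [eps]. *)
Lemma schwarz f y v w :
  (\forall z \near y, [/\ derivable f z v, derivable f z w,
     derivable ('D_v f) z w & derivable ('D_w f) z v]) ->
  {for y, continuous ('D_w ('D_v f))} -> {for y, continuous ('D_v ('D_w f))} ->
  'D_w ('D_v f) y = 'D_v ('D_w f) y.
Proof.
move=> df cvw cwv; apply/eqP; rewrite -subr_eq0 -normr_le0.
apply/ler_addgt0Pr => eps eps0; rewrite add0r.
have e2 : 0 < eps / 2 by rewrite divr_gt0.
have df1 : \forall z \near y, derivable f z v /\ derivable ('D_v f) z w.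
  by apply: filterS df => z [].
have df2 : \forall z \near y, derivable f z w /\ derivable ('D_w f) z v.
  by apply: filterS df => z [].
have h1 := second_difference df1 cvw e2.
have h2 := second_difference df2 cwv e2.
have [d /= d0 dP] := (nbhs_ballP _ _).1 (filterI h1 h2).
have d20 : 0 < d / 2 by rewrite divr_gt0.
have [|/= k1 k2] := dP (d / 2).
  rewrite -ball_normE /ball_ /= sub0r normrN gtr0_norm //.
  by rewrite ltr_pdivrMr // mulr2n mulrDr mulr1 ltrDl.
set s := d / 2 in d20 k1 k2.
have s2 : 0 < s ^+ 2 by rewrite exprn_gt0.
rewrite [y + s *: w + _]addrAC in k2.
exact: close_to_common s2 k1 (second_differenceC k2).
Qed.

End EuclideanCalculus.

(** * Closure properties of smooth functions on open subsets of R^n *)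

Section SmoothEuclidean.
Variables (R : realType) (n : nat).
Notation E := 'rV[R]_n.
Notation e_ := (basis_vec R).
Implicit Types (f g : E -> R) (O : set E) (y v : E).

Lemma basis_sum v : v = \sum_i v 0 i *: e_ i.
Proof. by rewrite {1}(row_sum_delta v). Qed.

Lemma Ck_continuous k O f y : Ck k O f -> O y -> {for y, continuous f}.
Proof. by case: k => [|k] [cf _]; exact: cf. Qed.

Lemma Ck_le k O f : Ck k.+1 O f -> Ck k O f.
Proof.
elim: k f => [|k IH] f [cf df]; split=> // i.
by have [di ci] := df i; split=> //; exact: IH.
Qed.

(** Continuity and derivability at [y] refer to the total function near [y], not to its restriction
    to [O]. Hence [Ck] is a condition on single points, and on singletons a function may be replaced
    by one that agrees with it locally. *)
Lemma Ck_pointwise k O f : (forall y, O y -> Ck k [set y] f) -> Ck k O f.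
Proof.
elim: k f => [|k IH] f fk; first by split=> // y /fk [] /(_ y erefl).
split=> [y /fk [] /(_ y erefl) // |i]; split.
  by move=> y /fk [_] /(_ i) [] /(_ y erefl).
by apply: IH => y /fk [_] /(_ i) [].
Qed.

Lemma Ck_sub k O O' f : O' `<=` O -> Ck k O f -> Ck k O' f.
Proof.
elim: k f => [|k IH] f OO' [cf df]; first by split=> // y /OO'; exact: cf.
split=> [y /OO'|i]; first exact: cf.
have [di ci] := df i; split=> [y /OO'|]; [exact: di|exact: IH].
Qed.

(** Functions that agree near [y] also agree near each point close to [y]; their partial derivatives
    then agree near [y], which carries the induction on [k]. *)
Lemma near_eq_Ck k y f g :
  (\forall z \near y, f z = g z) -> Ck k [set y] f -> Ck k [set y] g.
Proof.
have near_cont u w : (\forall z \near y, u z = w z) ->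
    {for y, continuous u} -> {for y, continuous w}.
  move=> uw cu; rewrite /prop_for /continuous_at -(nbhs_singleton uw).
  exact: cvg_trans (near_eq_cvg uw) cu.
elim: k f g => [|k IH] f g fg [cf df].
  by split=> // _ ->; apply: near_cont fg (cf y erefl).
split=> [_ ->|i]; first exact: near_cont fg (cf y erefl).
have [di ci] := df i; split.
  by move=> _ ->; exact: near_eq_derivable fg (di y erefl).
apply: IH ci; have fgi := nbhs_interior fg.
by apply: filterS fgi => z; exact: near_eq_derive.
Qed.

Lemma Cinfty_pointwise O f : (forall y, O y -> Cinfty [set y] f) -> Cinfty O f.
Proof. by move=> fO k; apply: Ck_pointwise => y /fO. Qed.

Lemma Cinfty_sub O O' f : O' `<=` O -> Cinfty O f -> Cinfty O' f.
Proof. by move=> OO' fO k; exact: Ck_sub (fO k). Qed.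

Lemma eq_Cinfty O f g : open O -> (forall y, O y -> f y = g y) ->
  Cinfty O f -> Cinfty O g.
Proof.
move=> oO fg fO; apply: Cinfty_pointwise => y Oy k.
apply: (@near_eq_Ck k y f g); last by apply: Ck_sub (fO k) => _ ->.
by apply: filterS fg (open_nbhs_nbhs (conj oO Oy)).
Qed.

Lemma Cinfty_continuous O f y : Cinfty O f -> O y -> {for y, continuous f}.
Proof. by move=> fO; exact: Ck_continuous (fO 0%N). Qed.

Lemma Cinfty_derivable O f i y : Cinfty O f -> O y -> derivable f y (e_ i).
Proof. by move=> fO Oy; have [_ /(_ i) [di _]] := fO 1%N; exact: di. Qed.

Lemma Cinfty_partial O f i : Cinfty O f -> Cinfty O ('D_(e_ i) f).
Proof. by move=> fO k; have [_ /(_ i) []] := fO k.+1. Qed.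

Lemma Ck1_diff O f y : open O -> Ck 1 O f -> O y ->
  differentiable f y /\ forall v, 'D_v f y = \sum_i v 0 i * 'D_(e_ i) f y.
Proof.
move=> oO [_ df] Oy; apply: C1_diff => i.
  by apply: filterS (open_nbhs_nbhs (conj oO Oy)); exact: (df i).1.
by have [_ [ci _]] := df i; exact: ci.
Qed.

Lemma Cinfty_diff O f y : open O -> Cinfty O f -> O y -> differentiable f y.
Proof. by move=> oO fO Oy; have [] := Ck1_diff oO (fO 1%N) Oy. Qed.

Lemma Cinfty_dirE O f y v : open O -> Cinfty O f -> O y ->
  'D_v f y = \sum_i v 0 i * 'D_(e_ i) f y.
Proof. by move=> oO fO Oy; have [] := Ck1_diff oO (fO 1%N) Oy. Qed.

Lemma Ck_cst k O (c : R) : Ck k O (cst c).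
Proof.
have cc : forall y : E, O y -> {for y, continuous (cst c)}.
  by move=> y _; exact: cst_continuous.
elim: k c cc => [|k IH] c cc; split=> // i.
split=> [y _|]; first exact: derivable_cst.
rewrite (_ : 'D_(e_ i) (cst c) = cst 0).
  by apply: IH => y _; exact: cst_continuous.
by apply/funext => y; rewrite derive_cst.
Qed.

Lemma Ck_add k O f g : open O -> Ck k O f -> Ck k O g -> Ck k O (f \+ g).
Proof.
move=> oO; elim: k f g => [|k IH] f g [cf df] [cg dg].
  by split=> // y Oy; apply: continuousD; [exact: cf|exact: cg].
split=> [y Oy|i]; first by apply: continuousD; [exact: cf|exact: cg].
have [di ci] := df i; have [di' ci'] := dg i.
split=> [y Oy|]; first by apply: derivableD; [exact: di|exact: di'].
apply: Ck_pointwise => y Oy.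
apply: (near_eq_Ck (f := 'D_(e_ i) f \+ 'D_(e_ i) g)).
  apply: filterS (open_nbhs_nbhs (conj oO Oy)) => z Oz.
  by rewrite deriveD //; [exact: di|exact: di'].
by apply: Ck_sub (IH _ _ ci ci') => _ ->.
Qed.

Lemma Ck_mul k O f g : open O -> Ck k O f -> Ck k O g -> Ck k O (f \* g).
Proof.
move=> oO; elim: k f g => [|k IH] f g fO gO.
  have [cf _] := fO; have [cg _] := gO.
  by split=> // y Oy; apply: continuousM; [exact: cf|exact: cg].
have fO' := Ck_le fO; have gO' := Ck_le gO.
have [cf df] := fO; have [cg dg] := gO.
split=> [y Oy|i]; first by apply: continuousM; [exact: cf|exact: cg].
have [di ci] := df i; have [di' ci'] := dg i.
split=> [y Oy|]; first by apply: derivableM; [exact: di|exact: di'].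
apply: Ck_pointwise => y Oy.
apply: (near_eq_Ck (f := (f \* 'D_(e_ i) g) \+ (g \* 'D_(e_ i) f))).
  apply: filterS (open_nbhs_nbhs (conj oO Oy)) => z Oz.
  by rewrite deriveM //; [exact: di|exact: di'].
by apply: (@Ck_sub _ O) => [_ -> //|]; apply: Ck_add => //; exact: IH.
Qed.

Lemma Ck_sum (I : Type) (r : seq I) (P : pred I) k O (F : I -> E -> R) :
  open O -> (forall i, P i -> Ck k O (F i)) ->
  Ck k O (fun y => \sum_(i <- r | P i) F i y).
Proof.
move=> oO FO; elim: r => [|i r IH].
  rewrite (_ : (fun y => _) = cst 0); first exact: Ck_cst.
  by apply/funext => y; rewrite big_nil.
have [Pi|nPi] := boolP (P i).
  rewrite (_ : (fun y => _) = F i \+ (fun y => \sum_(i <- r | P i) F i y)).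
    by apply: Ck_add => //; exact: FO.
  by apply/funext => y; rewrite big_cons Pi.
rewrite (_ : (fun y => _) = (fun y => \sum_(i <- r | P i) F i y)) //.
by apply/funext => y; rewrite big_cons (negbTE nPi).
Qed.

Lemma Cinfty_cst O (c : R) : Cinfty O (cst c).
Proof. by move=> k; exact: Ck_cst. Qed.

Lemma Cinfty_add O f g : open O -> Cinfty O f -> Cinfty O g ->
  Cinfty O (fun y => f y + g y).
Proof. by move=> oO fO gO k; exact: Ck_add. Qed.

Lemma Cinfty_mul O f g : open O -> Cinfty O f -> Cinfty O g ->
  Cinfty O (fun y => f y * g y).
Proof. by move=> oO fO gO k; exact: Ck_mul. Qed.

Lemma Cinfty_sum (I : Type) (r : seq I) (P : pred I) O (F : I -> E -> R) :
  open O -> (forall i, P i -> Cinfty O (F i)) ->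
  Cinfty O (fun y => \sum_(i <- r | P i) F i y).
Proof. by move=> oO FO k; apply: Ck_sum => // i /FO. Qed.

Lemma Cinfty_dir O f v : open O -> Cinfty O f -> Cinfty O ('D_v f).
Proof.
move=> oO fO; apply: (@eq_Cinfty _ (fun y => \sum_i v 0 i * 'D_(e_ i) f y)) => //.
  by move=> y Oy; rewrite (Cinfty_dirE _ oO fO).
apply: Cinfty_sum => // i _; apply: Cinfty_mul => //; first exact: Cinfty_cst.
exact: Cinfty_partial.
Qed.

Lemma Cinfty_coord O i : Cinfty O (fun y : E => y 0 i).
Proof.
have dc y v : 'D_v (fun y : E => y 0 i) y = v 0 i.
  have := derive_mx (@derivable_id R 'rV[R]_n y v).
  by rewrite derive_id => /matrixP /(_ 0 i); rewrite mxE.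
have cc : forall y : E, O y -> {for y, continuous (fun y : E => y 0 i)}.
  by move=> y _; exact: coord_continuous.
case=> [|k]; split=> // j; split=> [y _|].
  by apply: diff_derivable; exact: differentiable_coord.
rewrite (_ : 'D_(e_ j) _ = cst (e_ j 0 i)); first exact: Ck_cst.
by apply/funext => y; rewrite dc.
Qed.

Lemma Cinfty_schwarz O f y v w : open O -> Cinfty O f -> O y ->
  'D_w ('D_v f) y = 'D_v ('D_w f) y.
Proof.
move=> oO fO Oy; have oy := open_nbhs_nbhs (conj oO Oy).
have dO g u : Cinfty O g -> forall z, O z -> derivable g z u.
  by move=> gO z Oz; apply: diff_derivable; exact: Cinfty_diff gO Oz.
apply: schwarz.
- apply: filterS oy => z Oz.
  by split; apply: dO Oz; try exact: fO; apply: Cinfty_dir.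
- exact: Cinfty_continuous (Cinfty_dir w oO (Cinfty_dir v oO fO)) Oy.
- exact: Cinfty_continuous (Cinfty_dir v oO (Cinfty_dir w oO fO)) Oy.
Qed.

(* The family phi is closed under differentiation: psi a lists the coefficients
   and indices of phi a' as a linear combination of members of the family. *)
Lemma Ck_unary (I : Type) (phi : I -> R -> R) (S : set R) O f
    (psi : I -> seq (R * I)) :
  open O -> (forall y, O y -> S (f y)) -> Cinfty O f ->
  (forall a t, S t -> is_derive t 1 (phi a) (\sum_(p <- psi a) p.1 * phi p.2 t)) ->
  forall a, Cinfty O (phi a \o f).
Proof.
move=> oO fS fO dphi.
have cphi a y : O y -> {for y, continuous (phi a \o f)}.
  move=> Oy; apply: continuous_comp; first exact: Cinfty_continuous fO Oy.
  have [da _] := dphi a _ (fS _ Oy).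
  by apply: differentiable_continuous; apply/derivable1_diffP.
have dcomp a i y : O y -> is_derive y (e_ i) (phi a \o f)
    ((\sum_(p <- psi a) p.1 * phi p.2 (f y)) * 'D_(e_ i) f y).
  move=> Oy; have [da dv] := dphi a _ (fS _ Oy).
  have dfy := Cinfty_diff oO fO Oy.
  have dda : differentiable (phi a) (f y) by apply/derivable1_diffP.
  have dc : differentiable (phi a \o f) y by exact: differentiable_comp.
  split; first exact: diff_derivable.
  rewrite deriveE // diff_comp //= diff1E // -deriveE // derive1E.
  by rewrite dv /= mulrC.
move=> a k; elim: k a => [|k IH] a; first by split=> // y; exact: cphi.
split=> [y|i]; first exact: cphi.
split=> [y Oy|]; first by have [] := dcomp a i y Oy.
apply: Ck_pointwise => y Oy.
apply: (near_eq_Ck (f := fun y =>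
   (\sum_(p <- psi a) p.1 * (phi p.2 \o f) y) * 'D_(e_ i) f y)).
  apply: filterS (open_nbhs_nbhs (conj oO Oy)) => z Oz.
  by have [_ ->] := dcomp a i z Oz.
apply: (@Ck_sub _ O) => [_ -> //|]; apply: Ck_mul => //; last first.
  exact: Cinfty_partial.
apply: Ck_sum => // p _; apply: Ck_mul => //; exact: Ck_cst.
Qed.

End SmoothEuclidean.

(** * Chain rule and composition of smooth maps *)

Section Composition.
Variables (R : realType) (m n : nat).
Implicit Types (f : 'rV[R]_m -> R) (G : 'rV[R]_n -> 'rV[R]_m).

Lemma diff_row G y : (forall j, differentiable (fun z => G z 0 j) y) ->
  differentiable G y.
Proof.
move=> dG.
have -> : G = \sum_j (fun z => G z 0 j *: basis_vec R j).
  by apply/funext => z; rewrite fct_sumE {1}(basis_sum (G z)).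
apply: differentiable_sum => j; exact: differentiableZl.
Qed.

Lemma chain_rule f G y v :
  differentiable f (G y) -> (forall j, differentiable (fun z => G z 0 j) y) ->
  differentiable (f \o G) y /\
  'D_v (f \o G) y = 'D_(\row_j 'D_v (fun z => G z 0 j) y) f (G y).
Proof.
move=> df dG; have dGy := diff_row dG.
have dc : differentiable (f \o G) y by exact: differentiable_comp.
split=> //; rewrite deriveE // diff_comp //= [RHS]deriveE //; congr ('d f _ _).
rewrite -deriveE // derive_mx; last exact: diff_derivable.
by apply/matrixP => i j; rewrite !mxE ord1.
Qed.

(** By the chain rule the partial derivatives of [f \o G] are sums of products of smooth functions
    with compositions of partial derivatives of [f] with [G], so the induction on the order is made
    for all [f] at once. *)
Lemma Cinfty_comp (O : set 'rV[R]_n) (P : set 'rV[R]_m) f G :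
  open O -> open P -> (forall y, O y -> P (G y)) -> Cinfty P f ->
  (forall j, Cinfty O (fun z => G z 0 j)) -> Cinfty O (f \o G).
Proof.
move=> oO oP GP fP GO k.
have dG y j : O y -> differentiable (fun z => G z 0 j) y.
  by move=> Oy; exact: Cinfty_diff (GO j) Oy.
have cG y : O y -> {for y, continuous G}.
  by move=> Oy; apply/differentiable_continuous/diff_row => j; exact: dG.
have cc g y : Cinfty P g -> O y -> {for y, continuous (g \o G)}.
  move=> gP Oy; apply: continuous_comp; first exact: cG.
  exact: Cinfty_continuous gP (GP _ Oy).
elim: k f fP => [|k IH] f fP; first by split=> // y; exact: cc.
have dc y i : O y -> differentiable (f \o G) y /\ 'D_(basis_vec R i) (f \o G) y =
    \sum_j 'D_(basis_vec R i) (fun z => G z 0 j) y * 'D_(basis_vec R j) f (G y).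
  move=> Oy; have [d1 ->] := chain_rule (basis_vec R i)
    (Cinfty_diff oP fP (GP _ Oy)) (fun j => dG y j Oy).
  split=> //; rewrite (Cinfty_dirE _ oP fP (GP _ Oy)); apply: eq_bigr => j _.
  by rewrite mxE.
split=> [y|i]; first exact: cc.
split=> [y Oy|]; first by apply: diff_derivable; exact: (dc y i Oy).1.
apply: Ck_pointwise => y Oy.
apply: (near_eq_Ck (f := fun y => \sum_j 'D_(basis_vec R i) (fun z => G z 0 j) y
   * (('D_(basis_vec R j) f) \o G) y)).
  apply: filterS (open_nbhs_nbhs (conj oO Oy)) => z Oz.
  by rewrite (dc z i Oz).2.
apply: (@Ck_sub _ _ _ O) => [_ -> //|]; apply: Ck_sum => // j _.
apply: Ck_mul => //; first exact: Cinfty_partial.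
by apply: IH; exact: Cinfty_partial.
Qed.

End Composition.

(** * Inverse, exponential and logarithm of smooth functions *)

Section ElementaryFunctions.
Variable R : realType.

Lemma is_derive_invX (k : nat) (t : R) : t != 0 ->
  is_derive t 1 (fun s => s^-1 ^+ k) (- k%:R * t^-1 ^+ k.+1).
Proof.
move=> t0.
have dV : is_derive t 1 (fun s : R => s^-1) (- t ^- 2).
  split; first exact: (derivableV (f := id)).
  by rewrite (deriveV (f := id)) // derive_id scaler1.
have := @is_deriveX R R _ k t 1 _ dV.
rewrite (_ : (fun s => s^-1) ^+ k = fun s : R => s^-1 ^+ k); last first.
  by apply/funext => s; elim: k => [|k IH]; rewrite ?expr0 // !exprS -IH.
move=> dX; apply: is_derive_eq dX _.
case: k => [|k]; first by rewrite mul0r scale0r oppr0 mul0r.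
rewrite -[LHS]/(_ * _) -mulrA mulrN -exprVn -exprD addn2 !mulNr mulrN //.
Qed.

Lemma is_derive_lnabs (t : R) : t != 0 -> is_derive t 1 (fun s : R => ln `|s|) t^-1.
Proof.
move=> t0; have [tp|tn|t00] := ltgtP 0 t; last by rewrite -t00 eqxx in t0.
  have := is_derive1_ln tp; apply: near_eq_is_derive.
  by near=> s; rewrite gtr0_norm //; near: s; exact: lt_nbhsr.
have tn' : 0 < - t by rewrite oppr_gt0.
have dl := is_derive1_ln tn'.
have dN := is_deriveNid t 1.
have := is_derive1_comp dl dN.
rewrite mulrN1 invrN opprK.
apply: near_eq_is_derive.
by near=> s; rewrite /= ltr0_norm //; near: s; exact: lt_nbhsl.
Unshelve. all: by end_near. Qed.

Variable n : nat.
Implicit Types (O : set 'rV[R]_n) (f : 'rV[R]_n -> R).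

(** The negative powers form a family closed under differentiation; the inverse is its member with
    exponent 1. *)
Lemma Cinfty_inv O f : open O -> (forall y, O y -> f y != 0) -> Cinfty O f ->
  Cinfty O (fun y => (f y)^-1).
Proof.
move=> oO f0 fO.
pose psi k := [:: (- k%:R : R, k.+1)].
apply: (@Ck_unary _ _ _ (fun k t => t^-1 ^+ k) [set t : R | t != 0] _ _ psi oO f0 fO _ 1%N).
by move=> k t t0; rewrite big_seq1; exact: is_derive_invX.
Qed.

Lemma Cinfty_expR O f : open O -> Cinfty O f -> Cinfty O (fun y => expR (f y)).
Proof.
move=> oO fO.
apply: (@Ck_unary _ _ unit (fun=> @expR R) setT _ _ (fun=> [:: (1, tt)]) oO _ fO _ tt) => //.
by move=> _ t _; rewrite big_seq1 mul1r; exact: is_derive_expR.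
Qed.

Lemma Cinfty_lnabs O f : open O -> (forall y, O y -> f y != 0) -> Cinfty O f ->
  Cinfty O (fun y => ln `|f y|).
Proof.
move=> oO f0 fO.
(* [None] stands for the logarithm, whose derivative is the member [Some 1] of the family of
   negative powers. *)
pose phi (o : option nat) (t : R) := if o is Some k then t^-1 ^+ k else ln `|t|.
pose psi (o : option nat) :=
  if o is Some k then [:: (- k%:R : R, Some k.+1)] else [:: (1, Some 1%N)].
apply: (@Ck_unary _ _ _ phi [set t : R | t != 0] _ _ psi oO f0 fO _ None).
move=> [k|] t /= t0; rewrite big_seq1 /=; first exact: is_derive_invX.
by rewrite mul1r expr1; exact: is_derive_lnabs.
Qed.

End ElementaryFunctions.

(** * Alternating multilinear functions *)

Section Alternating.
Variables (R : realType) (n : nat).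
Notation E := 'rV[R]_n.

Definition multilinear k (T : ('I_k -> E) -> R) : Prop :=
  forall v i (a : R) u w,
    T (update v i (a *: u + w)) = a * T (update v i u) + T (update v i w).

Lemma update_id k (v : 'I_k -> E) i : update v i (v i) = v.
Proof. by apply/funext => j; rewrite /update; case: eqP => [->|]. Qed.

Lemma update_same k (v : 'I_k -> E) i u : update v i u i = u.
Proof. by rewrite /update eqxx. Qed.

Lemma update_neq k (v : 'I_k -> E) i j u : j != i -> update v i u j = v j.
Proof. by rewrite /update => /negbTE ->. Qed.

Lemma update_comm k (v : 'I_k -> E) i j u w : i != j ->
  update (update v i u) j w = update (update v j w) i u.
Proof.
move=> ij; apply/funext => l; rewrite /update.
by case: (eqVneq l j) => // ->; rewrite eq_sym (negbTE ij).
Qed.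

Lemma update_lift k (v : 'I_k.+1 -> E) i u (j : 'I_k) :
  update v i u (lift i j) = v (lift i j).
Proof. by rewrite update_neq // eq_sym neq_lift. Qed.

Lemma ml_add k (T : ('I_k -> E) -> R) v i u w : multilinear T ->
  T (update v i (u + w)) = T (update v i u) + T (update v i w).
Proof. by move=> Tl; rewrite -[u]scale1r Tl mul1r scale1r. Qed.

Lemma ml_zero k (T : ('I_k -> E) -> R) v i : multilinear T -> v i = 0 -> T v = 0.
Proof.
move=> Tl vi; have := Tl v i (-1) 0 0.
by rewrite scaler0 addr0 mulN1r addNr -vi update_id.
Qed.

Lemma ml_sum k (T : ('I_k -> E) -> R) v i (I : finType) (c : I -> R) (u : I -> E) :
  multilinear T ->
  T (update v i (\sum_l c l *: u l)) = \sum_l c l * T (update v i (u l)).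
Proof.
move=> Tl; elim/big_rec2: _ => [|l x y _ <-]; last by rewrite Tl.
by apply: (ml_zero (i := i)) => //; rewrite update_same.
Qed.

(** The arguments are expanded over the spanning family [b] one after the other. This is how
    identities between multilinear functions are reduced to basis vectors. *)
Lemma ml_vanish k (T : ('I_k -> E) -> R) (b : 'I_n -> E) :
  (forall u, exists c, u = \sum_l c l *: b l) ->
  multilinear T -> (forall I, T (fun i => b (I i)) = 0) -> forall v, T v = 0.
Proof.
move=> span Tl Tb.
(* [m] counts the leading arguments that are still arbitrary; the remaining ones already belong to
   the family. *)
suff H m : (m <= k)%N -> forall v, (forall j : 'I_k, (m <= j)%N -> exists l, v j = b l) ->
    T v = 0.
  by move=> v; apply: (H k) => // j; rewrite leqNgt ltn_ord.
elim: m => [|m IH] mk v vb.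
  have /choice[I vI] : forall j, exists l, v j = b l by move=> j; exact: vb.
  by rewrite (_ : v = fun i => b (I i)) //; apply/funext.
have [c vc] := span (v (Ordinal mk)).
rewrite -(update_id v (Ordinal mk)) vc ml_sum // big1 // => l _.
rewrite IH ?mulr0 //; first exact: ltnW.
move=> j mj; have [->|jm] := eqVneq j (Ordinal mk).
  by rewrite update_same; exists l.
rewrite update_neq //; apply: vb; rewrite ltn_neqAle mj andbT eq_sym.
by apply: contra jm => /eqP jm; apply/eqP/val_inj.
Qed.

Lemma std_span u : exists c, u = \sum_l c l *: basis_vec R l :> E.
Proof. by exists (u 0); exact: row_sum_delta. Qed.

Lemma ml_expand k (T : ('I_k -> E) -> R) v : multilinear T ->
  T v = \sum_(I : {ffun 'I_k -> 'I_n})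
          (\prod_i v i 0 (I i)) * T (fun i => basis_vec R (I i)).
Proof.
move=> Tl; apply/eqP; rewrite -subr_eq0; apply/eqP.
move: v; apply: (ml_vanish std_span).
  move=> v i a u w; rewrite Tl [in RHS]mulrBr addrACA -opprD; congr (_ - _).
  rewrite mulr_sumr -big_split /=; apply: eq_bigr => I _.
  rewrite mulrA -mulrDl; congr (_ * _).
  have prodE x : \prod_l update v i x l 0 (I l) =
      x 0 (I i) * \prod_(l | l != i) v l 0 (I l).
    rewrite (bigD1 i) //= update_same; congr (_ * _).
    by apply: eq_bigr => l li; rewrite update_neq.
  by rewrite !prodE !mxE mulrDl -mulrA.
move=> I; apply/eqP; rewrite subr_eq0 (bigD1 (finfun I)) //=.
rewrite [X in _ == _ + X]big1 ?addr0.
  rewrite big1 ?mul1r => [|i _]; last by rewrite mxE ffunE !eqxx.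
  by apply/eqP; congr T; apply/funext => i; rewrite ffunE.
move=> J JI; have /existsP[i iJ] : [exists i, J i != I i].
  apply: contraR JI; rewrite negb_exists => /forallP JI.
  by apply/eqP/ffunP => i; rewrite ffunE; apply/eqP; have := JI i; rewrite negbK.
by rewrite (bigD1 i) //= mxE eqxx (negbTE iJ) !mul0r.
Qed.

(** Polarisation: [T] vanishes when both slots contain [v i + v j], and of the four terms of the
    expansion only the two mixed ones survive. *)
Lemma ml_swap k (T : ('I_k -> E) -> R) i j : multilinear T -> i != j ->
  (forall v, v i = v j -> T v = 0) -> forall v, T (v \o tperm i j) = - T v.
Proof.
move=> Tl ij Tz v; apply/eqP; rewrite -addr_eq0.
have := Tz (update (update v i (v i + v j)) j (v i + v j)).
rewrite update_neq // !update_same => /(_ erefl).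
rewrite ml_add // !(update_comm _ _ _ ij) !ml_add //.
rewrite [T (update (update v j (v i)) i (v i))]Tz; last first.
  by rewrite update_same update_neq 1?eq_sym // update_same.
rewrite [T (update (update v j (v j)) i (v j))]Tz; last first.
  by rewrite update_same update_neq 1?eq_sym // update_same.
rewrite add0r addr0 [update v j (v j)]update_id update_id => /eqP.
congr (_ + _ == _); congr T; apply/funext => l /=; rewrite /update.
by case: tpermP => [->|->|/eqP/negbTE -> /eqP/negbTE -> //]; rewrite ?eqxx // eq_sym (negbTE ij).
Qed.

Lemma alt_perm k (T : ('I_k -> E) -> R) (s : 'S_k) v : alternating T ->
  T (fun i => v (s i)) = (-1) ^+ s * T v.
Proof.
move=> [Tl Tz]; have [ts -> /allP dts] := prod_tpermP s.
elim: ts dts => [|[i j] ts IH] dts.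
  rewrite big_nil odd_perm1 mul1r; congr T; apply/funext => i.
  by rewrite perm1.
have ij : i != j by exact: (dts (i, j) (mem_head _ _)).
rewrite big_cons odd_mul_tperm ij /= signrN mulNr -IH; last first.
  by move=> x xts; apply: dts; rewrite inE xts orbT.
rewrite -(ml_swap Tl ij) => [|w wij]; last exact: Tz ij wij.
by congr T; apply/funext => l /=; rewrite permM.
Qed.

(** If two equal arguments are not adjacent, the right one is exchanged with its left neighbour,
    which by [ml_swap] only changes the sign; the induction is on their distance. *)
Lemma alt_adjacent k (T : ('I_k -> E) -> R) : multilinear T ->
  (forall v (i j : 'I_k), j = i.+1 :> nat -> v i = v j -> T v = 0) ->
  alternating T.
Proof.
move=> Tl Tz; split=> //.
suff H d v (i j : 'I_k) : j = (i + d.+1)%N :> nat -> v i = v j -> T v = 0.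
  move=> v i j ij vij; have [lij|lji|/val_inj e] := ltngtP i j.
  - by apply: (H (j - i).-1 v i j) => //; rewrite prednK ?subn_gt0 // subnKC // ltnW.
  - by apply: (H (i - j).-1 v j i) => //; rewrite prednK ?subn_gt0 // subnKC // ltnW.
  - by rewrite e eqxx in ij.
elim: d v i j => [|d IH] v i j eij vij.
  by apply: (Tz v i j) => //; rewrite eij addn1.
have lq : (i + d.+1 < k)%N by apply: ltnW; rewrite -addnS -eij.
pose q := Ordinal lq.
have qj : q != j by apply/eqP => /(congr1 val) /=; rewrite eij; lia.
have iq : i != q by apply/eqP => /(congr1 val) /=; lia.
have ij : i != j by apply/eqP => /(congr1 val) /=; rewrite eij; lia.
have sw := ml_swap Tl qj (fun w => @Tz w q j _).
rewrite -[v]/(v \o id) -[LHS]opprK -sw /=; last by rewrite eij addnS.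
apply/eqP; rewrite oppr_eq0; apply/eqP; apply: (IH _ i q) => //=.
by rewrite tpermL tpermD // eq_sym.
Qed.

(** The common pattern of [ext_d] and [wedge1]. If two adjacent arguments coincide, the two terms
    that single them out cancel, and in every other term both remain inside an alternating
    function. *)
Lemma alternating_insertion k (G : E -> ('I_k -> E) -> R) :
  (forall w a u u', G (a *: u + u') w = a * G u w + G u' w) ->
  (forall u, alternating (G u)) ->
  alternating (fun v : 'I_k.+1 -> E =>
    \sum_(i < k.+1) (-1) ^+ i * G (v i) (fun j => v (lift i j))).
Proof.
move=> Gl Ga; apply: alt_adjacent.
  move=> v i a u w; rewrite mulr_sumr -big_split /=; apply: eq_bigr => l _.
  rewrite mulrCA -mulrDr; congr (_ * _).
  have [->|li] := eqVneq l i.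
    rewrite !update_same Gl.
    by congr (_ * G _ _ + G _ _); apply/funext => j; rewrite !update_lift.
  rewrite !update_neq //; have [il eil] := unlift_some li.
  have e x : (fun j => update v i x (lift l j)) =
             update (fun j => v (lift l j)) il x.
    apply/funext => j; rewrite /update eil.
    by rewrite (inj_eq (@lift_inj _ l)).
  by rewrite !e (Ga _).1.
move=> v i j eij vij.
have ij : i != j by rewrite -val_eqE /= eij ltn_eqF.
rewrite (bigD1 i) //= (bigD1 j) 1?eq_sym //= big1 ?addr0.
  rewrite eij exprS mulN1r mulNr vij.
  rewrite (_ : (fun m => v (lift i m)) = (fun m => v (lift j m))) ?subrr //.
  apply/funext => m; have [mi|mi] := eqVneq (m : nat) i.
    have -> : lift i m = j by apply/val_inj; rewrite /= /bump mi leqnn eij.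
    have -> : lift j m = i by apply/val_inj; rewrite /= /bump eij mi ltnn.
    by [].
  congr v; apply/val_inj; rewrite /= /bump eij; congr (_ + m)%N.
  by rewrite leq_eqVlt eq_sym (negbTE mi).
move=> l /andP[li lj]; have [il ei] := unlift_some li; have [jl ej] := unlift_some lj.
have := ei; have := ej => _ _.
rewrite ((Ga _).2 _ il jl) ?mulr0 //; last by rewrite -ei -ej.
by apply: contra ij => /eqP e; rewrite ei ej e.
Qed.

(** The exterior product with a covector, in the same insertion form as [ext_d] instead of the sum
    over permutations of [wedge_prod]; this makes the Leibniz rule a termwise identity. *)
Definition wedge1 k (a : E) (T : ('I_k -> E) -> R) : ('I_k.+1 -> E) -> R :=
  fun v => \sum_(i < k.+1) (-1) ^+ i * (pairing a (v i) * T (fun j => v (lift i j))).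

Lemma pairingDr (a : E) (c : R) (u w : E) :
  pairing a (c *: u + w) = c * pairing a u + pairing a w.
Proof.
rewrite /pairing mulr_sumr -big_split /=; apply: eq_bigr => i _.
by rewrite !mxE mulrDr mulrCA.
Qed.

Lemma pairingDl (a b : E) (c : R) (u : E) : pairing (c *: a + b) u = c * pairing a u + pairing b u.
Proof.
rewrite /pairing mulr_sumr -big_split /=; apply: eq_bigr => i _.
by rewrite !mxE mulrDl mulrA.
Qed.

Lemma alternating_scale k (T : ('I_k -> E) -> R) c : alternating T ->
  alternating (fun v => c * T v).
Proof.
move=> [Tl Tz]; split=> [v i a u w|v i j ij e]; last by rewrite (Tz v i j) ?mulr0.
by rewrite Tl mulrDr mulrCA.
Qed.

Lemma alternating_add k (T S : ('I_k -> E) -> R) : alternating T -> alternating S ->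
  alternating (fun v => T v + S v).
Proof.
move=> [Tl Tz] [Sl Sz]; split=> [v i a u w|v i j ij e].
  by rewrite Tl Sl mulrDr addrACA.
by rewrite (Tz v i j) // (Sz v i j) // addr0.
Qed.

Lemma alternating_wedge1 k a (T : ('I_k -> E) -> R) : alternating T ->
  alternating (wedge1 a T).
Proof.
move=> Ta; apply: (alternating_insertion (G := fun u w => pairing a u * T w)).
  by move=> w c u u'; rewrite pairingDr mulrDl mulrA.
by move=> u; exact: alternating_scale.
Qed.

End Alternating.

(** * Alternating functions of top degree *)

Section TopDegree.
Variables (R : realType) (n : nat).
Notation E := 'rV[R]_n.
Notation rows_of v := (\matrix_(i < n, j < n) (v i : E) 0 j).

Lemma alternating_det : alternating (fun v : 'I_n -> E => \det (rows_of v)).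
Proof.
split=> [v i a u w|v i j ij e]; last first.
  by apply: (determinant_alternate ij) => l; rewrite !mxE e.
rewrite -[X in _ = _ + X]mul1r; apply: (determinant_multilinear (i0 := i)).
- by rewrite scale1r; apply/rowP => j; rewrite !mxE !update_same !mxE.
- by apply/matrixP => l j; rewrite !mxE !update_neq // eq_sym neq_lift.
- by apply/matrixP => l j; rewrite !mxE !update_neq // eq_sym neq_lift.
Qed.

(** The difference of both sides is alternating, hence vanishes on repeated basis vectors, and on a
    permuted basis both sides carry the sign of the permutation. *)
Lemma alt_top (T : ('I_n -> E) -> R) v : alternating T ->
  T v = \det (rows_of v) * T (@basis_vec R n).
Proof.
move=> Ta; have Da := alternating_det.
suff H w : T w + - T (@basis_vec R n) * \det (rows_of w) = 0.
  by have /eqP := H v; rewrite addr_eq0 => /eqP ->; rewrite mulNr opprK mulrC.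
have Ea : alternating (fun v => T v + (- T (@basis_vec R n)) * \det (rows_of v)).
  by apply: alternating_add => //; exact: alternating_scale.
move: w; apply: (ml_vanish (@std_span R n) Ea.1) => I.
have [Ii|/injectivePn[i [j ij e]]] := boolP (injectiveb I); last first.
  by apply: (Ea.2 _ i j) => //; rewrite e.
pose s := perm (injectiveP _ Ii).
have sI i : I i = s i by rewrite permE.
have ps : rows_of (fun i => basis_vec R (I i)) = perm_mx s.
  by apply/matrixP => i j; rewrite !mxE sI eqxx /= eq_sym.
have -> : T (fun i => basis_vec R (I i)) = (-1) ^+ s * T (@basis_vec R n).
  by rewrite -(alt_perm s) //; congr T; apply/funext => i; rewrite sI.
by rewrite ps det_perm mulNr mulrC addrN.
Qed.

(** The linearisation of multiplicativity of the determinant. Expanding each determinant along the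
    modified row gives the trace of [M *m L *m \adj M], where the adjugate and [M] combine to a
    scalar matrix. *)
Lemma alt_trace (T : ('I_n -> E) -> R) (L : 'M[R]_n) v : alternating T ->
  \sum_i T (update v i (v i *m L)) = \tr L * T v.
Proof.
move=> Ta; rewrite (alt_top v Ta) mulrA.
under eq_bigr do rewrite (alt_top _ Ta).
rewrite -mulr_suml; congr (_ * _); set M := rows_of v.
have -> : \tr L * \det M = \tr (M *m L *m \adj M).
  rewrite -mulmxA mxtrace_mulC -mulmxA mul_adj_mx.
  by rewrite mul_mx_scalar mxtraceZ mulrC.
rewrite /mxtrace; apply: eq_bigr => i _.
rewrite (expand_det_row _ i) mxE; apply: eq_bigr => j _; congr (_ * _).
  by rewrite !mxE update_same !mxE; apply: eq_bigr => l _; rewrite mxE.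
rewrite mxE; congr (_ * \det _).
by apply/matrixP => a b; rewrite !mxE update_neq // eq_sym neq_lift.
Qed.

End TopDegree.

(** * Calculus on manifolds *)

Section ManifoldCalculus.
Variables (R : realType) (n : nat) (M : manifold R n).
Notation E := 'rV[R]_n.
Notation e_ := (@basis_vec R n).
Implicit Types (x y z : M) (U W : set M) (f g : M -> R) (v w : E).

Lemma chart_image_open x W : open W -> W `<=` chart_dom x -> open (chart x @` W).
Proof.
move=> oW Wx; rewrite openE => _ [y Wy <-]; rewrite /interior.
have xy := Wx _ Wy.
have im : (chart x @` chart_dom x) (chart x y) by exists y.
have im_nbhs := open_nbhs_nbhs (conj (@chart_img_open _ _ M x) im).
have cW : nbhs (chart_inv x (chart x y)) W.
  by rewrite chartK //; exact: open_nbhs_nbhs.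
apply: filterS2 im_nbhs (chart_inv_continuous im cW) => u /= [z xz zu] Wu.
by exists z => //; rewrite -(chartK xz) zu.
Qed.

Lemma chart_image_openI x W : open W -> open (chart x @` (chart_dom x `&` W)).
Proof.
move=> oW; apply: chart_image_open; last by move=> y [].
by apply: openI => //; exact: chart_dom_open.
Qed.

Lemma chart_invK x y : chart_dom x y -> chart x (chart_inv x (chart x y)) = chart x y.
Proof. by move=> xy; rewrite chartK. Qed.

Lemma near_chart_inv x y (P : set M) : chart_dom x y ->
  (\forall z \near y, P z) -> \forall u \near chart x y, P (chart_inv x u).
Proof.
move=> xy Py; have im : (chart x @` chart_dom x) (chart x y) by exists y.
by apply: (chart_inv_continuous im); rewrite chartK.
Qed.

Lemma near_chart_dom x y : chart_dom x y -> \forall z \near y, chart_dom x z.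
Proof. by move=> xy; apply: open_nbhs_nbhs; split=> //; exact: chart_dom_open. Qed.

Lemma near_chart_image x y : chart_dom x y ->
  \forall u \near chart x y, chart x (chart_inv x u) = u.
Proof.
move=> xy; have im : (chart x @` chart_dom x) (chart x y) by exists y.
apply: filterS (open_nbhs_nbhs (conj (@chart_img_open _ _ M x) im)) => u [z xz <-].
exact: chart_invK.
Qed.

Lemma smooth_sub U W f : W `<=` U -> smooth U f -> smooth W f.
Proof.
move=> WU fU x; apply: Cinfty_sub (fU x).
by move=> _ [y [xy Wy] <-]; exists y => //; split=> //; exact: WU.
Qed.

Lemma smooth_local U f :
  (forall y, U y -> exists W, [/\ open W, W y & smooth W f]) -> smooth U f.
Proof.
move=> loc x; apply: Cinfty_pointwise => _ [y [xy Uy] <-].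
have [W [oW Wy fW]] := loc y Uy.
by apply: Cinfty_sub (fW x) => _ ->; exists y.
Qed.

Lemma eq_smooth U f g : open U -> (forall y, U y -> f y = g y) ->
  smooth U f -> smooth U g.
Proof.
move=> oU fg fU x; apply: eq_Cinfty (fU x); first exact: chart_image_openI.
by move=> _ [y [xy Uy] <-] /=; rewrite chartK // fg.
Qed.

(** By smoothness of the transition maps, one chart whose domain contains [W] is enough. *)
Lemma smooth_chart x W f : open W -> W `<=` chart_dom x ->
  Cinfty (chart x @` W) (f \o chart_inv x) -> smooth W f.
Proof.
move=> oW Wx fW z.
have oz : open (chart z @` (chart_dom z `&` W)) by exact: chart_image_openI.
apply: (eq_Cinfty (f := (f \o chart_inv x) \o (fun u => chart x (chart_inv z u)))) => //.
  by move=> _ [y [zy Wy] <-] /=; rewrite !chartK //; exact: Wx.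
apply: (Cinfty_comp (P := chart x @` W)) => //.
- exact: chart_image_open.
- by move=> _ [y [zy Wy] <-]; rewrite chartK //; exists y.
- move=> j; apply: Cinfty_sub (@chart_compatible _ _ M z x j).
  by move=> _ [y [zy Wy] <-]; exists y => //; split=> //; exact: Wx.
Qed.

Lemma smooth_cst U (c : R) : smooth U (fun=> c).
Proof. by move=> x; exact: Cinfty_cst. Qed.

Lemma smooth_add U f g : open U -> smooth U f -> smooth U g ->
  smooth U (fun y => f y + g y).
Proof.
move=> oU fU gU x.
exact: Cinfty_add (chart_image_openI oU) (fU x) (gU x).
Qed.

Lemma smooth_mul U f g : open U -> smooth U f -> smooth U g ->
  smooth U (fun y => f y * g y).
Proof.
move=> oU fU gU x.
exact: Cinfty_mul (chart_image_openI oU) (fU x) (gU x).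
Qed.

Lemma smooth_sum (I : Type) (r : seq I) (P : pred I) U (F : I -> M -> R) : open U ->
  (forall i, P i -> smooth U (F i)) -> smooth U (fun y => \sum_(i <- r | P i) F i y).
Proof.
move=> oU FU x.
by apply: (@Cinfty_sum R n I r P _ (fun i => F i \o chart_inv x)
  (chart_image_openI oU)) => i /FU.
Qed.

Lemma smooth_inv U f : open U -> (forall y, U y -> f y != 0) -> smooth U f ->
  smooth U (fun y => (f y)^-1).
Proof.
move=> oU f0 fU x; apply: (Cinfty_inv (chart_image_openI oU) _ (fU x)).
by move=> _ [y [xy Uy] <-] /=; rewrite chartK //; exact: f0.
Qed.

Lemma smooth_expR U f : open U -> smooth U f -> smooth U (fun y => expR (f y)).
Proof. by move=> oU fU x; exact: Cinfty_expR (chart_image_openI oU) (fU x). Qed.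

Lemma smooth_lnabs U f : open U -> (forall y, U y -> f y != 0) -> smooth U f ->
  smooth U (fun y => ln `|f y|).
Proof.
move=> oU f0 fU x; apply: (Cinfty_lnabs (chart_image_openI oU) _ (fU x)).
by move=> _ [y [xy Uy] <-] /=; rewrite chartK //; exact: f0.
Qed.

Lemma smooth_continuous U f y : open U -> smooth U f -> U y -> {for y, continuous f}.
Proof.
move=> oU fU Uy; have yy := chart_dom_mem y.
have c1 : {for chart y y, continuous (f \o chart_inv y)}.
  by apply: (Cinfty_continuous (fU y)); exists y.
have c2 : {for y, continuous ((f \o chart_inv y) \o chart y)}.
  by apply: continuous_comp c1; exact: chart_continuous.
rewrite /prop_for /continuous_at /= chartK // in c2.
apply: cvg_trans c2; apply: near_eq_cvg.
by apply: filterS (near_chart_dom yy) => z yz /=; rewrite chartK.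
Qed.

Lemma smooth_coord x j : smooth (chart_dom x) (fun y => chart x y 0 j).
Proof.
apply: (smooth_chart (x := x)) => //; first exact: chart_dom_open.
apply: (eq_Cinfty (f := fun u : E => u 0 j)).
- exact: chart_img_open.
- by move=> _ [y xy <-] /=; rewrite chart_invK.
- exact: Cinfty_coord.
Qed.

Lemma smooth_differentiable U f x y : open U -> smooth U f -> U y -> chart_dom x y ->
  differentiable (f \o chart_inv x) (chart x y).
Proof.
by move=> oU fU Uy xy; apply: (Cinfty_diff (chart_image_openI oU) (fU x)); exists y.
Qed.

Definition smooth_at y f := exists W, [/\ open W, W y & smooth W f].

Lemma smooth_atP U f y : open U -> smooth U f -> U y -> smooth_at y f.
Proof. by exists U. Qed.

Lemma smooth_at_diff f y : smooth_at y f -> differentiable (f \o chart_inv y) (chart y y).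
Proof.
move=> [W [oW Wy fW]]; exact: smooth_differentiable oW fW Wy (chart_dom_mem y).
Qed.

Lemma smooth_at_coord x y j : chart_dom x y -> smooth_at y (fun z => chart x z 0 j).
Proof.
move=> xy; exists (chart_dom x); split=> //; first exact: chart_dom_open.
exact: smooth_coord.
Qed.

Lemma dir_derivable f y v : smooth_at y f -> derivable (f \o chart_inv y) (chart y y) v.
Proof. by move=> fy; apply: diff_derivable; exact: smooth_at_diff. Qed.

Lemma dir_lin f y a v w : smooth_at y f ->
  dir f y (a *: v + w) = a * dir f y v + dir f y w.
Proof.
move=> /smooth_at_diff df; rewrite /dir !deriveE //.
by rewrite linearD linearZ.
Qed.

Lemma dir0 f y : dir f y 0 = 0.
Proof. exact: derive0. Qed.

Lemma dir_sumv f y v : smooth_at y f -> dir f y v = \sum_i v 0 i * dir f y (e_ i).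
Proof.
move=> fy; rewrite {1}(basis_sum v).
elim/big_rec2: _ => [|i a u _ <-]; first exact: dir0.
exact: dir_lin.
Qed.

Lemma eq_dir f g y v : (\forall z \near y, f z = g z) -> dir f y v = dir g y v.
Proof.
move=> fg; apply: near_eq_derive.
exact: near_chart_inv (chart_dom_mem y) fg.
Qed.

Lemma dir_cst (c : R) y v : dir (fun=> c : R) y v = 0.
Proof. exact: derive_cst. Qed.

Lemma dir_add f g y v : smooth_at y f -> smooth_at y g ->
  dir (fun z => f z + g z) y v = dir f y v + dir g y v.
Proof. by move=> fy gy; apply: deriveD; exact: dir_derivable. Qed.

Lemma dir_mul f g y v : smooth_at y f -> smooth_at y g ->
  dir (fun z => f z * g z) y v = f y * dir g y v + g y * dir f y v.
Proof.
move=> fy gy; rewrite /dir.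
rewrite -[LHS]/('D_v ((f \o chart_inv y) * (g \o chart_inv y)) (chart y y)).
rewrite deriveM; try exact: dir_derivable.
by rewrite /= chartK //; exact: chart_dom_mem.
Qed.

Lemma smooth_at_add f g y : smooth_at y f -> smooth_at y g ->
  smooth_at y (fun z => f z + g z).
Proof.
move=> [U [oU Uy fU]] [W [oW Wy gW]]; exists (U `&` W); split=> //; first exact: openI.
by apply: smooth_add; [exact: openI|apply: smooth_sub fU|apply: smooth_sub gW] => z [].
Qed.

Lemma smooth_at_mul f g y : smooth_at y f -> smooth_at y g ->
  smooth_at y (fun z => f z * g z).
Proof.
move=> [U [oU Uy fU]] [W [oW Wy gW]]; exists (U `&` W); split=> //; first exact: openI.
by apply: smooth_mul; [exact: openI|apply: smooth_sub fU|apply: smooth_sub gW] => z [].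
Qed.

Lemma smooth_at_cst (c : R) y : smooth_at y (fun=> c).
Proof. by exists setT; split=> //; [exact: openT|exact: smooth_cst]. Qed.

Lemma smooth_at_sum (I : Type) (r : seq I) (P : pred I) (F : I -> M -> R) y :
  (forall i, P i -> smooth_at y (F i)) -> smooth_at y (fun z => \sum_(i <- r | P i) F i z).
Proof.
move=> FU; elim: r => [|i r IH].
  by under eq_fun do rewrite big_nil; exact: smooth_at_cst.
under eq_fun do rewrite big_cons.
by case Pi: (P i); [apply: smooth_at_add => //; exact: FU|exact: IH].
Qed.

Lemma dir_sum (I : Type) (r : seq I) (P : pred I) (F : I -> M -> R) y v :
  (forall i, P i -> smooth_at y (F i)) ->
  dir (fun z => \sum_(i <- r | P i) F i z) y v = \sum_(i <- r | P i) dir (F i) y v.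
Proof.
move=> FU; elim: r => [|i r IH].
  by under eq_fun do rewrite big_nil; rewrite dir_cst big_nil.
under eq_fun do rewrite big_cons; rewrite big_cons.
case Pi: (P i); last exact: IH.
by rewrite dir_add ?IH //; [exact: FU|exact: smooth_at_sum].
Qed.

Lemma dir_chain m (h : 'rV[R]_m -> R) (p : M -> 'rV[R]_m) f y v :
  (\forall z \near y, f z = h (p z)) -> differentiable h (p y) ->
  (forall j, differentiable ((fun z => p z 0 j) \o chart_inv y) (chart y y)) ->
  dir f y v = 'D_(\row_j dir (fun z => p z 0 j) y v) h (p y).
Proof.
move=> fhp dh dp; rewrite (eq_dir v fhp) /dir.
have yy := chart_dom_mem y.
have [||_] := @chain_rule R m n h (p \o chart_inv y) (chart y y) v.
- by rewrite /= chartK.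
- exact: dp.
by rewrite /= chartK.
Qed.

(** The derivative along the coordinate-constant field of the fixed chart [x]. In [dir] the chart
    changes with the point, so repeated differentiation goes through [pd]. *)
Definition pd x v f : M -> R := fun y => 'D_v (f \o chart_inv x) (chart x y).

(* The components with respect to [chart x] of the tangent vector at y whose
   components with respect to [chart y] are v; inverse to [const_field x]. *)
Definition comp x y v : E := \row_j dir (fun z => chart x z 0 j) y v.

Lemma dir_pd f x y v : chart_dom x y -> smooth_at y f ->
  dir f y v = pd x (comp x y v) f y.
Proof.
move=> xy [W [oW Wy fW]]; apply: (@dir_chain n (f \o chart_inv x) (chart x)).
- by apply: filterS (near_chart_dom xy) => z xz /=; rewrite chartK.
- exact: smooth_differentiable fW Wy xy.
- by move=> j; apply: smooth_at_diff; exact: smooth_at_coord.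
Qed.

(** The two transition maps between [chart x] and [chart y] are inverse to each other, so by the
    chain rule their differentials are too. *)
Lemma comp_const_field x y v : chart_dom x y -> comp x y (const_field x v y) = v.
Proof.
move=> xy; apply/rowP => j; rewrite mxE /dir.
have yy := chart_dom_mem y.
have [||_] := @chain_rule R n n (fun u => chart x (chart_inv y u) 0 j)
   (fun u => chart y (chart_inv x u)) (chart x y) v.
- rewrite chartK //; exact: smooth_at_diff (smooth_at_coord j xy).
- move=> l; have [W [oW Wy fW]] := smooth_at_coord l yy.
  exact: smooth_differentiable fW Wy xy.
rewrite chartK // => <-.
rewrite (near_eq_derive (g := fun u : E => u 0 j)).
  have := derive_mx (@derivable_id R 'rV[R]_n (chart x y) v).
  by rewrite derive_id => /matrixP /(_ 0 j); rewrite mxE.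
have := near_chart_inv xy (near_chart_dom yy).
apply: filterS2 (near_chart_image xy) => u /= xu yu.
by rewrite chartK // xu.
Qed.

Lemma const_field_comp x y v : chart_dom x y -> const_field x (comp x y v) y = v.
Proof.
move=> xy; apply/rowP => j; rewrite mxE.
have yy := chart_dom_mem y.
rewrite -[LHS]/(pd x (comp x y v) (fun z => chart y z 0 j) y) -dir_pd //; last first.
  exact: smooth_at_coord.
rewrite /dir (near_eq_derive (g := fun u : E => u 0 j)).
  have := derive_mx (@derivable_id R 'rV[R]_n (chart y y) v).
  by rewrite derive_id => /matrixP /(_ 0 j); rewrite mxE.
by apply: filterS (near_chart_image yy) => u /= ->.
Qed.

Lemma dir_const_field f x y v : chart_dom x y -> smooth_at y f ->
  dir f y (const_field x v y) = pd x v f y.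
Proof. by move=> xy fy; rewrite (dir_pd _ xy fy) comp_const_field. Qed.

Lemma comp_id x v : comp x x v = v.
Proof.
have xx := chart_dom_mem x.
apply/rowP => j; rewrite mxE.
rewrite /dir (near_eq_derive (g := fun u : E => u 0 j)).
  have := derive_mx (@derivable_id R 'rV[R]_n (chart x x) v).
  by rewrite derive_id => /matrixP /(_ 0 j); rewrite mxE.
by apply: filterS (near_chart_image xx) => u /= ->.
Qed.

Lemma const_field_id x v : const_field x v x = v.
Proof. by rewrite -{1}(comp_id x v) const_field_comp //; exact: chart_dom_mem. Qed.

Lemma smooth_pd U f x v : open U -> smooth U f -> smooth (chart_dom x `&` U) (pd x v f).
Proof.
move=> oU fU; have oW : open (chart_dom x `&` U) by apply: openI => //; exact: chart_dom_open.
apply: (smooth_chart (x := x) oW); first by move=> y [].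
have oI : open (chart x @` (chart_dom x `&` U)) by exact: chart_image_openI.
have e u : (chart x @` (chart_dom x `&` U)) u ->
    'D_v (f \o chart_inv x) u = (pd x v f \o chart_inv x) u.
  by move=> [y [xy Uy] <-]; rewrite /pd /= chart_invK.
exact: eq_Cinfty oI e (Cinfty_dir v oI (fU x)).
Qed.

Lemma smooth_at_pd f x y v : chart_dom x y -> smooth_at y f -> smooth_at y (pd x v f).
Proof.
move=> xy [U [oU Uy fU]]; exists (chart_dom x `&` U); split=> //.
  by apply: openI => //; exact: chart_dom_open.
exact: smooth_pd.
Qed.

Lemma smooth_const_field x v : smooth_vfield (chart_dom x) (const_field x v).
Proof.
move=> W f oW Wx fW; apply: (eq_smooth (f := pd x v f)) => //.
  move=> y Wy; rewrite dir_const_field //; first exact: Wx.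
  exact: smooth_atP fW Wy.
by apply: smooth_sub (smooth_pd x v oW fW) => y Wy; split=> //; exact: Wx.
Qed.

Lemma const_field_lin x y a v w : chart_dom x y ->
  const_field x (a *: v + w) y = a *: const_field x v y + const_field x w y.
Proof.
move=> xy; apply/rowP => j; rewrite !mxE.
have df : differentiable (fun u => chart y (chart_inv x u) 0 j) (chart x y).
  have [W [oW Wy fW]] := smooth_at_coord j (chart_dom_mem y).
  exact: smooth_differentiable fW Wy xy.
by rewrite !deriveE // linearD linearZ.
Qed.

Lemma const_field0 x y : const_field x 0 y = 0.
Proof. by apply/rowP => j; rewrite !mxE derive0. Qed.

(** At [x] itself [dir] uses [chart x] as well, so both sides are second derivatives of one function
    on R^n. *)
Lemma pd_schwarz f x v w : smooth_at x f -> dir (pd x v f) x w = dir (pd x w f) x v.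
Proof.
move=> [U [oU Ux fU]]; have xx := chart_dom_mem x.
have e u : \forall z \near chart x x, (pd x u f \o chart_inv x) z = 'D_u (f \o chart_inv x) z.
  by apply: filterS (near_chart_image xx) => z /= xz; rewrite /pd xz.
rewrite /dir (near_eq_derive _ (e v)) (near_eq_derive _ (e w)).
by apply: (Cinfty_schwarz _ _ (chart_image_openI oU) (fU x)); exists x.
Qed.

Lemma differential_pairing f y v : smooth_at y f -> pairing (differential f y) v = dir f y v.
Proof.
move=> fy; rewrite (dir_sumv v fy); apply: eq_bigr => i _; rewrite mulrC; congr (_ * _).
by rewrite mxE /ext_d big_ord1 expr0 mul1r.
Qed.

Lemma differentialE f y i : differential f y 0 i = dir f y (e_ i).
Proof. by rewrite mxE /ext_d big_ord1 expr0 mul1r. Qed.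

Lemma smooth_form_field k U (a : dform M k) x (v : 'I_k -> E) : open U -> smooth_form U a ->
  smooth (chart_dom x `&` U) (fun y => a y (fun i => const_field x (v i) y)).
Proof.
move=> oU [_ aU]; apply: aU.
- by apply: openI => //; exact: chart_dom_open.
- by move=> y [].
- move=> i W f oW Wx; apply: smooth_const_field => // y /Wx [].
  by [].
Qed.

Lemma smooth_at_form k U (a : dform M k) x y (v : 'I_k -> E) : open U -> smooth_form U a ->
  U y -> chart_dom x y -> smooth_at y (fun y => a y (fun i => const_field x (v i) y)).
Proof.
move=> oU aU Uy xy; exists (chart_dom x `&` U); split=> //.
  by apply: openI => //; exact: chart_dom_open.
exact: smooth_form_field.
Qed.

Lemma smooth_vfield_comp U (X : vfield M) x j : open U -> smooth_vfield U X ->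
  smooth (chart_dom x `&` U) (fun y => comp x y (X y) 0 j).
Proof.
move=> oU XU; under eq_fun do rewrite mxE; apply: XU.
- by apply: openI => //; exact: chart_dom_open.
- by move=> y [].
by apply: smooth_sub (@smooth_coord x j) => y [].
Qed.

End ManifoldCalculus.

Section TangentMap.
Variables (R : realType) (m n : nat) (M : manifold R m) (N : manifold R n).

(** [tangent_map] uses the chart around [F x]. Along a flow and over the base the image point moves,
    and a fixed target chart [b] is needed. *)
Lemma tangent_map_chart (F : M -> N) (b : N) x v :
  (\forall z \near x, chart_dom b (F z)) ->
  (forall j, differentiable ((fun z => chart b (F z) 0 j) \o chart_inv x) (chart x x)) ->
  tangent_map F x v =
    const_field b (\row_j dir (fun z => chart b (F z) 0 j) x v) (F x).
Proof.
move=> Fb dF; apply/rowP => j; rewrite !mxE.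
have bF := nbhs_singleton Fb.
apply: (dir_chain (p := fun z => chart b (F z))) => //.
  by apply: filterS Fb => z bz /=; rewrite chartK.
have [W [oW Wy fW]] := smooth_at_coord j (chart_dom_mem (F x)).
exact: smooth_differentiable fW Wy bF.
Qed.

End TangentMap.

(** * Exterior derivative and divergence of Hamiltonian fields *)

Section LiftLift.
Variables (R : realType) (T : Type) (k : nat).

(** The simplicial identity behind d o d = 0: two indices can be removed in either order, with
    opposite signs. *)
Lemma lift_liftC (i j : 'I_k.+2) (a b : 'I_k.+1) : j = lift i a -> i = lift j b ->
  (forall l : 'I_k, lift i (lift a l) = lift j (lift b l)) /\
  (-1) ^+ i * (-1) ^+ a = - ((-1) ^+ j * (-1) ^+ b) :> R.
Proof.
move=> /(congr1 val) /= ja /(congr1 val) /= ib.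
wlog ij : i j a b ja ib / (i < j)%N.
  move=> H; have [ij|ji|ij] := ltngtP i j; first exact: H.
    have [e s] := H j i b a ib ja ji.
    by split=> [l|]; [rewrite e|rewrite s opprK].
  by move: ja; rewrite /bump ij; lia.
split=> [l|]; first by apply: val_inj => /=; move: ja ib ij; rewrite /bump; lia.
have -> : (j : nat) = a.+1 by move: ja ij; rewrite /bump; lia.
have -> : (b : nat) = i by move: ib ij; rewrite /bump; lia.
by rewrite exprS mulN1r mulNr opprK mulrC.
Qed.

(** By [lift_liftC] the terms for the ordered pairs (i, j) and (j, i) cancel when [B] is
    symmetric. *)
Lemma symmetric_insertion (B : T -> T -> ('I_k -> T) -> R) (v : 'I_k.+2 -> T) :
  (forall u u' w, B u u' w = B u' u w) ->
  \sum_(i < k.+2) (-1) ^+ i * (\sum_(a < k.+1) (-1) ^+ a *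
     B (v i) (v (lift i a)) (fun l => v (lift i (lift a l)))) = 0.
Proof.
move=> Bs.
(* The summand is extended by 0 to the diagonal, so that the sum runs over all pairs and the two
   summations can be exchanged. *)
pose H (i j : 'I_k.+2) := if unlift i j is Some a then (-1) ^+ i * (-1) ^+ a *
   B (v i) (v (lift i a)) (fun l => v (lift i (lift a l))) else 0.
have HC i j : H i j = - H j i.
  rewrite /H; case: unliftP => [a ja|ji]; case: unliftP => [b ib|ij].
  - have [e s] := lift_liftC ja ib.
    rewrite s mulNr; congr (- (_ * _)); rewrite -ja -ib Bs; congr (B _ _ _).
    by apply/funext => l; rewrite e.
  - by have := neq_lift i a; rewrite -ja ij eqxx.
  - by have := neq_lift j b; rewrite -ib ji eqxx.
  - by rewrite oppr0.
have -> : \sum_(i < k.+2) (-1) ^+ i * (\sum_(a < k.+1) (-1) ^+ a *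
     B (v i) (v (lift i a)) (fun l => v (lift i (lift a l)))) = \sum_i \sum_j H i j.
  apply: eq_bigr => i _; rewrite (bigD1_ord i) //= {1}/H unlift_none add0r mulr_sumr.
  by apply: eq_bigr => a _; rewrite /H liftK mulrA.
set S := (X in X = 0); have : S = - S.
  rewrite {1}/S exchange_big /= -sumrN; apply: eq_bigr => i _.
  by rewrite -sumrN; apply: eq_bigr => j _; exact: HC.
by move/eqP; rewrite -addr_eq0 -mulr2n mulrn_eq0 => /eqP.
Qed.

End LiftLift.

Section FormCalculus.
Variables (R : realType) (n : nat) (M : manifold R n).
Notation E := 'rV[R]_n.
Notation e_ := (@basis_vec R n).
Implicit Types (x y z : M) (U W : set M) (f g : M -> R).

(** The coefficients of [a] in [chart x], as functions of the point: these are what [ext_d] and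
    [lie] differentiate. *)
Definition coef k (a : dform M k) x (w : 'I_k -> E) : M -> R :=
  fun y => a y (fun i => const_field x (w i) y).

Lemma coef_id k (a : dform M k) x w : coef a x w x = a x w.
Proof. by congr (a x); apply/funext => i; rewrite const_field_id. Qed.

Lemma ext_dE k (a : dform M k) x v : ext_d a x v =
  \sum_(i < k.+1) (-1) ^+ i * dir (coef a x (fun j => v (lift i j))) x (v i).
Proof. by []. Qed.

Lemma const_field_update k x y (w : 'I_k -> E) i u :
  (fun j => const_field x (update w i u j) y) =
  update (fun j => const_field x (w j) y) i (const_field x u y).
Proof. by apply/funext => j; rewrite /update; case: eqP. Qed.

Lemma alternating_coef k (a : dform M k) x y : chart_dom x y -> alternating (a y) ->
  alternating (fun w => coef a x w y).
Proof.
move=> xy [al az]; split=> [w i c u u'|w i j ij e].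
  have cu t := const_field_update x y w i t.
  rewrite /coef (cu (c *: u + u')) (cu u) (cu u').
  by rewrite (const_field_lin c u u' xy) al.
by apply: (az _ i j ij); rewrite e.
Qed.

Lemma smooth_at_coef k U (a : dform M k) x y w : open U -> smooth_form U a -> U y ->
  chart_dom x y -> smooth_at y (coef a x w).
Proof. by move=> oU aU Uy xy; exact: smooth_at_form oU aU Uy xy. Qed.

Lemma near_alternating k U (a : dform M k) x : open U -> smooth_form U a -> U x ->
  \forall y \near x, U y /\ chart_dom x y /\ alternating (fun w => coef a x w y).
Proof.
move=> oU [aU _] Ux.
apply: filterS2 (open_nbhs_nbhs (conj oU Ux)) (near_chart_dom (chart_dom_mem x)).
by move=> y Uy xy; split=> //; split=> //; apply: alternating_coef => //; exact: aU.
Qed.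

Lemma alternating_dir_coef k U (a : dform M k) x u : open U -> smooth_form U a -> U x ->
  alternating (fun w => dir (coef a x w) x u).
Proof.
move=> oU aU Ux; have xx := chart_dom_mem x.
have sa w : smooth_at x (coef a x w) by exact: smooth_at_coef oU aU Ux xx.
have na := near_alternating oU aU Ux.
split=> [w i c v v'|w i j ij e].
  rewrite (eq_dir (g := fun y => c * coef a x (update w i v) y + coef a x (update w i v') y)).
    rewrite dir_add ?dir_mul ?dir_cst ?mulr0 ?addr0 //; try exact: smooth_at_cst.
    by apply: smooth_at_mul => //; exact: smooth_at_cst.
  by apply: filterS na => y [_ [_ [al _]]]; rewrite al.
rewrite (eq_dir (g := fun=> 0)) ?dir_cst //.
by apply: filterS na => y [_ [_ [_ az]]]; exact: az e.
Qed.

Lemma alternating_ext_d k U (a : dform M k) x : open U -> smooth_form U a -> U x ->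
  alternating (ext_d a x).
Proof.
move=> oU aU Ux; have xx := chart_dom_mem x.
apply: (alternating_insertion (G := fun u w => dir (coef a x w) x u)).
  by move=> w c u u'; apply: dir_lin; exact: smooth_at_coef oU aU Ux xx.
by move=> u; exact: alternating_dir_coef oU aU Ux.
Qed.

Lemma ext_d_add k U (a b : dform M k) x v : open U -> smooth_form U a -> smooth_form U b ->
  U x -> ext_d (fun y w => a y w + b y w) x v = ext_d a x v + ext_d b x v.
Proof.
move=> oU aU bU Ux; have xx := chart_dom_mem x.
rewrite !ext_dE -big_split /=; apply: eq_bigr => i _; rewrite -mulrDr; congr (_ * _).
rewrite -dir_add //.
  exact: smooth_at_coef oU aU Ux xx.
exact: smooth_at_coef oU bU Ux xx.
Qed.

Lemma ext_d_scale k U f (a : dform M k) x v : open U -> smooth_at x f -> smooth_form U a ->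
  U x -> ext_d (fun y w => f y * a y w) x v =
    wedge1 (differential f x) (a x) v + f x * ext_d a x v.
Proof.
move=> oU fx aU Ux; have xx := chart_dom_mem x.
rewrite !ext_dE mulr_sumr -big_split /=; apply: eq_bigr => i _.
rewrite [X in _ = _ + X]mulrCA -mulrDr; congr (_ * _).
rewrite differential_pairing // -(coef_id a) addrC [dir f _ _ * _]mulrC.
by rewrite -dir_mul //; exact: smooth_at_coef oU aU Ux xx.
Qed.

Lemma smooth_form_add k U (a b : dform M k) : open U -> smooth_form U a -> smooth_form U b ->
  smooth_form U (fun y w => a y w + b y w).
Proof.
move=> oU [aa sa] [ba sb]; split=> [x Ux|W X oW WU sX].
  by apply: alternating_add; [exact: aa|exact: ba].
by apply: smooth_add => //; [exact: sa|exact: sb].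
Qed.

Lemma smooth_form_scale k U f (a : dform M k) : open U -> smooth U f -> smooth_form U a ->
  smooth_form U (fun y w => f y * a y w).
Proof.
move=> oU sf [aa sa]; split=> [x Ux|W X oW WU sX].
  by apply: alternating_scale; exact: aa.
by apply: smooth_mul => //; [exact: smooth_sub sf|exact: sa].
Qed.

Lemma smooth_form_sub k U W (a : dform M k) : W `<=` U -> smooth_form U a -> smooth_form W a.
Proof.
move=> WU [aa sa]; split=> [x /WU|V X oV VW]; first exact: aa.
by apply: sa => //; exact: subset_trans WU.
Qed.

Lemma covector_pairing (T : ('I_1 -> E) -> R) u : multilinear T ->
  pairing (covector T) u = T (fun=> u).
Proof.
move=> Tl.
have e w : (fun=> w) = update (fun=> 0 : E) (ord0 : 'I_1) w.
  by apply/funext => i; rewrite (ord1 i) update_same.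
rewrite /pairing (e u) {2}(basis_sum u) ml_sum //; apply: eq_bigr => i _.
by rewrite mxE e mulrC.
Qed.

Lemma smooth_form_wedge1 k U (b : dform M 1) (a : dform M k) : open U -> smooth_form U b ->
  smooth_form U a -> smooth_form U (fun y => wedge1 (covector (b y)) (a y)).
Proof.
move=> oU [ba sb] [aa sa]; split=> [x Ux|W X oW WU sX].
  by apply: alternating_wedge1; exact: aa.
apply: smooth_sum => // i _; apply: smooth_mul => //; first exact: smooth_cst.
apply: smooth_mul => //; last first.
  by apply: (sa W (fun j => X (lift i j))).
apply: (eq_smooth (f := fun y => b y (fun=> X i y))) => //.
  by move=> y Wy; rewrite covector_pairing //; exact: (ba y (WU _ Wy)).1.
exact: (sb W (fun=> X i)).
Qed.

End FormCalculus.

(** * Lie derivatives of top-degree forms *)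

Section Divergence.
Variables (R : realType) (n : nat) (M : manifold R n).
Notation E := 'rV[R]_n.
Notation e_ := (@basis_vec R n).
Implicit Types (x y z : M) (U W : set M) (f g : M -> R).

Lemma smooth_at_vfield U (X : vfield M) x y j : open U -> smooth_vfield U X -> U y ->
  chart_dom x y -> smooth_at y (fun z => comp x z (X z) 0 j).
Proof.
move=> oU XU Uy xy; exists (chart_dom x `&` U); split=> //; last exact: smooth_vfield_comp.
by apply: openI => //; exact: chart_dom_open.
Qed.

(** The bracket of [X] with a coordinate-constant field is minus the derivative of the components of
    [X], and [alt_trace] collects the bracket terms of the Lie derivative into the trace of the
    Jacobian. *)
Lemma lie_top U (a : dform M n) (X : vfield M) x (v : 'I_n -> E) : open U ->
  smooth_form U a -> smooth_vfield U X -> U x ->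
  lie X a x v = \det (\matrix_(i, j) v i 0 j) * (dir (coef a x e_) x (X x) +
    \tr (\matrix_(l, j) dir (fun y => comp x y (X y) 0 j) x (e_ l)) * a x e_).
Proof.
move=> oU aU XU Ux; have xx := chart_dom_mem x.
have sm w : smooth_at x (coef a x w) by exact: smooth_at_coef oU aU Ux xx.
have sX j := smooth_at_vfield j oU XU Ux xx.
have ax := aU.1 _ Ux.
set D := \det _; pose m := coef a x e_.
pose L : 'M[R]_n := \matrix_(l, j) dir (fun y => comp x y (X y) 0 j) x (e_ l).
(* The summand 0 gives the bracket the shape of the multilinearity law, which is applied to it
   below. *)
have br w : bracket X (const_field x w) x = (-1) *: (w *m L) + 0.
  apply/rowP => j; rewrite addr0 !mxE mulN1r -[RHS]add0r /=.
  congr (_ - _).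
    rewrite (eq_dir (g := fun=> w 0 j)) ?dir_cst //.
    apply: filterS (near_chart_dom xx) => y xy.
    by rewrite -[in RHS](comp_const_field w xy) mxE.
  rewrite const_field_id (eq_dir (g := fun y => comp x y (X y) 0 j)).
    by rewrite (dir_sumv _ (sX j)); apply: eq_bigr => l _; rewrite mxE.
  by near=> y; rewrite mxE.
have -> : lie X a x v = dir (coef a x v) x (X x) + \tr L * a x v.
  rewrite /lie -(alt_trace L v ax) -sumrN; congr (_ + _).
  apply: eq_bigr => i _; rewrite br ax.1 mulN1r opprD opprK.
  by rewrite (ml_zero (v := update v i 0) (i := i)) ?oppr0 ?addr0 ?update_same //; exact: ax.1.
rewrite (eq_dir (g := fun y => D * m y)); last first.
  by apply: filterS (near_alternating oU aU Ux) => y [_ [_ ay]]; exact: alt_top ay.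
rewrite dir_mul; [|exact: smooth_at_cst|exact: sm].
by rewrite dir_cst mulr0 addr0 (alt_top v ax) -/D mulrCA -mulrDr.
Unshelve. all: by end_near. Qed.

(** The classical divergence of the density times [X]: the product rule merges the derivative of the
    density and the trace of the Jacobian. *)
Lemma lie_top_divergence U (a : dform M n) (X : vfield M) x (v : 'I_n -> E) : open U ->
  smooth_form U a -> smooth_vfield U X -> U x ->
  lie X a x v = \det (\matrix_(i, j) v i 0 j) *
    \sum_i dir (fun y => coef a x e_ y * comp x y (X y) 0 i) x (e_ i).
Proof.
move=> oU aU XU Ux; have xx := chart_dom_mem x.
have sm w : smooth_at x (coef a x w) by exact: smooth_at_coef oU aU Ux xx.
have sX j := smooth_at_vfield j oU XU Ux xx.
rewrite (lie_top v oU aU XU Ux); congr (_ * _).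
rewrite (dir_sumv _ (sm _)) /mxtrace mulr_suml -big_split /=; apply: eq_bigr => i _.
by rewrite dir_mul // addrC mxE comp_id coef_id mulrC.
Qed.

End Divergence.

Section Hamiltonian.
Variables (R : realType) (n : nat) (M : manifold R n).
Notation E := 'rV[R]_n.
Notation e_ := (@basis_vec R n).
Implicit Types (x y z : M) (U W : set M) (f g : M -> R).

Definition pair2 (a b : E) : 'I_2 -> E := push a (fun=> b).

Lemma ham_dir (P : mvector M 2) f g y : multilinear (P y) -> smooth_at y g ->
  dir g y (ham P f y) = P y (pair2 (differential f y) (differential g y)).
Proof.
move=> Pl gy.
have e w : pair2 (differential f y) w =
    update (pair2 (differential f y) 0) (lift ord0 ord0) w.
  apply/funext => i; rewrite /update /pair2 /push; case: unliftP => [j ->|->].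
    by rewrite (ord1 j) eqxx.
  by rewrite (negbTE (neq_lift _ _)).
rewrite e {1}(basis_sum (differential g y)) ml_sum // (dir_sumv _ gy).
by apply: eq_bigr => i _; rewrite mxE differentialE /insert -/(pair2 _ _) e mulrC.
Qed.

End Hamiltonian.

(** * Hamiltonian fields of a bivector dual to a form *)

Section HamiltonianDivergence.
Variables (R : realType) (k : nat) (M : manifold R k.+2).
Notation E := 'rV[R]_k.+2.
Notation e_ := (@basis_vec R k.+2).
Implicit Types (x y z : M) (U W : set M) (f g : M -> R).
Variables (U : set M) (a : dform M k.+2) (P : mvector M 2) (A : dform M k).
Hypotheses (oU : open U) (aU : volume_form U a) (AU : smooth_form U A).
Hypothesis Palt : forall y, U y -> alternating (P y).
Hypothesis PA : forall y, U y -> forall b1 b2 v,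
  P y (pair2 b1 b2) * a y v = wedge1 b1 (wedge1 b2 (A y)) v.

Lemma coef_volume_neq0 x y : U y -> chart_dom x y -> coef a x e_ y != 0.
Proof.
move=> Uy xy; have [[aalt _] a0] := aU; have [v av] := a0 y Uy.
apply: contra av => /eqP m0.
have -> : v = fun i => const_field x (comp x y (v i)) y.
  by apply/funext => i; rewrite const_field_comp.
have ca := alternating_coef xy (aalt _ Uy).
by rewrite -[a y _]/(coef a x _ y) (alt_top _ ca) m0 mulr0.
Qed.

Lemma wedge1_coord x y i (T : ('I_k.+1 -> E) -> R) : chart_dom x y ->
  wedge1 (differential (fun z => chart x z 0 i) y) T (fun j => const_field x (e_ j) y) =
  (-1) ^+ i * T (fun j => const_field x (e_ (lift i j)) y).
Proof.
move=> xy; rewrite /wedge1 (bigD1 i) //= big1 ?addr0; last first.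
  move=> j ji; rewrite differential_pairing; last exact: smooth_at_coord.
  have := congr1 (fun u : E => u 0 i) (comp_const_field (e_ j) xy).
  rewrite mxE => ->; rewrite mxE eqxx /= eq_sym (negbTE ji) mul0r mulr0 //.
rewrite differential_pairing; last exact: smooth_at_coord.
have := congr1 (fun u : E => u 0 i) (comp_const_field (e_ i) xy).
by rewrite mxE => ->; rewrite mxE !eqxx mul1r.
Qed.

Lemma pair2C (T : ('I_2 -> E) -> R) b1 b2 : alternating T -> T (pair2 b1 b2) = - T (pair2 b2 b1).
Proof.
move=> Ta; have := alt_perm (tperm ord0 (lift ord0 ord0)) (pair2 b2 b1) Ta.
rewrite odd_tperm (neq_lift ord0 ord0) expr1 mulN1r => <-; congr T.
apply/funext => i; rewrite /pair2 /push; case: (unliftP ord0 i) => [j ->|->].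
  by rewrite (ord1 j) tpermR unlift_none.
by rewrite tpermL liftK.
Qed.

(** The component is P (df, dx_i) = - P (dx_i, df). By the duality [PA] it is governed by dx_i /\ df
    /\ A, where dx_i singles out the i-th coordinate field. *)
Lemma ham_comp f x y i : U y -> chart_dom x y -> smooth_at y f ->
  coef a x e_ y * comp x y (ham P f y) 0 i =
  - ((-1) ^+ i * wedge1 (differential f y) (A y) (fun j => const_field x (e_ (lift i j)) y)).
Proof.
move=> Uy xy fy; rewrite mxE ham_dir; last exact: smooth_at_coord.
  rewrite pair2C; last exact: Palt.
  by rewrite mulrN mulrC PA // wedge1_coord.
exact: (Palt Uy).1.
Qed.

Lemma wedge1_differential_coef f x y (w : 'I_k.+1 -> E) : chart_dom x y -> smooth_at y f ->
  wedge1 (differential f y) (A y) (fun j => const_field x (w j) y) =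
  \sum_(b < k.+1) (-1) ^+ b * (pd x (w b) f y * coef A x (fun l => w (lift b l)) y).
Proof.
move=> xy fy; apply: eq_bigr => b _; rewrite differential_pairing //.
by rewrite dir_const_field.
Qed.

(** The duality [PA] expresses P (df, dg) as a quotient of coefficients of smooth forms, and the
    denominator, the coefficient of a volume form, has no zeros. *)
Lemma smooth_ham f : smooth U f -> smooth_vfield U (ham P f).
Proof.
move=> fU W g oW WU gW.
apply: smooth_local => x Wx; have xx := chart_dom_mem x.
pose V := chart_dom x `&` W.
have oV : open V by apply: openI => //; exact: chart_dom_open.
exists V; split=> //.
have VU y : V y -> U y by case=> _ /WU.
have fV : smooth V f by apply: smooth_sub fU => y /VU.
have gV : smooth V g by apply: smooth_sub gW => y [].
(* [G] is the value of dg /\ df /\ A on the coordinate fields, so the derivative of [g] along the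
   Hamiltonian field of [f] is - G divided by the coefficient of [a]. *)
pose G y := \sum_(i < k.+2) (-1) ^+ i * (pd x (e_ i) g y *
  \sum_(b < k.+1) (-1) ^+ b * (pd x (e_ (lift i b)) f y *
     coef A x (fun l => e_ (lift i (lift b l))) y)).
have VV : V = chart_dom x `&` V by rewrite setIA setIid.
have pdV h u : smooth V h -> smooth V (pd x u h).
  by move=> hV; rewrite VV; exact: smooth_pd.
have coV w : smooth V (coef A x w).
  apply: smooth_sub (@smooth_form_field _ _ _ _ U _ x w oU AU).
  by move=> y Vy; split; [case: Vy|exact: VU].
have maV : smooth V (coef a x e_).
  apply: smooth_sub (@smooth_form_field _ _ _ _ U _ x e_ oU aU.1).
  by move=> y Vy; split; [case: Vy|exact: VU].
apply: (eq_smooth (f := fun y => - (G y) * (coef a x e_ y)^-1)) => //.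
  move=> y Vy; have Uy := VU _ Vy; have [xy _] := Vy.
  have fy := smooth_atP oV fV Vy; have gy := smooth_atP oV gV Vy.
  have m0 := coef_volume_neq0 Uy xy.
  apply: (mulIf m0); rewrite mulfVK // ham_dir //; last exact: (Palt Uy).1.
  rewrite pair2C ?mulNr; last exact: Palt.
  congr (- _); rewrite PA // /wedge1; apply: eq_bigr => i _; congr (_ * _).
  rewrite differential_pairing // dir_const_field //; congr (_ * _).
  by rewrite -wedge1_differential_coef.
apply: smooth_mul => //; last first.
  by apply: smooth_inv => // y Vy; apply: coef_volume_neq0; [exact: VU|case: Vy].
rewrite /G; under eq_fun do rewrite -mulN1r.
apply: smooth_mul => //; first exact: smooth_cst.
apply: smooth_sum => // i _; apply: smooth_mul => //; first exact: smooth_cst.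
apply: smooth_mul => //; first exact: pdV.
apply: smooth_sum => // b _; apply: smooth_mul => //; first exact: smooth_cst.
by apply: smooth_mul => //; exact: pdV.
Qed.

(** By [ham_comp] the divergence is - d (df /\ A) written in coordinates, and this equals df /\ dA
    since d df = 0. *)
Lemma ham_divergence f x v : smooth U f -> U x ->
  lie (ham P f) a x v = wedge1 (differential f x) (ext_d A x) v.
Proof.
move=> fU Ux; have xx := chart_dom_mem x; have fx := smooth_atP oU fU Ux.
rewrite (lie_top_divergence v oU aU.1 (smooth_ham fU) Ux).
have dA := alternating_ext_d oU AU Ux.
rewrite [RHS](alt_top _ (alternating_wedge1 _ dA)); congr (_ * _).
have near_f : \forall y \near x, U y /\ chart_dom x y /\ smooth_at y f.
  apply: filterS2 (open_nbhs_nbhs (conj oU Ux)) (near_chart_dom xx).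
  by move=> y Uy xy; do 2 split=> //; exact: smooth_atP fU Uy.
have sA w : smooth_at x (coef A x w) by exact: smooth_at_coef oU AU Ux xx.
have sf w : smooth_at x (pd x w f) by exact: smooth_at_pd.
have lhsE i : dir (fun y => coef a x e_ y * comp x y (ham P f y) 0 i) x (e_ i) =
   - ((-1) ^+ i * \sum_(b < k.+1) (-1) ^+ b *
     (pd x (e_ (lift i b)) f x * dir (coef A x (fun l => e_ (lift i (lift b l)))) x (e_ i)
      + coef A x (fun l => e_ (lift i (lift b l))) x * dir (pd x (e_ (lift i b)) f) x (e_ i))).
  rewrite (eq_dir (g := fun y => (- (-1) ^+ i) * \sum_(b < k.+1) (-1) ^+ b *
     (pd x (e_ (lift i b)) f y * coef A x (fun l => e_ (lift i (lift b l))) y))); last first.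
    apply: filterS near_f => y [Uy [xy fy]].
    by rewrite ham_comp // wedge1_differential_coef // mulNr.
  have sm (b : 'I_k.+1) : smooth_at x (fun y => (-1) ^+ b *
     (pd x (e_ (lift i b)) f y * coef A x (fun l => e_ (lift i (lift b l))) y)).
    by apply: smooth_at_mul; [exact: smooth_at_cst|exact: smooth_at_mul].
  rewrite dir_mul; [|exact: smooth_at_cst|exact: smooth_at_sum].
  rewrite dir_cst mulr0 addr0 mulNr; congr (- (_ * _)).
  rewrite dir_sum //; apply: eq_bigr => b _.
  rewrite dir_mul; [|exact: smooth_at_cst|exact: smooth_at_mul].
  by rewrite dir_cst mulr0 addr0 dir_mul.
have pdx u : pd x u f x = dir f x u by [].
under eq_bigr do rewrite lhsE.
rewrite sumrN; apply/eqP; rewrite eq_sym -addr_eq0; apply/eqP.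
(* [h1] removes the second derivatives of [f]. [h2] exchanges, up to sign, the index that
   differentiates [f] with the one that differentiates [A], which turns the remaining terms into df
   /\ dA. *)
have h1 := symmetric_insertion (B := fun u u' w => coef A x w x * dir (pd x u' f) x u) e_.
have h2 := symmetric_insertion (B := fun u u' w =>
    dir f x u' * dir (coef A x w) x u + dir f x u * dir (coef A x w) x u') e_.
have {}h1 := h1 (fun u u' w => congr1 _ (pd_schwarz u' u fx)).
have {}h2 := h2 (fun u u' w => addrC _ _).
rewrite -[RHS]addr0 -[X in _ = X + _]h1 -[X in _ = _ + X]h2.
rewrite -!big_split /=; apply: eq_bigr => i _.
rewrite -!mulrDr; congr (_ * _); rewrite differential_pairing // ext_dE mulr_sumr.
rewrite -!big_split /=; apply: eq_bigr => b _.
have alg (s p q c d D r : R) :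
  p * (s * D) + s * (q * d + c * r) = s * (c * r) + s * (q * d + p * D) by ring.
exact: alg.
Qed.

End HamiltonianDivergence.

(** * Invariance under flows *)

Section DerivativeOfMultilinear.
Variables (R : realType) (n : nat).
Notation E := 'rV[R]_n.

Lemma is_derive_prod_seq (I : eqType) (r : seq I) (f : I -> R -> R) (df : I -> R) (s : R) :
  uniq r -> (forall i, is_derive s 1 (f i) (df i)) ->
  is_derive s 1 (fun t => \prod_(i <- r) f i t)
    (\sum_(i <- r) df i * \prod_(j <- r | j != i) f j s).
Proof.
move=> ur fs; elim: r ur => [_|i r IH /= /andP[ir ur]].
  by under eq_fun do rewrite big_nil; rewrite big_nil; exact: is_derive_cst.
under eq_fun do rewrite big_cons.
apply: is_derive_eq (is_deriveM (fs i) (IH ur)) _.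
rewrite big_cons big_cons eqxx /= addrC; congr (_ + _).
  rewrite -[LHS]/(_ * _) mulrC; congr (_ * _); rewrite big_seq_cond [RHS]big_seq_cond.
  apply: eq_bigl => j; rewrite andbT; case jr: (j \in r) => //=.
  by apply/esym; apply: contraNneq ir => <-.
rewrite -[LHS]/(_ * _) mulr_sumr; apply: eq_big_seq => j jr.
rewrite big_cons (_ : i != j); last by apply: contraNneq ir => ->.
by rewrite mulrCA.
Qed.

Lemma is_derive_bigsum (I : Type) (r : seq I) (f : I -> R -> R) (df : I -> R) (s : R) :
  (forall i, is_derive s 1 (f i) (df i)) ->
  is_derive s 1 (fun t => \sum_(i <- r) f i t) (\sum_(i <- r) df i).
Proof.
move=> fs; elim: r => [|i r IH].
  by under eq_fun do rewrite big_nil; rewrite big_nil; exact: is_derive_cst.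
under eq_fun do rewrite big_cons; rewrite big_cons; exact: is_deriveD.
Qed.

Lemma is_derive_multilinear k (T : ('I_k -> E) -> R) (J : R -> 'I_k -> E) (K : 'I_k -> E)
    (s : R) : multilinear T ->
  (forall i j, is_derive s 1 (fun t => J t i 0 j) (K i 0 j)) ->
  is_derive s 1 (fun t => T (J t)) (\sum_i T (update (J s) i (K i))).
Proof.
move=> Tl dJ; under eq_fun do rewrite (ml_expand _ Tl).
have dI (I : {ffun 'I_k -> 'I_n}) : is_derive s 1
   (fun t => (\prod_i J t i 0 (I i)) * T (fun i => basis_vec R (I i)))
   ((\sum_i K i 0 (I i) * \prod_(j | j != i) J s j 0 (I j)) *
      T (fun i => basis_vec R (I i))).
  have := is_derive_prod_seq (index_enum_uniq _) (fun i => dJ i (I i)).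
  move=> dp; apply: is_derive_eq (is_deriveM dp (is_derive_cst _ _ _)) _.
  by rewrite -[LHS]/(_ * _ + _ * _) mulr0 add0r mulrC.
apply: is_derive_eq (is_derive_bigsum _ dI) _.
under [RHS]eq_bigr do rewrite (ml_expand _ Tl).
rewrite exchange_big /=; apply: eq_bigr => I _; rewrite mulr_suml; apply: eq_bigr => i _.
congr (_ * _); rewrite [RHS](bigD1 i) //= update_same; congr (_ * _).
by apply: eq_bigr => j ji; rewrite update_neq.
Qed.

End DerivativeOfMultilinear.

Section Flow.
Variables (R : realType) (n : nat) (M : manifold R n).
Notation E := 'rV[R]_n.
Notation e_ := (@basis_vec R n).
Variables (U : set M) (a : dform M n) (X : vfield M).
Hypotheses (oU : open U) (aU : smooth_form U a) (XU : smooth_vfield U X).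
Hypothesis aX : forall x v, U x -> lie X a x v = 0.
Variables (D : set (R * M)%type) (phi : R -> M -> M).
Hypothesis fl : is_flow U X D phi.

Let tau (z : 'rV[R]_(1 + n)) : R := lsubmx z 0 0.

(** Coordinates (t, u) at which the flow can be read in the two fixed charts [x] and [b]; there
    [Psi x b] gives its components. *)
Let O (x b : M) : set 'rV[R]_(1 + n) := [set z | exists t y,
  [/\ z = row_mx t%:M (chart x y), chart_dom x y, D (t, y) & chart_dom b (phi t y)]].

Let Psi (x b : M) (j : 'I_n) (z : 'rV[R]_(1 + n)) : R :=
  chart b (phi (tau z) (chart_inv x (rsubmx z))) 0 j.

Let pt (t : R) (u : E) : 'rV[R]_(1 + n) := row_mx t%:M u.

Lemma tau_pt t u : tau (pt t u) = t.
Proof. by rewrite /tau /pt row_mxKl mxE. Qed.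

Lemma rsub_pt t u : rsubmx (pt t u) = u.
Proof. by rewrite /pt row_mxKr. Qed.

Lemma pt_tau z : pt (tau z) (rsubmx z) = z.
Proof. by rewrite /pt /tau -mx11_scalar hsubmxK. Qed.

(** [flow_smooth] gives smoothness on this set, but the chain rule and the symmetry of second
    derivatives ask for an open one. Openness comes from that of [D] and the continuity of the
    flow. *)
Lemma flow_chart_open x b : open (O x b).
Proof.
rewrite openE => z0 [t0 [y0 [-> xy0 Dy0 by0]]].
rewrite /interior -[row_mx _ _]/(pt t0 (chart x y0)).
have im : (chart x @` chart_dom x) (chart x y0) by exists y0.
pose kap z := (tau z, chart_inv x (rsubmx z)).
have kap0 : kap (pt t0 (chart x y0)) = (t0, y0).
  by rewrite /kap tau_pt rsub_pt chartK.
have crs : {for pt t0 (chart x y0), continuous (fun z : 'rV[R]_(1 + n) => rsubmx z)}.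
  exact/differentiable_continuous/differentiable_rsubmx.
have ctau : {for pt t0 (chart x y0), continuous tau}.
  rewrite /tau; apply: (@continuous_comp _ _ _ (fun z : 'rV[R]_(1 + n) => lsubmx z)
    (fun w : 'rV[R]_1 => w 0 0)).
    exact/differentiable_continuous/differentiable_lsubmx.
  exact: coord_continuous.
have cinv : {for pt t0 (chart x y0), continuous (fun z => chart_inv x (rsubmx z))}.
  apply: continuous_comp; first exact: crs.
  by rewrite rsub_pt; exact: chart_inv_continuous.
have ckap : {for pt t0 (chart x y0), continuous kap} by exact: cvg_pair ctau cinv.
have nD : \forall z \near pt t0 (chart x y0), D (kap z).
  by apply: ckap; rewrite kap0; apply: open_nbhs_nbhs; split=> //; exact: flow_open fl.
have nb : \forall z \near pt t0 (chart x y0), chart_dom b (phi (tau z) (chart_inv x (rsubmx z))).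
  have cphi : {for pt t0 (chart x y0), continuous ((fun p : (R * M)%type => phi p.1 p.2) \o kap)}.
    apply: continuous_comp; first exact: ckap.
    by rewrite kap0; exact: flow_continuous fl _ _ Dy0.
  by apply: cphi; rewrite /= tau_pt rsub_pt chartK //; exact: near_chart_dom.
have nim : \forall z \near pt t0 (chart x y0), (chart x @` chart_dom x) (rsubmx z).
  apply: crs; rewrite rsub_pt; apply: open_nbhs_nbhs; split=> //.
  exact: (@chart_img_open _ _ M x).
apply: filterS3 nD nb nim => z Dz bz [y xy yz].
exists (tau z), y; split=> //.
- by rewrite yz -[RHS]/(pt _ _) pt_tau.
- by move: Dz; rewrite /kap -yz chartK.
- by move: bz; rewrite -yz chartK.
Qed.

Lemma Psi_smooth x b j : Cinfty (O x b) (Psi x b j).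
Proof.
have := flow_smooth fl x (chart_dom_open b) (@smooth_coord _ _ M b j).
exact.
Qed.

Lemma derive_pt x b j t u (w : E) :
  'D_w (fun v => Psi x b j (pt t v)) u = 'D_(row_mx 0 w) (Psi x b j) (pt t u) /\
  (derivable (Psi x b j) (pt t u) (row_mx 0 w) -> derivable (fun v => Psi x b j (pt t v)) u w).
Proof.
have e : (fun h : R => h^-1 *: (((fun v => Psi x b j (pt t v)) \o shift u) (h *: w)
      - Psi x b j (pt t u))) =
    (fun h => h^-1 *: ((Psi x b j \o shift (pt t u)) (h *: row_mx 0 w) - Psi x b j (pt t u))).
  apply/funext => h /=; congr (_ *: (Psi _ _ _ _ - _)).
  by rewrite /pt scale_row_mx scaler0 add_row_mx add0r.
by split; rewrite /derive /derivable e.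
Qed.

Notation e0 := (basis_vec R (lshift n (ord0 : 'I_1))).

Lemma pt_line s t u : pt s u = pt t u + (s - t) *: e0.
Proof.
apply/rowP => i; rewrite /pt !mxE eqxx /=; case: splitP => l il.
  by rewrite -val_eqE /= il (ord1 l) !mxE !mulr1n mulr1 addrC subrK.
by rewrite -val_eqE /= il /= mulr0 addr0.
Qed.

Lemma line_pt (f : 'rV[R]_(1 + n) -> R) t u :
  derivable f (pt t u) (e0) ->
  is_derive t 1 (fun s => f (pt s u)) ('D_(e0) f (pt t u)).
Proof.
have -> : (fun s => f (pt s u)) =
   (fun s => f (pt t u + s *: e0)) \o shift (- t).
  by apply/funext => s /=; rewrite (pt_line s t).
move=> df; have := line_derive (y := pt t u) (t := 0) (f := f) (v := e0).
rewrite scale0r addr0 => /(_ df) dl.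
have e : (fun h : R => h^-1 *: ((((fun s => f (pt t u + s *: e0)) \o shift (- t)) \o shift t)
      (h *: 1) - ((fun s => f (pt t u + s *: e0)) \o shift (- t)) t)) =
    (fun h => h^-1 *: (((fun s => f (pt t u + s *: e0)) \o shift 0) (h *: 1) -
        f (pt t u + 0 *: e0))).
  by apply/funext => h /=; rewrite addrK addr0 subrr.
by case: dl => dl1 dl2; split; rewrite /derive /derivable e.
Qed.

Lemma pt_continuous u : continuous (fun s => pt s u).
Proof.
rewrite (_ : (fun s => pt s u) = (cst (pt 0 u)) \+ ( *:%R^~ e0)).
  by move=> s; apply: continuousD; [exact: cst_continuous|exact: scalel_continuous].
by apply/funext => s; rewrite (pt_line s 0) subr0.
Qed.

Lemma pt_differentiable s u : differentiable (pt s) u.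
Proof.
apply: diff_row => j; rewrite /pt.
case: (splitP j) => l jl.
  rewrite (_ : (fun z => _) = cst (s%:M 0 l)); first exact: differentiable_cst.
  apply/funext => z; rewrite (_ : j = lshift n l) ?row_mxEl //; exact: val_inj.
rewrite (_ : (fun z => _) = (fun z : E => z 0 l)); first exact: differentiable_coord.
apply/funext => z; rewrite (_ : j = rshift 1 l) ?row_mxEr //; exact: val_inj.
Qed.

Lemma O_pt x b t u : O x b (pt t u) ->
  exists y, [/\ u = chart x y, chart_dom x y, D (t, y) & chart_dom b (phi t y)].
Proof.
move=> [s [y [e xy Dy by_]]].
have := congr1 tau e; have := congr1 rsubmx e.
rewrite -[row_mx _ (chart x y)]/(pt s (chart x y)) !rsub_pt !tau_pt => -> ->.
by exists y.
Qed.

Lemma PsiE x b j t : (fun z => chart b (phi t z) 0 j) \o chart_inv x =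
  fun v => Psi x b j (pt t v).
Proof. by apply/funext => v; rewrite /Psi /= tau_pt rsub_pt. Qed.

(** With [L] the Jacobian of [X] in the chart around phi s0 x, the rows of [J] satisfy J' = J L, so
    the determinant contributes [\tr L]; the coefficient [m] contributes its derivative along [X].
    By [lie_top] the sum is the vanishing Lie derivative. *)
Lemma flow_pullback_derive s0 x (w : 'I_n -> E) : D (s0, x) ->
  is_derive s0 1 (fun s => pullback (phi s) a x w) 0.
Proof.
move=> Ds0; pose b := phi s0 x; have bb := chart_dom_mem b; have xx := chart_dom_mem x.
have [Ux Ub] := flow_dom fl Ds0.
pose u0 := chart x x; pose P := Psi x b.
have oO := @flow_chart_open x b.
have z0O : O x b (pt s0 u0) by exists s0, x.
have PO j : Cinfty (O x b) (P j) := @Psi_smooth x b j.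
pose m := coef a b e_.
pose V := chart_dom b `&` U.
have oV : open V by apply: openI => //; exact: chart_dom_open.
have mV : smooth V m by exact: smooth_form_field.
pose J s i := \row_j 'D_(row_mx 0 (w i)) (P j) (pt s u0) : E.
pose Xi j y := comp b y (X y) 0 j.
pose L : 'M[R]_n := \matrix_(l, j) dir (Xi j) b (e_ l).
(* The chart [b] stays fixed while the image point moves, so this formula holds only for [s] close
   to [s0]. *)
have E1 : \forall s \near s0,
    \det (\matrix_(i, j) J s i 0 j) * m (phi s x) = pullback (phi s) a x w.
  have near_O : \forall s \near s0, O x b (pt s u0).
    by apply: (@pt_continuous u0 s0); apply: open_nbhs_nbhs.
  apply: filterS near_O => s sO.
  have [y [exy xy Dy by_]] := O_pt sO.
  have yx : y = x by rewrite -(chartK xy) -exy /u0 chartK.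
  rewrite yx in Dy by_ => {exy xy yx y}.
  have [_ Up] := flow_dom fl Dy.
  rewrite /pullback.
  have tE i : tangent_map (phi s) x (w i) = const_field b (J s i) (phi s x).
    have eJ : \row_j dir (fun z => chart b (phi s z) 0 j) x (w i) = J s i.
      apply/rowP => j; rewrite mxE [RHS]mxE /dir PsiE.
      exact: (derive_pt x b j s _ (w i)).1.
    rewrite -eJ; apply: tangent_map_chart.
    - have near_u : \forall u \near u0, O x b (pt s u).
        apply: (differentiable_continuous (pt_differentiable s u0)).
        exact: open_nbhs_nbhs.
      have := chart_continuous xx near_u.
      apply: filterS2 (near_chart_dom xx) => z xz /= /O_pt[y [ezy xy _ bzy]].
      by rewrite -(chartK xz) ezy chartK.
    - move=> j; rewrite PsiE; apply: (@differentiable_comp _ _ _ _ (pt s) (P j)).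
        exact: pt_differentiable.
      exact: Cinfty_diff oO (PO j) sO.
  rewrite (_ : (fun i => tangent_map (phi s) x (w i)) =
    fun i => const_field b (J s i) (phi s x)); last by apply/funext.
  by rewrite -[RHS]/(coef a b (J s) (phi s x))
    (alt_top _ (alternating_coef by_ (aU.1 _ Up))).
apply: (near_eq_is_derive E1).
have Vb : V (phi s0 x) by split.
have E2 : is_derive s0 1 (fun s => m (phi s x)) (dir m b (X b)) :=
  flow_ode fl Ds0 oV Vb mV.
have sXi j : smooth_at b (Xi j) by exact: smooth_at_vfield oU XU Ub bb.
have E3 i j : is_derive s0 1 (fun s => J s i 0 j) ((J s0 i *m L) 0 j).
  rewrite (_ : (fun s => J s i 0 j) = fun s => 'D_(row_mx 0 (w i)) (P j) (pt s u0)); last first.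
    by apply/funext => s; rewrite mxE.
  have DO : Cinfty (O x b) ('D_(row_mx 0 (w i)) (P j)) by exact: Cinfty_dir.
  have := line_pt (Cinfty_derivable DO z0O).
  (* The time derivative is moved inside the space derivative, where the flow equation turns it into
     the components of [X] along the flow. *)
  rewrite (Cinfty_schwarz _ _ oO (PO j) z0O).
  rewrite (near_eq_derive (g := (Xi j \o chart_inv b) \o
     (fun z => chart b (phi (tau z) (chart_inv x (rsubmx z)))))); last first.
    apply: filterS (open_nbhs_nbhs (conj oO z0O)) => z.
    rewrite -{1}(pt_tau z) => /O_pt[y [ezy xy Dy by_]].
    have pO : O x b (pt (tau z) (chart x y)) by exists (tau z), y.
    have [_ d1] := line_pt (Cinfty_derivable (PO j) pO).
    have [_ d2] := flow_ode fl Dy (chart_dom_open b) by_ (@smooth_coord _ _ M b j).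
    have PE : (fun s => P j (pt s (chart x y))) = fun s => chart b (phi s y) 0 j.
      by apply/funext => s; rewrite /P /Psi tau_pt rsub_pt chartK.
    by rewrite -{1}(pt_tau z) ezy -d1 /= ezy (chartK xy) (chartK by_) /Xi mxE -d2 PE.
  have [||_ ->] := @chain_rule R n (1 + n) (Xi j \o chart_inv b)
     (fun z => chart b (phi (tau z) (chart_inv x (rsubmx z)))) (pt s0 u0) (row_mx 0 (w i)).
  - by rewrite tau_pt rsub_pt /u0 chartK //; exact: smooth_at_diff (sXi j).
  - by move=> l; exact: Cinfty_diff oO (PO l) z0O.
  move=> dd; apply: is_derive_eq dd _; rewrite tau_pt rsub_pt /u0 chartK //.
  rewrite -[LHS]/(dir (Xi j) b (J s0 i)) (dir_sumv _ (sXi j)) mxE.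
  by apply: eq_bigr => l _; rewrite [L l j]mxE.
have dJ := is_derive_multilinear (@alternating_det R n).1 E3.
rewrite (alt_trace L (J s0) (@alternating_det R n)) in dJ.
apply: is_derive_eq (is_deriveM dJ E2) _.
have := aX (J s0) Ub; rewrite (lie_top (J s0) oU aU XU Ub) => <-.
rewrite mulrDr; congr (_ + _).
by rewrite -[LHS]/(_ * _) mulrC -mulrA mulrCA /m coef_id.
Qed.

(** The times at which the flow is defined at [x] form an interval that contains 0, and on it the
    pullback has derivative zero. At time 0 it is [a x]. *)
Lemma flow_pullback t x : D (t, x) -> pullback (phi t) a x = a x.
Proof.
move=> Dtx; apply/funext => w.
have [D0x p0] := flow_start fl Dtx; have xx := chart_dom_mem x.
have p0E : pullback (phi 0) a x w = a x w.
  rewrite /pullback p0; congr (a x); apply/funext => i; apply/rowP => j.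
  rewrite mxE p0 (eq_dir (g := fun z => chart x z 0 j)).
    by rewrite -[RHS](congr1 (fun v : E => v 0 j) (comp_id x (w i))) mxE.
  (* The tangent map of [phi 0] at [x] depends on [phi 0] near [x]; since [D] is open, it is the
     identity there. *)
  have nD : \forall z \near x, D (0, z).
    have c : ((0 : R), z) @[z --> x] --> ((0 : R), x).
      have c0 : {for x, continuous (fun=> 0 : R)} by exact: cst_continuous.
      have cx : {for x, continuous (fun z : M => z)} by exact: cvg_id.
      exact: cvg_pair c0 cx.
    exact: (c D (open_nbhs_nbhs (conj (flow_open fl) D0x))).
  by apply: filterS nD => z /(flow_start fl) [_ ->].
have Ds s : (0 <= s <= t) || (t <= s <= 0) -> D (s, x).
  have itv := @flow_interval _ _ _ _ _ _ _ fl x.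
  case/orP => st; first exact: (itv 0 t).
  exact: (itv t 0).
rewrite -p0E; pose xi s := pullback (phi s) a x w; rewrite -/(xi t) -/(xi 0).
have cst_ (c d : R) : c <= d ->
    (forall s, c <= s <= d -> is_derive s 1 xi 0) -> xi d = xi c.
  move=> cd dxi; have [||r _ e] := @MVT_segment R xi (fun=> 0) c d cd.
  - by move=> s; rewrite in_itv /= => /andP[cs sd]; apply: dxi; rewrite !ltW.
  - apply: derivable_within_continuous => s; rewrite in_itv /= => /dxi dx.
    exact: ex_derive.
  - by apply/eqP; rewrite -subr_eq0 e mul0r.
have [t0|t0] := leP 0 t.
  by apply: cst_ => // s st; apply: flow_pullback_derive; apply: Ds; rewrite st.
apply/esym/cst_ => [|s st]; first exact: ltW.
by apply: flow_pullback_derive; apply: Ds; rewrite st orbT.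
Qed.

End Flow.

Lemma flow_invariant_lie (R : realType) (n : nat) (M : manifold R n) (U : set M)
    (a : dform M n) (X : vfield M) : open U -> smooth_form U a -> smooth_vfield U X ->
  (forall x v, U x -> lie X a x v = 0) -> flow_invariant U X a.
Proof.
by move=> oU aU XU aX D phi fl t x; exact: (flow_pullback oU aU XU (fun x v => aX x v) fl).
Qed.

(** * Functions with prescribed differential *)

Section Bump.
Variable R : realType.

(* The functions t^-k exp (-1/t), extended by 0; their derivatives are linear
   combinations of members of the family, whence their smoothness at 0. *)
Definition flat (k : nat) (t : R) : R := if 0 < t then t^-1 ^+ k * expR (- t^-1) else 0.

(** For positive [t] the exponential series gives exp (1/t) >= t^-(k+1) / (k+1)!; the spare power of
    [t] becomes the factor [t] of the bound. *)
Lemma flat_le (k : nat) (t : R) : `|flat k t| <= k.+1`!%:R * `|t|.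
Proof.
rewrite /flat; case: ifP => [t0|_]; last by rewrite normr0 mulr_ge0.
have F0 : 0 < k.+1`!%:R :> R by rewrite ltr0n fact_gt0.
have e1 : t^-1 ^+ k.+1 / k.+1`!%:R <= expR t^-1.
  have ti : 0 <= t^-1 by rewrite invr_ge0 ltW.
  by apply: le_trans (expR_ge1Dxn k ti); rewrite lerDr.
rewrite ger0_norm; last by rewrite mulr_ge0 ?exprn_ge0 ?invr_ge0 ?expR_ge0 // ltW.
rewrite gtr0_norm //.
rewrite expRN ler_pdivrMr ?expR_gt0 //.
apply: (@le_trans _ _ (k.+1`!%:R * t * (t^-1 ^+ k.+1 / k.+1`!%:R))); last first.
  by rewrite ler_pM2l // mulr_gt0.
rewrite exprS le_eqVlt; apply/orP; left; apply/eqP.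
by field; rewrite !lt0r_neq0.
Qed.

Lemma flat0 k : flat k 0 = 0.
Proof. by rewrite /flat ltxx. Qed.

Lemma is_derive_flat (k : nat) (t : R) :
  is_derive t 1 (flat k) (- k%:R * flat k.+1 t + flat k.+2 t).
Proof.
have [t0|t0|<-] := ltgtP 0 t.
- rewrite [flat k.+1 t]/flat [flat k.+2 t]/flat t0.
  have dV := is_derive_invX 1 (lt0r_neq0 t0).
  have dE : is_derive t 1 (fun s : R => expR (- s^-1)) (expR (- t^-1) * t^-1 ^+ 2).
    apply: is_derive1_comp.
    have := is_deriveN dV; rewrite mulN1r opprK.
    by rewrite (_ : - (fun s : R => s^-1 ^+ 1) = fun s => - s^-1) //.
  have := is_deriveM (is_derive_invX k (lt0r_neq0 t0)) dE.
  move=> dM; apply: (near_eq_is_derive (f := (fun s => s^-1 ^+ k) * (fun s : R => expR (- s^-1)))).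
    near=> s; rewrite /flat (_ : 0 < s) //; near: s; exact: lt_nbhsr.
  apply: is_derive_eq dM _; rewrite -![_ *: _]/(_ * _).
  by rewrite !exprS; ring.
- rewrite [flat k.+1 t]/flat [flat k.+2 t]/flat ltNge ltW // /= mulr0 addr0.
  apply: (near_eq_is_derive (f := cst 0)).
  near=> s; rewrite /flat ltNge ltW //; near: s; exact: lt_nbhsl.
rewrite !flat0 mulr0 addr0.
(* The difference quotient of [flat k] at 0 is [flat k.+1 h], which tends to 0 by [flat_le]. *)
have c0 : h^-1 *: ((flat k \o shift 0) (h *: 1) - flat k 0) @[h --> 0^'] --> (0 : R).
  apply/cvgrPdist_le => eps eps0.
  pose C : R := k.+2`!%:R.
  have C0 : 0 < C by rewrite ltr0n fact_gt0.
  near=> h; have h0 : h != 0 by near: h; exact: nbhs_dnbhs_neq.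
  have hC : `|h| < eps / C by near: h; apply: dnbhs0_lt; rewrite divr_gt0.
  rewrite sub0r normrN /= flat0 subr0 addr0 [_%:A]mulr1.
  have -> : h^-1 *: flat k h = flat k.+1 h.
    rewrite /flat; case: ifP => _; last by rewrite scaler0.
    by rewrite -[LHS]/(_ * _) mulrA -exprS.
  apply: (le_trans (flat_le _ _)); rewrite -/C mulrC -ler_pdivlMr //; exact: ltW.
split; first by apply/cvg_ex; exists 0.
exact: cvg_lim c0.
Unshelve. all: by end_near. Qed.

Lemma Cinfty_flat n (O : set 'rV[R]_n) f : open O -> Cinfty O f -> Cinfty O (flat 0 \o f).
Proof.
move=> oO fO.
pose psi k := [:: (- k%:R : R, k.+1); (1, k.+2)].
apply: (@Ck_unary _ _ _ flat setT _ _ psi oO _ fO _ 0%N) => // k t _.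
by rewrite big_cons big_seq1 /= mul1r; exact: is_derive_flat.
Qed.

End Bump.

Section PrescribedDifferential.
Variables (R : realType) (n : nat) (M : manifold R n).

(** A linear function of the coordinates centred at [x] is multiplied by a bump supported in a box
    inside the chart image, then extended by 0. As the linear factor vanishes at [x], the derivative
    of the bump does not contribute there. *)
Lemma prescribed_differential (x : M) (b : 'rV[R]_n) :
  exists f : M -> R, smooth setT f /\ differential f x = b.
Proof.
have xx := chart_dom_mem x; pose u0 := chart x x.
have im : (chart x @` chart_dom x) u0 by exists x.
have := open_nbhs_nbhs (conj (@chart_img_open _ _ M x) im).
move=> /nbhs_ballP[d /= d0 dsub].
pose r := d / 2; have r0 : 0 < r by rewrite divr_gt0.
pose K : set 'rV[R]_n := [set v | forall i, `[u0 0 i - r, u0 0 i + r]%classic (v 0 i)].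
have Kc : compact K.
  apply: (@rV_compact R n (fun i => `[u0 0 i - r, u0 0 i + r]%classic)) => i.
  exact: segment_compact.
have Kim u : K u -> (chart x @` chart_dom x) u.
  move=> Ku; apply: dsub; rewrite -ball_normE /ball_ /=.
  apply: (@le_lt_trans _ _ r); last by rewrite /r ltr_pdivrMr // mulr2n mulrDr mulr1 ltrDl.
  rewrite [leLHS]/Num.norm /= mx_normrE; apply/bigmax_leP; split=> [|[i j] _ /=]; first exact: ltW.
  rewrite ord1 !mxE ler_distlC; have := Ku j; rewrite /= in_itv /=.
  by [].
pose KM := chart_inv x @` K.
(* Here the Hausdorff axiom enters: the image of the box is compact, hence closed, and the extension
   by 0 is smooth on its complement. *)
have KMc : closed KM.
  apply: compact_closed; first exact: space_hausdorff.
  apply: continuous_compact => //; apply: continuous_in_subspaceT => u; rewrite inE => /Kim.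
  exact: chart_inv_continuous.
(* The value of the bump at the centre; dividing by it makes the bump equal to 1 at [x]. *)
pose N := \prod_(i < n) flat 0 (r ^+ 2 - (u0 0 i - u0 0 i) ^+ 2).
pose h (u : 'rV[R]_n) := N^-1 * ((\prod_(i < n) flat 0 (r ^+ 2 - (u 0 i - u0 0 i) ^+ 2)) *
   \sum_i b 0 i * (u 0 i - u0 0 i)).
have N0 : N != 0.
  rewrite /N prodf_seq_neq0; apply/allP => i _ /=.
  rewrite subrr expr0n subr0 /flat exprn_gt0 // mul1r gt_eqF // expR_gt0 //.
pose f y := if `[< chart_dom x y >] then h (chart x y) else 0.
have coordC i : Cinfty setT (fun u : 'rV[R]_n => u 0 i - u0 0 i).
  apply: (Cinfty_add (f := fun u : 'rV[R]_n => u 0 i) (g := fun=> - u0 0 i)).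
  - exact: openT.
  - exact: Cinfty_coord.
  - exact: Cinfty_cst.
have bumpC : Cinfty setT (fun u => \prod_(i < n) flat 0 (r ^+ 2 - (u 0 i - u0 0 i) ^+ 2)).
  elim: (index_enum (ordinal n)) => [|i s IH].
    by under eq_fun do rewrite big_nil; exact: Cinfty_cst.
  under eq_fun do rewrite big_cons; apply: Cinfty_mul IH; first exact: openT.
  apply: (Cinfty_flat (f := fun u : 'rV[R]_n => r ^+ 2 - (u 0 i - u0 0 i) ^+ 2)).
    exact: openT.
  apply: (Cinfty_add (f := fun=> r ^+ 2) (g := fun u : 'rV[R]_n => - (u 0 i - u0 0 i) ^+ 2)).
  - exact: openT.
  - exact: Cinfty_cst.
  - under eq_fun do rewrite -mulN1r expr2.
    apply: Cinfty_mul; [exact: openT|exact: Cinfty_cst|].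
    by apply: Cinfty_mul => //; exact: openT.
have sumC : Cinfty setT (fun u : 'rV[R]_n => \sum_i b 0 i * (u 0 i - u0 0 i)).
  apply: Cinfty_sum => [|i _]; first exact: openT.
  by apply: Cinfty_mul => //; [exact: openT|exact: Cinfty_cst].
have hC : Cinfty setT h.
  apply: Cinfty_mul; [exact: openT|exact: Cinfty_cst|].
  by apply: Cinfty_mul => //; exact: openT.
have odom := @chart_dom_open _ _ M x.
have fdom : smooth (chart_dom x) f.
  apply: (smooth_chart (x := x)) => //.
  apply: (@eq_Cinfty _ _ _ h); first exact: (@chart_img_open _ _ M x).
    by move=> _ [y xy <-]; rewrite /f /= chartK // asboolT.
  by apply: Cinfty_sub hC.
exists f; split.
  apply: smooth_local => y _; have [xy|nxy] := pselect (chart_dom x y).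
    by exists (chart_dom x).
  exists (~` KM); split; first exact: closed_openC.
    by move=> [u /Kim[z xz <-]]; rewrite chartK // => zy; apply: nxy; rewrite -zy.
  apply: (eq_smooth (f := fun=> 0)); [exact: closed_openC| |exact: smooth_cst].
  move=> z nKz; rewrite /f; case: asboolP => // xz.
  have [i nKi] : exists i, ~ `[u0 0 i - r, u0 0 i + r]%classic (chart x z 0 i).
    apply/existsNP => Kz; apply: nKz; exists (chart x z) => //; exact: chartK.
  rewrite /h (bigD1 i) //= {1}/flat ifF ?mul0r ?mulr0 //.
  apply/negP; rewrite subr_gt0 => lt_r; apply: nKi; rewrite /= in_itv /= -ler_distlC.
  rewrite distrC -(ger0_norm (ltW r0)) -ler_sqr ?nnegrE // ?real_normK ?num_real //.
  exact: ltW.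
have fx : smooth_at x f by exact: smooth_atP odom fdom xx.
have fhx : \forall z \near x, f z = h (chart x z).
  by apply: filterS (near_chart_dom xx) => z xz; rewrite /f asboolT.
pose B := fun y : M => N^-1 * \prod_(i < n) flat 0 (r ^+ 2 - (chart x y 0 i - u0 0 i) ^+ 2).
pose S := fun y : M => \sum_i b 0 i * (chart x y 0 i - u0 0 i).
have smC (F : 'rV[R]_n -> R) : Cinfty setT F -> smooth_at x (F \o chart x).
  move=> FC; apply: (smooth_atP (U := chart_dom x)) => //.
  apply: (smooth_chart (x := x)) => //.
  apply: (@eq_Cinfty _ _ _ F); first exact: (@chart_img_open _ _ M x).
    by move=> _ [y xy <-]; rewrite /= chartK.
  by apply: Cinfty_sub FC.
have sB : smooth_at x B.
  apply: (smC (fun u => N^-1 * \prod_(i < n) flat 0 (r ^+ 2 - (u 0 i - u0 0 i) ^+ 2))).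
  by apply: Cinfty_mul => //; [exact: openT|exact: Cinfty_cst].
have sS : smooth_at x S by exact: smC sumC.
apply/rowP => j; rewrite differentialE (eq_dir (g := fun z => B z * S z)); last first.
  by apply: filterS fhx => z ->; rewrite /h /B /S mulrA.
rewrite dir_mul // (_ : B x = 1); last by rewrite /B mulVf.
rewrite (_ : S x = 0) ?mul0r ?addr0 ?mul1r; last first.
  by rewrite /S big1 // => i _; rewrite subrr mulr0.
have sc i : smooth_at x (fun z => chart x z 0 i) by exact: smooth_at_coord.
have scc i : smooth_at x (fun z => chart x z 0 i - u0 0 i).
  by apply: smooth_at_add => //; exact: smooth_at_cst.
rewrite /S dir_sum; last by move=> i _; apply: smooth_at_mul => //; exact: smooth_at_cst.
rewrite (bigD1 j) //= big1 => [|i ij].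
  rewrite dir_mul //; last exact: smooth_at_cst.
  rewrite dir_cst mulr0 !addr0 dir_add //; last exact: smooth_at_cst.
  rewrite dir_cst addr0.
  have := congr1 (fun v : 'rV[R]_n => v 0 j) (comp_id x (basis_vec R j)).
  by rewrite mxE => ->; rewrite mxE !eqxx mulr1.
rewrite dir_mul //; last exact: smooth_at_cst.
rewrite dir_cst mulr0 !addr0 dir_add //; last exact: smooth_at_cst.
rewrite dir_cst addr0.
have := congr1 (fun v : 'rV[R]_n => v 0 i) (comp_id x (basis_vec R j)).
by rewrite mxE => ->; rewrite mxE eqxx /= (negbTE ij) mulr0.
Qed.

End PrescribedDifferential.

Lemma sum2 (V : nmodType) (F : 'I_2 -> V) : \sum_i F i = F 0 + F 1.
Proof.
by rewrite !big_ord_recr big_ord0 /= add0r; congr (F _ + F _); exact: val_inj.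
Qed.

(** * Forms on explicit tuples of vectors *)

Section ExplicitTuples.
Variables (R : realType) (n : nat).
Notation E := 'rV[R]_n.

(** Lists let frame vectors be written out one by one; slots beyond the end of the list receive
    0. *)
Definition ev k (T : ('I_k -> E) -> R) (s : seq E) : R := T (fun l => nth 0 s l).

Lemma ev_mkseq k (T : ('I_k -> E) -> R) v : T v = ev T [seq v i | i : 'I_k].
Proof.
congr T; apply/funext => l; rewrite (nth_map l) ?nth_ord_enum //.
by rewrite size_enum_ord.
Qed.

Lemma ev_eq k (T : ('I_k -> E) -> R) (v : 'I_k -> E) s : (forall l, v l = nth 0 s l) ->
  T v = ev T s.
Proof. by move=> e; congr T; apply/funext. Qed.

Lemma nth_omit (s : seq E) (i l : nat) : nth 0 (take i s ++ drop i.+1 s) l = nth 0 s (bump i l).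
Proof.
rewrite nth_cat size_take /bump; case: (ltnP i (size s)) => [is_|si].
  rewrite ltnNge; case: (leqP i l) => il /=.
    by rewrite nth_drop; congr (nth _ _ _); lia.
  by rewrite nth_take // add0n.
case: (ltnP l (size s)) => ls.
  by rewrite (_ : (i <= l)%N = false) ?nth_take //; lia.
rewrite nth_drop !nth_default //; first exact: leq_trans ls (leq_addl _ _).
exact: leq_trans si (leq_trans (leqnSn _) (leq_addr _ _)).
Qed.

Lemma ev_wedge1 k a (T : ('I_k -> E) -> R) s : ev (wedge1 a T) s =
  \sum_(i < k.+1) (-1) ^+ i * (pairing a (nth 0 s i) * ev T (take i s ++ drop i.+1 s)).
Proof.
apply: eq_bigr => i _; congr (_ * (_ * _)); apply: ev_eq => l.
by rewrite nth_omit.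
Qed.

Lemma ev_wedge1_5 a (T : ('I_4 -> E) -> R) v0 v1 v2 v3 v4 :
  ev (wedge1 a T) [:: v0; v1; v2; v3; v4] =
  pairing a v0 * ev T [:: v1; v2; v3; v4] - pairing a v1 * ev T [:: v0; v2; v3; v4]
  + pairing a v2 * ev T [:: v0; v1; v3; v4] - pairing a v3 * ev T [:: v0; v1; v2; v4]
  + pairing a v4 * ev T [:: v0; v1; v2; v3].
Proof. by rewrite ev_wedge1 !big_ord_recr big_ord0 /=; ring. Qed.

Lemma ev_wedge1_4 a (T : ('I_3 -> E) -> R) v0 v1 v2 v3 :
  ev (wedge1 a T) [:: v0; v1; v2; v3] =
  pairing a v0 * ev T [:: v1; v2; v3] - pairing a v1 * ev T [:: v0; v2; v3]
  + pairing a v2 * ev T [:: v0; v1; v3] - pairing a v3 * ev T [:: v0; v1; v2].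
Proof. by rewrite ev_wedge1 !big_ord_recr big_ord0 /=; ring. Qed.

Lemma ev_swap k (T : ('I_k -> E) -> R) s1 a b s2 : alternating T ->
  (size s1 + (size s2).+2 = k)%N ->
  ev T (s1 ++ a :: b :: s2) = - ev T (s1 ++ b :: a :: s2).
Proof.
move=> [Tl Tz] sk.
have ik : (size s1 < k)%N by rewrite -sk; lia.
have jk : ((size s1).+1 < k)%N by rewrite -sk; lia.
have ij : Ordinal ik != Ordinal jk by rewrite -val_eqE /= ltn_eqF.
rewrite /ev -(ml_swap Tl ij (fun v => Tz v _ _ ij)) /=; congr T; apply/funext => l /=.
rewrite !nth_cat; case: tpermP => [->|->|/eqP ni /eqP nj] /=.
- by rewrite ltnn subnn ltnNge leqnSn /= subSnn.
- by rewrite ltnn subnn ltnNge leqnSn /= subSnn.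
case: ltnP => // sl; case e: (l - size s1)%N => [|[|m]] //=.
  by case/eqP: ni; apply: val_inj => /=; apply/eqP; rewrite eqn_leq sl andbT -subn_eq0 e.
by case/eqP: nj; apply: val_inj => /=; lia.
Qed.

(** A multilinear function killed by [K] descends to the quotient by [K]; the arguments are replaced
    one at a time. *)
Lemma ml_mod k (T : ('I_k -> E) -> R) (K : set E) (v w : 'I_k -> E) : multilinear T ->
  (forall v i, K (v i) -> T v = 0) -> (forall i, K (w i - v i)) -> T w = T v.
Proof.
move=> Tl TK wv.
suff H m : (m <= k)%N -> T (fun i => if (i < m)%N then w i else v i) = T v.
  rewrite -(H k (leqnn k)); congr T; apply/funext => i; by rewrite ltn_ord.
elim: m => [|m IH] mk; first by congr T.
rewrite -(IH (ltnW mk)); set im := Ordinal mk.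
have -> : (fun i : 'I_k => if (i < m.+1)%N then w i else v i) =
    update (fun i : 'I_k => if (i < m)%N then w i else v i) im ((w im - v im) + v im).
  apply/funext => i; rewrite /update; case: eqVneq => [->|ni]; first by rewrite /= leqnn subrK.
  rewrite ltnS leq_eqVlt (_ : ((i : nat) == m) = false) //.
  by apply: contraNF ni => /eqP e; apply/eqP/val_inj.
rewrite ml_add // (TK _ im) ?update_same // add0r; congr T; apply/funext => i.
by rewrite /update; case: eqVneq => [->|//]; rewrite /= ltnn.
Qed.

Lemma pairingC (a b : E) : pairing a b = pairing b a.
Proof. by apply: eq_bigr => i _; rewrite mulrC. Qed.

Lemma pairing_sum (I : finType) (c : I -> R) (d : I -> E) (u : E) :
  pairing (\sum_i c i *: d i) u = \sum_i c i * pairing (d i) u.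
Proof.
elim/big_rec2: _ => [|i x y _ <-]; last by rewrite pairingDl.
by rewrite /pairing big1 // => j _; rewrite mxE mul0r.
Qed.

Lemma pairingB (a b u : E) : pairing (a - b) u = pairing a u - pairing b u.
Proof. by rewrite -[a - b]addrC -scaleN1r pairingDl mulN1r addrC. Qed.

(** [Q] ignores what is annihilated by all the [h j], so it factors through a k-dimensional quotient
    with basis [d], and there it is a top-degree form. The lemma serves forms and multivectors
    alike. *)
Lemma alt_restrict k (Q : ('I_k -> E) -> R) (h d : 'I_k -> E) : alternating Q ->
  (forall i j, pairing (d i) (h j) = (i == j)%:R) ->
  (forall a i, (forall j, pairing (a i) (h j) = 0) -> Q a = 0) ->
  forall a, Q a = Q d * \det (\matrix_(i, j) pairing (a i) (h j)).
Proof.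
move=> [Ql Qz] dh Qk a.
pose C (u : 'I_k -> 'rV[R]_k) (i : 'I_k) : E := \sum_j u i 0 j *: d j.
have CU u i w : C (update u i w) = update (C u) i (\sum_j w 0 j *: d j).
  by apply/funext => l; rewrite /C /update; case: eqP.
have aC : alternating (fun u => Q (C u)).
  split=> [u i c w w'|u i j ij e]; last by apply: (Qz _ i j ij); rewrite /C e.
  rewrite !CU -Ql; congr (Q (update _ _ _)); rewrite scaler_sumr -big_split /=.
  by apply: eq_bigr => j _; rewrite !mxE scalerDl scalerA.
pose u (i : 'I_k) : 'rV[R]_k := \row_j pairing (a i) (h j).
have -> : Q a = Q (C u).
  apply: (ml_mod (K := [set b | forall j, pairing b (h j) = 0])) => // i j.
  rewrite /= pairingB pairing_sum (bigD1 j) //= dh eqxx mulr1 mxE big1 ?addr0 ?subrr //.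
  by move=> l lj; rewrite dh (negbTE lj) mulr0.
rewrite (alt_top u aC) mulrC; congr (_ * _).
  congr Q; apply/funext => i; rewrite /C (bigD1 i) //= mxE !eqxx scale1r big1 ?addr0 //.
  by move=> j ji; rewrite mxE eqxx (negbTE ji) scale0r.
by congr determinant; apply/matrixP => i j; rewrite !mxE.
Qed.

(** The factor of [a] inside [contract] as a function of the inserted vectors alone, with the
    reversal of their order that the convention for interior products prescribes. *)
Definition contract_args k m (a : ('I_(k + m) -> E) -> R) (w : 'I_m -> E) (u : 'I_k -> E) : R :=
  a (fun l => match fintype.split l with
              | inl i => u (rev_ord i)
              | inr j => w j
              end).

Lemma contract_args_ml k m (a : ('I_(k + m) -> E) -> R) w : multilinear a ->
  multilinear (contract_args a w).
Proof.
move=> al u i c x y.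
have e z : (fun l : 'I_(k + m) => match fintype.split l with
     | inl j => update u i z (rev_ord j) | inr j => w j end) =
   update (fun l => match fintype.split l with
     | inl j => u (rev_ord j) | inr j => w j end) (lshift m (rev_ord i)) z.
  apply/funext => l; rewrite /update -[l in l == _]splitK; case: fintype.split => j /=.
    by rewrite (inj_eq (@lshift_inj _ _)) -(inj_eq rev_ord_inj) rev_ordK.
  by rewrite eq_rlshift.
by rewrite /contract_args !e al.
Qed.

(** A decomposable [Q] inserts the vectors [h]: expanding the determinant over permutations, the sum
    over basis tuples reassembles [a] on the permuted [h]. The [k!] resulting terms are equal and
    cancel the normalisation. *)
Lemma contract_det k m (Q : ('I_k -> E) -> R) (a : ('I_(k + m) -> E) -> R) w (h : 'I_k -> E)
    (q C : R) : multilinear a ->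
  (forall b, Q b = q * \det (\matrix_(i, j) pairing (b i) (h j))) ->
  (forall s : 'S_k, contract_args a w (fun i => h (s i)) = (-1) ^+ s * C) ->
  contract Q a w = q * C.
Proof.
move=> al Qd aC; rewrite /contract.
have step (I : {ffun 'I_k -> 'I_n}) :
   Q (fun i => basis_vec R (I i)) * contract_args a w (fun i => basis_vec R (I i)) =
   q * \sum_(s : 'S_k) (-1) ^+ s * ((\prod_i h (s i) 0 (I i)) *
         contract_args a w (fun i => basis_vec R (I i))).
  rewrite Qd -mulrA; congr (_ * _); rewrite mulr_suml; apply: eq_bigr => s _.
  rewrite -mulrA; congr (_ * (_ * _)); apply: eq_bigr => i _; rewrite mxE.
  rewrite /pairing (bigD1 (I i)) //= mxE !eqxx mul1r big1 ?addr0 // => j ji.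
  by rewrite mxE eqxx /= (negbTE ji) mul0r.
rewrite (eq_bigr _ (fun I _ => step I)) -mulr_sumr exchange_big /=.
rewrite (eq_bigr (fun=> C)) => [|s _].
  have -> : \sum_(s : 'S_k) C = k`!%:R * C by rewrite sumr_const card_Sn mulr_natl.
  by rewrite [q * _]mulrCA mulKf // pnatr_eq0 -lt0n fact_gt0.
rewrite -mulr_sumr -(ml_expand (fun i => h (s i)) (contract_args_ml w al)) aC.
by rewrite mulrA -expr2 sqrr_sign mul1r.
Qed.

Lemma det2 (A : 'M[R]_2) : \det A = A 0 0 * A 1 1 - A 0 1 * A 1 0.
Proof.
rewrite (expand_det_row _ 0) !big_ord_recl big_ord0 addr0 /cofactor !det_mx11 !mxE /=.
rewrite expr0 mul1r expr1 mulN1r mulrN; congr (A _ _ * A _ _ - A _ _ * A _ _);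
exact: val_inj.
Qed.

Lemma wedge_prod11 (a b : ('I_1 -> E) -> R) s :
  ev (wedge_prod a b) s = a (fun=> nth 0 s 0) * b (fun=> nth 0 s 1) -
                          a (fun=> nth 0 s 1) * b (fun=> nth 0 s 0).
Proof.
pose A : 'M[R]_2 := \matrix_(i, j) (if i == 0 then a else b) (fun=> nth 0 s j).
transitivity (\det A); last by rewrite det2 !mxE /=.
rewrite /ev /wedge_prod (_ : (1`! * 1`!)%N = 1%N) // invr1 mul1r /determinant.
apply: eq_bigr => t _; congr (_ * _).
rewrite big_ord_recl big_ord1 !mxE /=; congr (a _ * b _); apply/funext => i.
  by rewrite (ord1 i); congr (nth _ _ (t _)); exact: val_inj.
by rewrite (ord1 i); congr (nth _ _ (t _)); exact: val_inj.
Qed.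

End ExplicitTuples.

Section ExplicitForms.
Variables (R : realType) (n : nat) (M : manifold R n).
Notation E := 'rV[R]_n.
Implicit Types (x y z : M) (f g : M -> R).

Lemma ev_ext_d k (a : dform M k) x s : ev (ext_d a x) s =
  \sum_(i < k.+1) (-1) ^+ i * dir
     (fun y => ev (a y) (map (fun u => const_field x u y) (take i s ++ drop i.+1 s)))
     x (nth 0 s i).
Proof.
rewrite /ev ext_dE; apply: eq_bigr => i _; congr (_ * _); congr (dir _ x _).
apply/funext => y; rewrite /coef; congr (a y); apply/funext => l.
rewrite -[nth 0 s (lift i l)](nth_omit s i l).
case: (ltnP l (size (take i s ++ drop i.+1 s))) => ls; first by rewrite (nth_map 0).
by rewrite !nth_default ?size_map // const_field0.
Qed.

Lemma dir_sub f g y v : smooth_at y f -> smooth_at y g ->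
  dir (fun z => f z - g z) y v = dir f y v - dir g y v.
Proof.
move=> fy gy; have gN : smooth_at y (fun z => -1 * g z).
  by apply: smooth_at_mul => //; exact: smooth_at_cst.
under eq_fun do rewrite -mulN1r.
rewrite dir_add // dir_mul //; last exact: smooth_at_cst.
by rewrite dir_cst mulr0 addr0 mulN1r.
Qed.

Lemma smooth_at_sub f g y : smooth_at y f -> smooth_at y g ->
  smooth_at y (fun z => f z - g z).
Proof.
move=> fy gy; under eq_fun do rewrite -mulN1r.
by apply: smooth_at_add => //; apply: smooth_at_mul => //; exact: smooth_at_cst.
Qed.

Lemma dir_alt_sum (f1 f2 f3 g1 g2 g3 : M -> R) x u :
  smooth_at x f1 -> smooth_at x f2 -> smooth_at x f3 ->
  smooth_at x g1 -> smooth_at x g2 -> smooth_at x g3 ->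
  dir (fun y => f1 y * g1 y - f2 y * g2 y + f3 y * g3 y) x u =
  (f1 x * dir g1 x u + g1 x * dir f1 x u) -
  (f2 x * dir g2 x u + g2 x * dir f2 x u) +
  (f3 x * dir g3 x u + g3 x * dir f3 x u).
Proof.
move=> sf1 sf2 sf3 sg1 sg2 sg3.
have s1 := smooth_at_mul sf1 sg1; have s2 := smooth_at_mul sf2 sg2.
have s3 := smooth_at_mul sf3 sg3.
rewrite (dir_add u (smooth_at_sub s1 s2) s3) (dir_sub u s1 s2).
by rewrite (dir_mul u sf1 sg1) (dir_mul u sf2 sg2) (dir_mul u sf3 sg3).
Qed.

Lemma dir_scaled_det (k f1 f2 g1 g2 : M -> R) x u : smooth_at x k ->
  smooth_at x f1 -> smooth_at x f2 -> smooth_at x g1 -> smooth_at x g2 ->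
  dir (fun y => k y * (f1 y * g1 y - f2 y * g2 y)) x u =
  k x * ((f1 x * dir g1 x u + g1 x * dir f1 x u) - (f2 x * dir g2 x u + g2 x * dir f2 x u)) +
  (f1 x * g1 x - f2 x * g2 x) * dir k x u.
Proof.
move=> sk sf1 sf2 sg1 sg2.
have s1 := smooth_at_mul sf1 sg1; have s2 := smooth_at_mul sf2 sg2.
rewrite (dir_mul u sk (smooth_at_sub s1 s2)) (dir_sub u s1 s2).
by rewrite (dir_mul u sf1 sg1) (dir_mul u sf2 sg2).
Qed.

(** The Leibniz rule d (b /\ W) = db /\ W - b /\ dW for a closed [W], with db /\ W written as the
    sum over the six ways to choose the two arguments of db. *)
Lemma ext_d_wedge1_closed U (b : dform M 1) (W : dform M 2) x v0 v1 v2 v3 :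
  open U -> smooth_form U b -> smooth_form U W -> U x ->
  (forall v, ext_d W x v = 0) ->
  let db p q := ev (ext_d b x) [:: p; q] in
  let w p q := ev (W x) [:: p; q] in
  ev (ext_d (fun y => wedge1 (covector (b y)) (W y)) x) [:: v0; v1; v2; v3] =
    db v0 v1 * w v2 v3 - db v0 v2 * w v1 v3 + db v0 v3 * w v1 v2
    + db v1 v2 * w v0 v3 - db v1 v3 * w v0 v2 + db v2 v3 * w v0 v1.
Proof.
move=> oU bU WU Ux dW db w; have xx := chart_dom_mem x.
pose bb p y := pairing (covector (b y)) (const_field x p y).
pose ww p q y := ev (W y) [:: const_field x p y; const_field x q y].
have sw p q : smooth_at x (ww p q).
  have := smooth_at_coef (fun i : 'I_2 => nth 0 [:: p; q] i) oU WU Ux xx.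
  rewrite (_ : coef W x _ = ww p q) //; apply/funext => y; apply: ev_eq => l.
  by case: l => [[|[|l]] H].
have bE p : \forall y \near x, b y (fun=> const_field x p y) = bb p y.
  apply: filterS (open_nbhs_nbhs (conj oU Ux)) => y Uy.
  by rewrite /bb covector_pairing //; exact: (bU.1 _ Uy).1.
have sb p : smooth_at x (bb p).
  exists (chart_dom x `&` U).
  have oV : open (chart_dom x `&` U) by apply: openI => //; exact: chart_dom_open.
  split=> //; apply: (eq_smooth (f := fun y => b y (fun=> const_field x p y))) => //.
    by move=> y [_ Uy]; rewrite /bb covector_pairing //; exact: (bU.1 _ Uy).1.
  exact: (@smooth_form_field _ _ _ _ U _ x (fun=> p)).
have dbE p q : db p q = dir (bb q) x p - dir (bb p) x q.
  rewrite /db ev_ext_d !big_ord_recr big_ord0 /= add0r expr0 mul1r expr1 mulN1r.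
  by congr (_ - _); apply: eq_dir; [move: (bE q)|move: (bE p)];
    apply: filterS => y <-; rewrite /ev; congr (b y); apply/funext => l; rewrite (ord1 l).
have wE p q : w p q = ww p q x by rewrite /w /ww !const_field_id.
(* Closedness of [W], solved for one derivative; substituting it cancels all terms in which [b]
   itself is not differentiated. *)
have dWE p q r : dir (ww q r) x p = dir (ww p r) x q - dir (ww p q) x r.
  have := dW (fun i : 'I_3 => nth 0 [:: p; q; r] i).
  rewrite -[ext_d _ _ _]/(ev _ _) ev_ext_d !big_ord_recr big_ord0 /=.
  rewrite add0r expr0 mul1r expr1 mulN1r sqrrN expr1n mul1r => /eqP.
  by rewrite -addrA addr_eq0 opprD opprK => /eqP ->.
have term p q r u : dir (fun y => ev (wedge1 (covector (b y)) (W y))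
    [:: const_field x p y; const_field x q y; const_field x r y]) x u =
  (bb p x * dir (ww q r) x u + ww q r x * dir (bb p) x u) -
  (bb q x * dir (ww p r) x u + ww p r x * dir (bb q) x u) +
  (bb r x * dir (ww p q) x u + ww p q x * dir (bb r) x u).
  rewrite -(dir_alt_sum u (sb p) (sb q) (sb r) (sw q r) (sw p r) (sw p q)).
  congr (dir _ x u); apply/funext => y; rewrite ev_wedge1 !big_ord_recr big_ord0 /=.
  by rewrite add0r expr0 mul1r expr1 mulN1r sqrrN expr1n mul1r.
rewrite ev_ext_d !big_ord_recr big_ord0 /=.
rewrite (dbE v0 v1) (dbE v0 v2) (dbE v0 v3) (dbE v1 v2) (dbE v1 v3) (dbE v2 v3).
rewrite (wE v0 v1) (wE v0 v2) (wE v0 v3) (wE v1 v2) (wE v1 v3) (wE v2 v3).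
have alg (h : E -> R) (dh l : E -> E -> R) (dl : E -> E -> E -> R) :
  (forall p q r, dl q r p = dl p r q - dl p q r) ->
  (-1) ^+ 0 * (h v1 * dl v2 v3 v0 + l v2 v3 * dh v1 v0 -
    (h v2 * dl v1 v3 v0 + l v1 v3 * dh v2 v0) + (h v3 * dl v1 v2 v0 + l v1 v2 * dh v3 v0)) +
  (-1) ^+ 1 * (h v0 * dl v2 v3 v1 + l v2 v3 * dh v0 v1 -
    (h v2 * dl v0 v3 v1 + l v0 v3 * dh v2 v1) + (h v3 * dl v0 v2 v1 + l v0 v2 * dh v3 v1)) +
  (-1) ^+ 2 * (h v0 * dl v1 v3 v2 + l v1 v3 * dh v0 v2 -
    (h v1 * dl v0 v3 v2 + l v0 v3 * dh v1 v2) + (h v3 * dl v0 v1 v2 + l v0 v1 * dh v3 v2)) +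
  (-1) ^+ 3 * (h v0 * dl v1 v2 v3 + l v1 v2 * dh v0 v3 -
    (h v1 * dl v0 v2 v3 + l v0 v2 * dh v1 v3) + (h v2 * dl v0 v1 v3 + l v0 v1 * dh v2 v3)) =
  (dh v1 v0 - dh v0 v1) * l v2 v3 - (dh v2 v0 - dh v0 v2) * l v1 v3 +
  (dh v3 v0 - dh v0 v3) * l v1 v2 + (dh v2 v1 - dh v1 v2) * l v0 v3 -
  (dh v3 v1 - dh v1 v3) * l v0 v2 + (dh v3 v2 - dh v2 v3) * l v0 v1.
  by move=> dl3; rewrite (dl3 v0 v1 v2) (dl3 v0 v1 v3) (dl3 v0 v2 v3) (dl3 v1 v2 v3); ring.
rewrite add0r; apply: etrans _ (alg (fun p => bb p x) (fun p u => dir (bb p) x u)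
  (fun p q => ww p q x) (fun p q u => dir (ww p q) x u) dWE).
by congr (_ * _ + _ * _ + _ * _ + _ * _); exact: term.
Qed.

End ExplicitForms.

(** * Adapted frames of a fibred 5-manifold *)

Section PulledBackArea.
Variables (R : realType) (M : manifold R 5) (B : manifold R 2) (pi : M -> B).
Variable om : dform B 2.
Hypotheses (pi_smooth : smooth_map setT pi) (om_smooth : smooth_form setT om).
Notation E := 'rV[R]_5.
Implicit Types x y : M.

Lemma pi_preimage_open V : open V -> open (pi @^-1` V).
Proof.
move=> oV; have c : continuous pi by move=> x; exact: pi_smooth.1.
by move/continuousP: c; exact.
Qed.

Lemma smooth_pullback V f : open V -> smooth V f -> smooth (pi @^-1` V) (f \o pi).
Proof. by move=> oV fV; have := pi_smooth.2 V f oV fV; rewrite setTI. Qed.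

Definition pcoord (b : B) (j : 'I_2) : M -> R := fun z => chart b (pi z) 0 j.

Lemma smooth_pcoord b j : smooth (pi @^-1` chart_dom b) (pcoord b j).
Proof.
apply: (smooth_pullback (f := fun u => chart b u 0 j)) (@smooth_coord _ _ B b j).
exact: chart_dom_open.
Qed.

Lemma smooth_at_pcoord b j y : chart_dom b (pi y) -> smooth_at y (pcoord b j).
Proof.
move=> by_; exists (pi @^-1` chart_dom b); split=> //; last exact: smooth_pcoord.
by apply: pi_preimage_open; exact: chart_dom_open.
Qed.

Lemma tangent_map_lin x a (u v : E) :
  tangent_map pi x (a *: u + v) = a *: tangent_map pi x u + tangent_map pi x v.
Proof.
apply/rowP => j; rewrite !mxE dir_lin //.
exact: smooth_at_pcoord (chart_dom_mem (pi x)).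
Qed.

Lemma tangent_map0 x : tangent_map pi x 0 = 0.
Proof. by have := tangent_map_lin x (-1) 0 0; rewrite scaler0 addr0 scaleN1r addNr. Qed.

(** In a fixed chart of the base the area form is a function times dq_0 /\ dq_1, where [pcoord b j]
    is the j-th coordinate pulled back to [M]. *)
Lemma pullback_area b y (v : 'I_2 -> E) : chart_dom b (pi y) ->
  OmH pi om y v = coef om b (@basis_vec R 2) (pi y) *
    (dir (pcoord b 0) y (v 0) * dir (pcoord b 1) y (v 1) -
     dir (pcoord b 1) y (v 0) * dir (pcoord b 0) y (v 1)).
Proof.
move=> by_.
have tE i : tangent_map pi y (v i) =
    const_field b (\row_j dir (pcoord b j) y (v i)) (pi y).
  apply: tangent_map_chart.
    apply: (open_nbhs_nbhs (A := pi @^-1` chart_dom b)); split=> //.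
    by apply: pi_preimage_open; exact: chart_dom_open.
  by move=> j; apply: smooth_at_diff; exact: smooth_at_pcoord.
rewrite /OmH /pullback
  (_ : (fun i => _) = fun i => const_field b (\row_j dir (pcoord b j) y (v i)) (pi y));
  last by apply/funext.
rewrite -[LHS]/(coef om b (fun i => \row_j dir (pcoord b j) y (v i)) (pi y)).
rewrite (alt_top _ (alternating_coef by_ (om_smooth.1 _ I))) mulrC det2 !mxE.
by [].
Qed.

Lemma alternating_OmH x : alternating (OmH pi om x).
Proof.
have [ol oz] := om_smooth.1 (pi x) I.
have tu k (v : 'I_k -> E) i u : (fun l => tangent_map pi x (update v i u l)) =
    update (fun l => tangent_map pi x (v l)) i (tangent_map pi x u).
  by apply/funext => l; rewrite /update; case: eqP.
split=> [v i a u w|v i j ij e]; last by apply: (oz _ i j ij); rewrite e.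
by rewrite /OmH /pullback (tu _ v i (a *: u + w)) (tu _ v i u) (tu _ v i w) tangent_map_lin ol.
Qed.

Lemma smooth_coef_pi b : smooth (pi @^-1` chart_dom b) (coef om b (@basis_vec R 2) \o pi).
Proof.
apply: smooth_pullback; first exact: chart_dom_open.
have := @smooth_form_field _ _ _ _ setT om b (@basis_vec R 2) openT om_smooth.
by rewrite setIT.
Qed.

Lemma smooth_OmH : smooth_form setT (OmH pi om).
Proof.
split=> [x _|W X oW _ XW]; first exact: alternating_OmH.
apply: smooth_local => x Wx; pose b := pi x.
pose V := W `&` pi @^-1` chart_dom b.
have opb : open (pi @^-1` chart_dom b) by apply: pi_preimage_open; exact: chart_dom_open.
have oV : open V by exact: openI.
exists V; split=> //; first by split=> //; exact: chart_dom_mem.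
apply: (eq_smooth (f := fun y => (coef om b (@basis_vec R 2) \o pi) y *
    (dir (pcoord b 0) y (X 0 y) * dir (pcoord b 1) y (X 1 y) -
     dir (pcoord b 1) y (X 0 y) * dir (pcoord b 0) y (X 1 y)))) => //.
  by move=> y [_ by_]; rewrite (pullback_area _ by_).
have sd i j : smooth V (fun y => dir (pcoord b j) y (X i y)).
  apply: XW => //; first by move=> y [].
  by apply: smooth_sub (smooth_pcoord b j) => y [].
apply: smooth_mul => //; first by apply: smooth_sub (smooth_coef_pi b) => y [].
apply: smooth_add => //; first exact: smooth_mul.
under eq_fun do rewrite -mulN1r.
by apply: smooth_mul => //; [exact: smooth_cst|exact: smooth_mul].
Qed.

(** With [K] dq_0 /\ dq_1 as in [pullback_area], dK is a combination of dq_0 and dq_1 because [K]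
    comes from the base, and the second derivatives of the q_j cancel by symmetry. *)
Lemma OmH_closed x v : ext_d (OmH pi om) x v = 0.
Proof.
pose b := pi x; have xx := chart_dom_mem x; have bx : chart_dom b (pi x) by exact: chart_dom_mem.
rewrite ev_mkseq.
have -> : [seq v i | i : 'I_3] = [:: v 0; v 1; v (lift 0 1)].
  rewrite /image_mem enum_ordSl /= enum_ordSl enum_ordSl /= enum_ord0 /=.
  by congr [:: v _; v _; v _]; exact: val_inj.
move: (v 0) (v 1) (v (lift 0 1)) => p q r.
pose K := coef om b (@basis_vec R 2) \o pi.
pose P j u := pd x u (pcoord b j).
pose ww u w y := K y * (P 0 u y * P 1 w y - P 1 u y * P 0 w y).
have near_b : \forall y \near x, chart_dom x y /\ chart_dom b (pi y).
  have opb : open (pi @^-1` chart_dom b) by apply: pi_preimage_open; exact: chart_dom_open.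
  by apply: filterS2 (near_chart_dom xx) (open_nbhs_nbhs (conj opb bx)).
have wwE u w : \forall y \near x,
    ev (OmH pi om y) [:: const_field x u y; const_field x w y] = ww u w y.
  apply: filterS near_b => y [xy by_]; rewrite /ev (pullback_area _ by_) /=.
  by rewrite !dir_const_field //; exact: smooth_at_pcoord.
have sK : smooth_at x K.
  exists (pi @^-1` chart_dom b); split=> //; last exact: smooth_coef_pi.
  by apply: pi_preimage_open; exact: chart_dom_open.
have sP j u : smooth_at x (P j u).
  by apply: smooth_at_pd => //; exact: smooth_at_pcoord.
have dP j u w : dir (P j u) x w = dir (P j w) x u.
  by apply: pd_schwarz; exact: smooth_at_pcoord.
pose H j := 'D_(@basis_vec R 2 j) (coef om b (@basis_vec R 2) \o chart_inv b) (chart b (pi x)).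
have dK u : dir K x u = P 0 u x * H 0 + P 1 u x * H 1.
  have sm : smooth_at (pi x) (coef om b (@basis_vec R 2)).
    exact: smooth_at_coef openT om_smooth I bx.
  rewrite (@dir_chain _ _ _ 2 (coef om b (@basis_vec R 2) \o chart_inv b)
    (fun z => chart b (pi z))).
  - have [W [oW Wb sW]] := sm.
    have oI := @chart_image_openI _ _ B b W oW.
    have im : (chart b @` (chart_dom b `&` W)) (chart b (pi x)).
      exact: ex_intro2 (conj bx Wb) erefl.
    by rewrite (Cinfty_dirE _ oI (sW b) im) sum2 mxE mxE.
  - by apply: filterS near_b => y [_ by_]; rewrite /= chartK.
  - by have [W [oW Wb sW]] := sm; exact: smooth_differentiable sW Wb bx.
  - by move=> j; apply: smooth_at_diff; exact: smooth_at_pcoord.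
have term u w t : dir (fun y => ev (OmH pi om y) [:: const_field x u y; const_field x w y]) x t =
  K x * ((P 0 u x * dir (P 1 w) x t + P 1 w x * dir (P 0 u) x t) -
         (P 1 u x * dir (P 0 w) x t + P 0 w x * dir (P 1 u) x t)) +
  (P 0 u x * P 1 w x - P 1 u x * P 0 w x) * (P 0 t x * H 0 + P 1 t x * H 1).
  rewrite (eq_dir t (wwE u w)) -(dK t).
  exact: dir_scaled_det t sK (sP 0 u) (sP 1 u) (sP 1 w) (sP 0 w).
have alg (c h0 h1 : R) (a0 a1 : E -> R) (d0 d1 : E -> E -> R) :
  (forall u w, d0 u w = d0 w u) -> (forall u w, d1 u w = d1 w u) ->
  let T u w t := c * ((a0 u * d1 w t + a1 w * d0 u t) - (a1 u * d0 w t + a0 w * d1 u t)) +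
     (a0 u * a1 w - a1 u * a0 w) * (a0 t * h0 + a1 t * h1) in
  (-1) ^+ 0 * T q r p + (-1) ^+ 1 * T p r q + (-1) ^+ 2 * T p q r = 0.
  move=> s0 s1 T; rewrite /T (s0 r p) (s0 q p) (s0 r q) (s1 r p) (s1 q p) (s1 r q); ring.
rewrite ev_ext_d !big_ord_recr big_ord0 /= add0r.
apply: etrans (alg (K x) (H 0) (H 1) (fun u => P 0 u x) (fun u => P 1 u x)
  (fun u w => dir (P 0 u) x w) (fun u w => dir (P 1 u) x w) (dP 0) (dP 1)).
by congr (_ + _ + _); congr (_ * _); [exact: (term q r p)|exact: (term p r q)|exact: (term p q r)].
Qed.

End PulledBackArea.

(** * Frames adapted to a connection *)

Section AdaptedFrame.
Variables (R : realType) (M : manifold R 5) (B : manifold R 2) (pi : M -> B).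
Variable g : M -> 'M[R]_5.
Hypotheses (bundle : fiber_bundle pi) (conn : connection pi g).
Notation E := 'rV[R]_5.
Implicit Types x : M.

Let pi_smooth : smooth_map setT pi. Proof. by case: bundle. Qed.

Lemma vertical_fixed x v : vertical pi x v -> v *m g x = v.
Proof. by case: conn => _ h _; exact: h. Qed.

Lemma vertical_horizontal0 x v : vertical pi x v -> horizontal g x v -> v = 0.
Proof. by move=> vv vh; rewrite -(vertical_fixed vv). Qed.

(** [g x] is idempotent: its values are vertical, and vertical vectors are fixed. *)
Lemma horizontal_part x v : horizontal g x (v - v *m g x).
Proof.
rewrite /horizontal /= mulmxBl [_ *m _ *m _]vertical_fixed ?subrr //.
by case: conn => h _ _; exact: h.
Qed.

Lemma tangent_horizontal_part x v :
  tangent_map pi x (v - v *m g x) = tangent_map pi x v.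
Proof.
have vv : tangent_map pi x (v *m g x) = 0 by case: conn => h _ _; exact: h.
by rewrite addrC -scaleN1r (tangent_map_lin pi_smooth) vv scaler0 add0r.
Qed.

Lemma hor_vecP x w : horizontal g x (hor_vec pi g x w) /\
  tangent_map pi x (hor_vec pi g x w) = w.
Proof.
apply: (@getPex _ [set v | horizontal g x v /\ tangent_map pi x v = w]).
have [v vw] : exists v, tangent_map pi x v = w by case: bundle => _ _ h; exact: h.
exists (v - v *m g x); split; first exact: horizontal_part.
by rewrite tangent_horizontal_part.
Qed.

Lemma tangent_mapE x v : tangent_map pi x v =
  v *m \matrix_(i, j) tangent_map pi x (basis_vec R i) 0 j.
Proof.
rewrite {1}(basis_sum v); apply/rowP => j; rewrite [RHS]mxE.
have lin := tangent_map_lin pi_smooth x.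
have -> : tangent_map pi x (\sum_i v 0 i *: basis_vec R i) =
    \sum_i v 0 i *: tangent_map pi x (basis_vec R i).
  elim/big_rec2: _ => [|i a b _ <-]; last by rewrite lin.
  exact: (tangent_map0 pi_smooth).
by rewrite summxE; apply: eq_bigr => i _; rewrite !mxE.
Qed.

Lemma adapted_frame x : exists f d : nat -> E,
  [/\ (forall i j, (i < 5)%N -> (j < 5)%N -> pairing (f i) (d j) = (i == j)%:R),
      (forall v, v = \sum_(i < 5) pairing v (d i) *: f i),
      (forall i, (i < 2)%N -> horizontal g x (f i)),
      (forall i : 'I_2, f i = hor_vec pi g x (basis_vec R i)) &
      (forall i, (2 <= i < 5)%N -> vertical pi x (f i))].
Proof.
pose P : 'M[R]_(5, 2) := \matrix_(i, j) tangent_map pi x (basis_vec R i) 0 j.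
have tP v : tangent_map pi x v = v *m P by exact: tangent_mapE.
pose Hm : 'M[R]_(2, 5) := \matrix_(i < 2) hor_vec pi g x (basis_vec R i).
have HP : Hm *m P = 1%:M.
  apply/row_matrixP => i; rewrite row_mul rowK -tP (hor_vecP x _).2.
  by apply/rowP => j; rewrite !mxE eqxx eq_sym.
have rP : \rank P = 2%N.
  apply/eqP; rewrite eqn_leq rank_leq_col /= -{1}(mxrank1 R 2) -HP.
  exact: mxrankM_maxr.
have rK : \rank (kermx P) = 3%N by rewrite mxrank_ker rP.
pose K : 'M[R]_(3, 5) := castmx (rK, erefl) (row_base (kermx P)).
have KP : K *m P = 0.
  apply/row_matrixP => i; rewrite row_mul row0.
  apply/eqP; rewrite -sub_kermx; apply: submx_trans (row_sub _ _) _.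
  by rewrite eqmx_cast eq_row_base.
have Kfree u : u *m K = 0 -> u = 0.
  move=> uK; apply: (row_free_inj (_ : row_free K)); last by rewrite uK mul0mx.
  by rewrite /row_free eqmx_cast eq_row_base rK.
pose F : 'M[R]_5 := col_mx Hm K.
(* Applying the matrix [P] of the tangent map to a linear relation kills the vertical rows and shows
   that the horizontal coefficients vanish; the rows of [K] are independent. *)
have Fu : F \in unitmx.
  rewrite -row_free_unit; apply: inj_row_free => u.
  rewrite -[u](@hsubmxK _ 1 2 3) /F (mul_row_col (n1 := 2) (n2 := 3)) => e.
  have l0 : lsubmx (u : 'M[R]_(1, 2 + 3)) = 0.
    have := congr1 (mulmx^~ P) e.
    by rewrite mulmxDl -!mulmxA HP KP mulmx0 mulmx1 addr0 mul0mx.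
  move: e; rewrite l0 mul0mx add0r => /Kfree ->.
  by rewrite row_mx0.
(* The rows of the transposed inverse are the basis dual to the rows of [F]. *)
pose G := (invmx F)^T.
have pFG (v : E) j : pairing v (row j G) = (v *m invmx F) 0 j.
  by rewrite mxE; apply: eq_bigr => l _; rewrite !mxE.
have FH (i : 'I_2) : row (inord i) F = hor_vec pi g x (basis_vec R i).
  have -> : inord i = lshift 3 i :> 'I_5.
    by apply: val_inj; rewrite /= inordK // (leq_trans (ltn_ord i)).
  by rewrite /F (rowKu i Hm K) rowK.
have hor i : (i < 2)%N -> horizontal g x (row (inord i) F).
  by move=> i2; rewrite (FH (Ordinal i2)); exact: (hor_vecP x _).1.
exists (fun i => row (inord i) F), (fun i => row (inord i) G); split=> //.
- move=> i j i5 j5; rewrite pFG -row_mul mulmxV // !mxE -val_eqE /=.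
  by rewrite !inordK.
- move=> v; rewrite -{1}[v](mulmxKV Fu) mulmx_sum_row; apply: eq_bigr => i _.
  by rewrite inord_val pFG.
- move=> i /andP[i2 i5]; rewrite /vertical /= tP.
  have i3 : (i - 2 < 3)%N by rewrite ltn_subLR.
  have -> : inord i = rshift 2 (Ordinal i3) :> 'I_5.
    by apply: val_inj; rewrite /= inordK // subnKC.
  by rewrite /F (rowKd (Ordinal i3) Hm K) -row_mul KP row0.
Qed.

End AdaptedFrame.

Lemma alternating_precomp (R : realType) m n k (T : ('I_k -> 'rV[R]_n) -> R)
    (L : 'rV[R]_m -> 'rV[R]_n) : alternating T ->
  (forall c u w, L (c *: u + w) = c *: L u + L w) -> alternating (fun v => T (fun i => L (v i))).
Proof.
move=> [Tl Tz] Ll; split=> [v i c u w|v i j ij e]; last by apply: (Tz _ i j ij); rewrite e.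
have Lu z : (fun l => L (update v i z l)) = update (fun l => L (v l)) i (L z).
  by apply/funext => l; rewrite /update; case: eqP.
by rewrite !Lu Ll Tl.
Qed.

Lemma alternating_insert (R : realType) n k (T : ('I_k.+1 -> 'rV[R]_n) -> R) u :
  alternating T -> alternating (insert u T).
Proof.
move=> [Tl Tz]; split=> [v i c z w|v i j ij e].
  have pu t : push u (update v i t) = update (push u v) (lift ord0 i) t.
    apply/funext => l; rewrite /update /push; case: unliftP => [a ->|->].
      by rewrite (inj_eq lift_inj).
    by rewrite (negbTE (neq_lift _ _)).
  by rewrite /insert !pu Tl.
apply: (Tz _ (lift ord0 i) (lift ord0 j)); first by rewrite (inj_eq lift_inj).
by rewrite /push !liftK.
Qed.

Section Differentials.
Variables (R : realType) (n : nat) (M : manifold R n).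
Implicit Types (x y : M) (f g : M -> R).
Notation E := 'rV[R]_n.

Lemma dir_unary (h : R -> R) (dh : R) f y v : smooth_at y f -> is_derive (f y) 1 h dh ->
  dir (fun z => h (f z)) y v = dh * dir f y v.
Proof.
move=> fy [da dv]; have df := smooth_at_diff fy; have yy := chart_dom_mem y.
have dda : differentiable h ((f \o chart_inv y) (chart y y)).
  by rewrite /= chartK //; apply/derivable1_diffP.
have dc : differentiable (h \o (f \o chart_inv y)) (chart y y) by exact: differentiable_comp.
rewrite /dir -[X in 'D_v X _ = _]/(h \o (f \o chart_inv y)).
rewrite deriveE // diff_comp //= diff1E // -deriveE // derive1E.
by rewrite chartK // dv mulrC.
Qed.

Lemma differential_cst (c : R) x : differential (fun=> c) x = 0.
Proof. by apply/rowP => i; rewrite differentialE dir_cst mxE. Qed.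

Lemma differential_add f g x : smooth_at x f -> smooth_at x g ->
  differential (fun z => f z + g z) x = differential f x + differential g x.
Proof. by move=> fx gx; apply/rowP => i; rewrite [RHS]mxE !differentialE dir_add. Qed.

Lemma differential_mul f g x : smooth_at x f -> smooth_at x g ->
  differential (fun z => f z * g z) x = f x *: differential g x + g x *: differential f x.
Proof.
move=> fx gx; apply/rowP => i.
by rewrite [RHS]mxE [X in _ = X + _]mxE [X in _ = _ + X]mxE !differentialE dir_mul.
Qed.

Lemma differential_expR f x : smooth_at x f ->
  differential (fun z => expR (f z)) x = expR (f x) *: differential f x.
Proof.
move=> fx; apply/rowP => i; rewrite [RHS]mxE !differentialE.
by rewrite (dir_unary _ fx (is_derive_expR _)).
Qed.

Lemma differential_lnabs f x : smooth_at x f -> f x != 0 ->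
  differential (fun z => ln `|f z|) x = (f x)^-1 *: differential f x.
Proof.
move=> fx f0; apply/rowP => i; rewrite [RHS]mxE !differentialE.
by rewrite (dir_unary _ fx (is_derive_lnabs f0)).
Qed.

Lemma wedge1Zr k a c (T : ('I_k -> E) -> R) :
  wedge1 a (fun u => c * T u) = fun v => c * wedge1 a T v.
Proof.
apply/funext => v; rewrite /wedge1 mulr_sumr; apply: eq_bigr => i _; ring.
Qed.

Lemma wedge1Dr k a (S T : ('I_k -> E) -> R) :
  wedge1 a (fun u => S u + T u) = fun v => wedge1 a S v + wedge1 a T v.
Proof.
apply/funext => v; rewrite /wedge1 -big_split; apply: eq_bigr => i _ /=; ring.
Qed.

Lemma wedge1Zl k a c (T : ('I_k -> E) -> R) v : wedge1 (c *: a) T v = c * wedge1 a T v.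
Proof.
rewrite /wedge1 mulr_sumr; apply: eq_bigr => i _.
have -> : pairing (c *: a) (v i) = c * pairing a (v i).
  rewrite -[c *: a]addr0 pairingDl [pairing 0 _]big1 ?addr0 // => j _.
  by rewrite mxE mul0r.
ring.
Qed.

(** [ham_dir] computes P (df, b) only when [b] is a differential; [prescribed_differential] makes
    every covector one. *)
Lemma ham_eq0 (P : mvector M 2) f x : multilinear (P x) ->
  ham P f x = 0 <-> forall b, P x (pair2 (differential f x) b) = 0.
Proof.
move=> Pl; split=> [h0 b|P0]; last by apply/rowP => j; rewrite !mxE; exact: P0.
have [phi [sphi <-]] := prescribed_differential x b.
by rewrite -ham_dir ?h0 ?dir0 //; exact: smooth_atP openT sphi I.
Qed.

End Differentials.

Lemma alternating_contract_args (R : realType) n k m (a : ('I_(k + m) -> 'rV[R]_n) -> R) w :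
  alternating a -> alternating (contract_args a w).
Proof.
move=> [al az]; split; first exact: contract_args_ml.
move=> v i j ij e; apply: (az _ (lshift m (rev_ord i)) (lshift m (rev_ord j))).
  by rewrite (inj_eq (@lshift_inj _ _)) (inj_eq rev_ord_inj).
have sl l : fintype.split (lshift m l) = inl l :> 'I_k + 'I_m := unsplitK (inl l).
by rewrite !sl !rev_ordK.
Qed.

Lemma contract_alt (R : realType) n k m (Q : ('I_k -> 'rV[R]_n) -> R)
    (a : ('I_(k + m) -> 'rV[R]_n) -> R) w (h : 'I_k -> 'rV[R]_n) q : alternating a ->
  (forall b, Q b = q * \det (\matrix_(i, j) pairing (b i) (h j))) ->
  contract Q a w = q * contract_args a w h.
Proof.
move=> aa Qd; apply: (contract_det aa.1 Qd) => s.
exact: alt_perm (alternating_contract_args w aa).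
Qed.

(** Any other index set of the same size contains an index outside [S0], where the argument is
    vertical and its horizontal part is 0; a single term of the sum survives. *)
Lemma bicomp_vertical (R : realType) (M : manifold R 5) (g : M -> 'M[R]_5) k p (a : dform M k)
    x (S0 : {set 'I_k}) v : #|S0| = p -> multilinear (a x) ->
  (forall i, i \notin S0 -> v i *m g x = v i) ->
  bicomp g p a x v = a x (fun i => if i \in S0 then v i - v i *m g x else v i).
Proof.
move=> <- al vS; rewrite /bicomp (bigD1 S0) //= big1 ?addr0.
  by congr (a x); apply/funext => i; case: ifP => // /negbT /vS.
move=> S /andP[/eqP cS SS0].
have [i iS iS0] : exists2 i, i \in S & i \notin S0.
  apply/subsetPn; apply: contra SS0 => sub; rewrite eqEcard sub cS leqnn //.
by apply: (ml_zero (i := i)) => //; rewrite iS vS ?subrr.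
Qed.

Lemma bicomp_ml (R : realType) (M : manifold R 5) (g : M -> 'M[R]_5) k p (a : dform M k) x :
  multilinear (a x) -> multilinear (bicomp g p a x).
Proof.
move=> al v l c u w; rewrite /bicomp mulr_sumr -big_split /=; apply: eq_bigr => S _.
pose part (z : 'rV[R]_5) := if l \in S then z - z *m g x else z *m g x.
have e z : (fun i => if i \in S then update v l z i - update v l z i *m g x
      else update v l z i *m g x) =
    update (fun i => if i \in S then v i - v i *m g x else v i *m g x) l (part z).
  by apply/funext => i; rewrite /update /part; case: eqP => [->|].
rewrite !e -al; congr (a x (update _ _ _)); rewrite /part; case: ifP => _.
  by rewrite mulmxDl -scalemxAl scalerBr opprD addrACA.
by rewrite mulmxDl -scalemxAl.
Qed.

Lemma det3 (R : comRingType) (A : 'M[R]_3) : \det A =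
  A 0 0 * (A 1 1 * A 2 2 - A 1 2 * A 2 1) - A 0 1 * (A 1 0 * A 2 2 - A 1 2 * A 2 0)
  + A 0 2 * (A 1 0 * A 2 1 - A 1 1 * A 2 0).
Proof.
rewrite (expand_det_row _ 0) !big_ord_recr big_ord0 /= add0r /cofactor.
have d2 (C : 'M[R]_2) : \det C = C 0 0 * C 1 1 - C 0 1 * C 1 0.
  rewrite (expand_det_row _ 0) !big_ord_recr big_ord0 /= add0r /cofactor !det_mx11 !mxE /=.
  rewrite expr0 mul1r expr1 mulN1r mulrN; congr (C _ _ * C _ _ - C _ _ * C _ _);
  exact: val_inj.
rewrite !d2 !mxE /= expr0 mul1r expr1 mulN1r sqrrN expr1n mul1r mulrN.
by congr (A _ _ * (A _ _ * A _ _ - A _ _ * A _ _) - A _ _ * (A _ _ * A _ _ - A _ _ * A _ _)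
  + A _ _ * (A _ _ * A _ _ - A _ _ * A _ _)); exact: val_inj.
Qed.

Lemma smooth_fn_form (R : realType) n (M : manifold R n) (U : set M) f :
  smooth U f -> smooth_form U (fn_form f).
Proof.
move=> sf; split=> [x _|W X oW WU _]; first by split=> [v []|v []].
exact: smooth_sub WU sf.
Qed.

Lemma ev_cons_lin (R : realType) n k (T : ('I_k.+1 -> 'rV[R]_n) -> R) c u u' s :
  multilinear T -> ev T (c *: u + u' :: s) = c * ev T (u :: s) + ev T (u' :: s).
Proof.
have e z : ev T (z :: s) = T (update (fun l => nth 0 (0 :: s) l) ord0 z).
  by congr T; apply/funext => -[[|l] H].
by move=> Tl; rewrite !e Tl.
Qed.

Lemma ord2P (j : 'I_2) : j = 0 \/ j = 1.
Proof. by case: j => [[|[|j]] H] //; [left|right]; exact: val_inj. Qed.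

(** * The 3-form dual to the coupling tensor *)

Section PointwiseGeometry.
Variables (R : realType) (M : manifold R 5) (B : manifold R 2) (pi : M -> B).
Variables (Om : dform M 5) (om : dform B 2) (g : M -> 'M[R]_5) (kappa : M -> R).
Variables (beta : dform M 1) (OmV : dform M 3) (QH : mvector M 2) (QV : mvector M 3).
Variable psi : mvector B 2.
Hypotheses (bundle : fiber_bundle pi) (Om_volume : volume_form setT Om).
Hypotheses (om_area : volume_form setT om) (data : bundle_data pi Om om g OmV QH QV psi).
Hypothesis triple : poisson_triple pi g OmV QH QV kappa beta.
Hypothesis beta_closed : forall x v, d01 g 0 beta x v = 0.
Notation E := 'rV[R]_5.

Let pi_smooth : smooth_map setT pi. Proof. by case: bundle. Qed.
Let conn : connection pi g. Proof. exact: triple_connection triple. Qed.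

(* The constant c with Omega = c w mu on an adapted frame, where pi^* omega and
   Omega^V take the values w and mu there. *)
Definition wedge_const : R := (2`! * 3`!)%:R^-1 * \sum_(s : 'S_(2 + 3)) (-1) ^+ s *
  (\det (\matrix_(i < 2, j < 2) (s (lshift 3 i) == j :> nat)%:R) *
   \det (\matrix_(i < 3, j < 3) (s (rshift 2 i) == (2 + j)%N :> nat)%:R)).

Definition dual3 : dform M 3 := fun y v =>
  kappa y * OmV y v + wedge1 (covector (beta y)) (OmH pi om y) v.

(** * Computations in an adapted frame at one point *)

Section AtPoint.
Variables (x : M) (f d : nat -> E).
Hypothesis fd : forall i j, (i < 5)%N -> (j < 5)%N -> pairing (f i) (d j) = (i == j)%:R.
Hypothesis fspan : forall v, v = \sum_(i < 5) pairing v (d i) *: f i.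
Hypothesis fhor : forall i, (i < 2)%N -> horizontal g x (f i).
Hypothesis fhv : forall i : 'I_2, f i = hor_vec pi g x (basis_vec R i).
Hypothesis fver : forall i, (2 <= i < 5)%N -> vertical pi x (f i).

Let w := ev (OmH pi om x) [:: f 0; f 1].
Let mu := ev (OmV x) [:: f 2; f 3; f 4].

(** The tangent map sends [f 0], [f 1] to the basis of the base and kills the other frame vectors,
    so [d 0] and [d 1] are its two components. *)
Lemma tangent_coord v (j : 'I_2) : tangent_map pi x v 0 j = pairing v (d j).
Proof.
have lin := tangent_map_lin pi_smooth x.
rewrite {1}[v]fspan.
have -> : tangent_map pi x (\sum_(i < 5) pairing v (d i) *: f i) =
    \sum_(i < 5) pairing v (d i) *: tangent_map pi x (f i).
  elim/big_rec2: _ => [|i a b _ <-]; last by rewrite lin.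
  exact: (tangent_map0 pi_smooth).
have tf (i : 'I_5) : tangent_map pi x (f i) 0 j = (i == j :> nat)%:R.
  have [i2|i2] := ltnP i 2.
    have := (hor_vecP bundle conn x (basis_vec R (Ordinal i2))).2.
    by rewrite -fhv /= => ->; rewrite mxE eqxx eq_sym.
  have -> : tangent_map pi x (f i) = 0 by apply: fver; rewrite i2 /=.
  by rewrite [LHS]mxE gtn_eqF // (leq_trans (ltn_ord j)).
rewrite summxE.
have -> : \sum_(i < 5) (pairing v (d i) *: tangent_map pi x (f i)) 0 j =
    \sum_(i < 5) pairing v (d i) * (i == j :> nat)%:R.
  by apply: eq_bigr => i _; rewrite -tf [LHS]mxE.
rewrite (bigD1 (widen_ord (isT : 2 <= 5)%N j)) //= eqxx mulr1 big1 ?addr0 // => i ij.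
by rewrite (_ : (i == j :> nat) = false) ?mulr0 //; exact: negbTE ij.
Qed.

Lemma vertical_of v : (forall j : 'I_2, pairing v (d j) = 0) -> vertical pi x v.
Proof. by move=> vd; apply/rowP => j; rewrite tangent_coord vd mxE. Qed.

Lemma vertical_coord v (j : 'I_2) : vertical pi x v -> pairing v (d j) = 0.
Proof. by rewrite -tangent_coord => ->; rewrite mxE. Qed.

Lemma horizontal_lin a u v : horizontal g x u -> horizontal g x v -> horizontal g x (a *: u + v).
Proof.
by rewrite /horizontal /= => hu hv; rewrite mulmxDl -scalemxAl hu hv scaler0 addr0.
Qed.

Lemma horizontal_span v : horizontal g x v ->
  v = pairing v (d 0) *: f 0 + pairing v (d 1) *: f 1.
Proof.
move=> hv; apply/eqP; rewrite -subr_eq0; apply/eqP.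
apply: (vertical_horizontal0 conn (x := x)).
  apply: vertical_of => j; rewrite pairingB pairingDl.
  have j5 : (j < 5)%N by rewrite (leq_trans (ltn_ord j)).
  rewrite -[_ *: f 1]addr0 pairingDl !fd // (_ : pairing 0 _ = 0); last first.
    by rewrite /pairing big1 // => i _; rewrite mxE mul0r.
  by case: (ord2P j) => ->; rewrite /= ?mulr1 ?mulr0 ?addr0 ?add0r subrr.
rewrite -[v - _]addrC -scaleN1r; apply: horizontal_lin => //; apply: horizontal_lin => //.
  exact: fhor.
by rewrite -[_ *: f 1]addr0; apply: horizontal_lin; [exact: fhor|rewrite /horizontal /= mul0mx].
Qed.

Lemma horizontal_of v : (forall j : 'I_3, pairing v (d (2 + j)) = 0) -> horizontal g x v.
Proof.
move=> vd; rewrite [v]fspan.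
have h0 : horizontal g x 0 by rewrite /horizontal /= mul0mx.
apply: (big_ind (fun u => horizontal g x u)) => // [u u' hu hu'|i _].
  by rewrite -[u]scale1r; exact: horizontal_lin.
rewrite -[_ *: _]addr0; have [i2|i2] := ltnP i 2.
  by apply: horizontal_lin => //; exact: fhor.
have i3 : (i - 2 < 3)%N by rewrite ltn_subLR.
have := vd (Ordinal i3); rewrite /= subnKC // => ->.
by rewrite scale0r addr0.
Qed.

Lemma OmH_vertical0 v i : vertical pi x (v i) -> OmH pi om x v = 0.
Proof. by move=> vi; apply: (ml_zero (i := i)) vi; exact: (om_area.1.1 _ I).1. Qed.

Lemma ev_OmH i j : (i < j < 5)%N ->
  ev (OmH pi om x) [:: f i; f j] = if j == 1%N then w else 0.
Proof.
case: eqP => [-> /andP[]|j1 /andP[ij j5]]; first by case: i.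
apply: (OmH_vertical0 (i := 1)); apply: fver; rewrite j5 andbT.
by case: j j1 ij {j5} => [|[|j]].
Qed.

Lemma ev_OmV i j k : (i < j < k)%N && (k < 5)%N ->
  ev (OmV x) [:: f i; f j; f k] = if i == 2%N then mu else 0.
Proof.
move=> /andP[/andP[ij jk] k5]; have [i2|i2] := eqVneq i 2%N.
  have k4 : k = 4%N by lia.
  have j3 : j = 3%N by lia.
  by rewrite k4 j3 i2.
have iS : (i < 2)%N by lia.
exact: (OmV_vertical data (i := 0)) (fhor iS).
Qed.

Lemma OmH_det v : OmH pi om x v =
  w * \det (\matrix_(i < 2, j < 2) pairing (v i) (d j)).
Proof.
rewrite (alt_restrict (h := fun j : 'I_2 => d j) (d := fun i : 'I_2 => f i)).
- congr (_ * _); apply: ev_eq => l; by case: (ord2P l) => ->.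
- exact: alternating_OmH pi_smooth om_area.1 x.
- by move=> i j; rewrite fd // (leq_trans (ltn_ord _)).
- by move=> a i ad; apply: (OmH_vertical0 (i := i)); exact: vertical_of.
Qed.

Lemma OmV_det v : OmV x v =
  mu * \det (\matrix_(i < 3, j < 3) pairing (v i) (d (2 + j))).
Proof.
rewrite (alt_restrict (h := fun j : 'I_3 => d (2 + j)) (d := fun i : 'I_3 => f (2 + i))).
- congr (_ * _); apply: ev_eq => l; by case: l => [[|[|[|l]]] H].
- exact: (OmV_smooth data).1 x I.
- by move=> i j; rewrite fd ?eqn_add2l // -[5%N]/(2 + 3)%N ltn_add2l.
- by move=> a i ad; apply: (OmV_vertical data (i := i)); exact: horizontal_of.
Qed.

Lemma Om_frame : Om x (fun i => f i) = wedge_const * (w * mu).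
Proof.
rewrite (OmV_def data) /wedge_prod /wedge_const -mulrA; congr (_ * _).
rewrite mulr_suml; apply: eq_bigr => s _; rewrite -mulrA; congr (_ * _).
rewrite OmH_det OmV_det mulrACA mulrC; congr (_ * _ * _).
  by congr determinant; apply/matrixP => i j; rewrite !mxE fd // (leq_trans (ltn_ord j)).
congr determinant; apply/matrixP => i j; rewrite !mxE fd //.
by rewrite -[5%N]/(2 + 3)%N ltn_add2l.
Qed.

Lemma frame_neq0 : \det (\matrix_(i < 5, j < 5) f i 0 j) != 0.
Proof.
pose F : 'M[R]_5 := \matrix_(i, j) f i 0 j; pose D : 'M[R]_5 := \matrix_(i, j) d j 0 i.
have FD : F *m D = 1%:M.
  apply/matrixP => i j; rewrite !mxE -(fd (ltn_ord i) (ltn_ord j)).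
  by apply: eq_bigr => l _; rewrite !mxE.
have : \det (F *m D) != 0 by rewrite FD det1 oner_neq0.
by rewrite det_mulmx mulf_eq0 negb_or => /andP[].
Qed.

Lemma top_ext (T S : ('I_5 -> E) -> R) : alternating T -> alternating S ->
  T (fun i => f i) = S (fun i => f i) -> forall v, T v = S v.
Proof.
move=> Ta Sa; rewrite (alt_top _ Ta) (alt_top _ Sa) => /(mulfI frame_neq0) e v.
by rewrite (alt_top _ Ta) (alt_top _ Sa) e.
Qed.

Lemma frame_list : (fun i : 'I_5 => f i) = fun i : 'I_5 => nth 0 [:: f 0; f 1; f 2; f 3; f 4] i.
Proof. by apply/funext => -[[|[|[|[|[|i]]]]] H]. Qed.

(** Their product is the value on the frame of the volume form, which is nonzero; thus [wedge_const]
    need not be evaluated. *)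
Lemma wmu_neq0 : [/\ wedge_const != 0, w != 0 & mu != 0].
Proof.
have [v] := Om_volume.2 x I.
rewrite (alt_top _ (Om_volume.1.1 x I)) mulf_eq0 negb_or => /andP[_ o0].
have : Om x (fun i => f i) != 0.
  by rewrite (alt_top _ (Om_volume.1.1 x I)) mulf_neq0 // frame_neq0.
by rewrite Om_frame !mulf_eq0 !negb_or => /and3P[].
Qed.

Let q := QV x (fun i : 'I_3 => d (2 + i)).

Lemma QV_det b : QV x b = q * \det (\matrix_(i < 3, j < 3) pairing (b i) (f (2 + j))).
Proof.
apply: alt_restrict; first exact: (QV_smooth data).1 x I.
  by move=> i j; rewrite pairingC fd ?eqn_add2l 1?eq_sym // -[5%N]/(2 + 3)%N ltn_add2l.
move=> a i af; apply: (QV_vertical data (i := i)) => v vv.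
rewrite pairingC [v]fspan pairing_sum big1 // => l _.
have [l2|l2] := ltnP l 2.
  by rewrite (vertical_coord (Ordinal l2) vv) mul0r.
have l3 : (l - 2 < 3)%N by rewrite ltn_subLR.
by have := af (Ordinal l3); rewrite /= subnKC // pairingC => ->; rewrite mulr0.
Qed.

(** The sign is that of reversing three vectors, an odd permutation, in the normalisation of
    [QV]. *)
Lemma q_mu : q * mu = -1.
Proof.
have V := (OmV_smooth data).1 x I.
have := congr1 (fun F => F (fun=> 0 : E)) (QV_def data x).
rewrite (contract_alt (k := 3) (m := 0) (fun=> 0) V QV_det) => e.
have e3 : contract_args (k := 3) (m := 0) (OmV x) (fun=> 0) (fun j : 'I_3 => f (2 + j)) =
    ev (OmV x) [:: f 4; f 3; f 2].
  apply: (@ev_eq _ _ 3 (OmV x)) => l; case: (splitP (m := 3) (n := 0) l) => [i -> /=|[]//].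
  by case: i => [[|[|[|i]]] H].
have s1 := @ev_swap _ _ 3 (OmV x) [::] (f 4) (f 3) [:: f 2] V erefl.
have s2 := @ev_swap _ _ 3 (OmV x) [:: f 3] (f 4) (f 2) [::] V erefl.
have s3 := @ev_swap _ _ 3 (OmV x) [::] (f 3) (f 2) [:: f 4] V erefl.
by move: e; rewrite e3 s1 s2 s3 opprK mulrN -/mu => <-; rewrite opprK.
Qed.

Notation p a k := (pairing a (f k)).
Notation bt := (covector (beta x)).

(** The minus sign in P_beta cancels the one in [q_mu], leaving the determinant of the vertical
    components of beta, [a] and [b]. *)
Lemma Pbeta_frame a b : vertical_tensor QV beta x (pair2 a b) * mu =
  p bt 2 * (p a 3 * p b 4 - p a 4 * p b 3) - p bt 3 * (p a 2 * p b 4 - p a 4 * p b 2)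
  + p bt 4 * (p a 2 * p b 3 - p a 3 * p b 2).
Proof.
rewrite /vertical_tensor /insert QV_det mulNr mulrAC q_mu mulN1r opprK det3 !mxE.
have e0 : push bt (pair2 a b) (0 : 'I_3) = bt by rewrite /push unlift_none.
have e1 : push bt (pair2 a b) (1 : 'I_3) = a.
  rewrite (_ : 1 = lift ord0 ord0 :> 'I_3); last exact: val_inj.
  by rewrite /push liftK /pair2 /push unlift_none.
have e2 : push bt (pair2 a b) (2 : 'I_3) = b.
  rewrite (_ : 2 = lift ord0 (lift ord0 ord0) :> 'I_3); last exact: val_inj.
  by rewrite /push liftK /pair2 /push liftK.
by rewrite e0 e1 e2.
Qed.

(** The normalisation of psi by -1 and the reversal of two vectors compensate each other, so psi
    takes the value 1/w on the dual basis of the base. *)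
Lemma hor_frame a b : hor_lift pi g psi x (pair2 a b) * w = p a 0 * p b 1 - p a 1 * p b 0.
Proof.
have P := (psi_smooth data).1 (pi x) I; have O := om_area.1.1 (pi x) I.
have psi_e u : psi (pi x) u = psi (pi x) (@basis_vec R 2) *
    \det (\matrix_(i, j) pairing (u i) (basis_vec R j)).
  rewrite (alt_top _ P) mulrC; congr (_ * determinant _); apply/matrixP => i j; rewrite !mxE.
  rewrite /pairing (bigD1 j) //= mxE !eqxx mulr1 big1 ?addr0 // => l lj.
  by rewrite mxE eqxx /= (negbTE lj) mulr0.
have pw : psi (pi x) (@basis_vec R 2) * w = 1.
  have := congr1 (fun F => F (fun=> 0 : 'rV[R]_2)) (psi_def data (pi x)).
  rewrite (contract_alt (k := 2) (m := 0) (fun=> 0) O psi_e) => e.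
  have e2 : contract_args (k := 2) (m := 0) (om (pi x)) (fun=> 0) (@basis_vec R 2) =
      ev (om (pi x)) [:: basis_vec R 1; basis_vec R 0].
    apply: (@ev_eq _ _ 2 (om (pi x))) => l.
    case: (splitP (m := 2) (n := 0) l) => [i -> /=|[]//].
    case: (ord2P i) => -> /=; congr (basis_vec R _); exact: val_inj.
  have wE : w = ev (om (pi x)) [:: basis_vec R 0; basis_vec R 1].
    apply: (@ev_eq _ _ 2 (om (pi x))
      (fun i : 'I_2 => tangent_map pi x (nth 0 [:: f 0; f 1] i))) => l.
    have t (i : 'I_2) : tangent_map pi x (f i) = basis_vec R i.
      by rewrite fhv (hor_vecP bundle conn x _).2.
    by case: (ord2P l) => -> /=; [exact: (t 0)|exact: (t 1)].
  have s1 := @ev_swap _ _ 2 (om (pi x)) [::] (basis_vec R 1) (basis_vec R 0) [::] O erefl.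
  move: e; rewrite e2 s1 -wE mulrN => /eqP.
  by rewrite eqr_opp => /eqP.
rewrite /hor_lift (alt_top _ P) -mulrA pw mulr1 det2 !mxE.
have e0 : pair2 a b 0 = a by rewrite /pair2 /push unlift_none.
have e1 : pair2 a b 1 = b.
  by rewrite (_ : 1 = lift ord0 ord0 :> 'I_2) ?/pair2 ?/push ?liftK //; exact: val_inj.
by rewrite e0 e1 -!fhv.
Qed.

Lemma alternating_dual3 : alternating (dual3 x).
Proof.
apply: alternating_add; first by apply: alternating_scale; exact: (OmV_smooth data).1 x I.
by apply: alternating_wedge1; exact: alternating_OmH pi_smooth om_area.1 x.
Qed.

Lemma ev_dual3 i j k : (i < j < k)%N && (k < 5)%N -> ev (dual3 x) [:: f i; f j; f k] =
  kappa x * (if i == 2%N then mu else 0) + (if j == 1%N then p bt k * w else 0).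
Proof.
move=> ijk; have /andP[/andP[ij jk] k5] := ijk.
rewrite -[LHS]/(kappa x * ev (OmV x) _ + ev (wedge1 bt (OmH pi om x)) _) ev_OmV //.
congr (_ + _); rewrite ev_wedge1 !big_ord_recr big_ord0 /= add0r expr0 mul1r.
rewrite (ev_OmH (i := j)) ?jk // (ev_OmH (i := i) (j := k)) ?k5 ?andbT; last exact: ltn_trans jk.
rewrite (ev_OmH (i := i) (j := j)) ?ij ?(ltn_trans jk) //.
have -> : (k == 1%N) = false by lia.
rewrite !mulr0 !add0r sqrrN expr1n mul1r.
by case: (j == 1%N); rewrite ?mulr0.
Qed.

(** Both sides are top-degree forms in [v], so it suffices to compare them on the frame, where
    [hor_frame] and [Pbeta_frame] reduce the claim to a polynomial identity. *)
Lemma coupling_dual a b v : coupling_tensor pi g QV psi kappa beta x (pair2 a b) * Om x v =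
  wedge_const * wedge1 a (wedge1 b (dual3 x)) v.
Proof.
have [c0 w0 m0] := wmu_neq0.
move: v; apply: top_ext.
- by apply: alternating_scale; exact: Om_volume.1.1.
- by apply: alternating_scale; do 2 apply: alternating_wedge1; exact: alternating_dual3.
rewrite Om_frame frame_list -[wedge1 _ _ _]/(ev _ _).
have hE := hor_frame a b; have bE := Pbeta_frame a b.
have -> : coupling_tensor pi g QV psi kappa beta x (pair2 a b) * (wedge_const * (w * mu)) =
  wedge_const * (kappa x * mu * (hor_lift pi g psi x (pair2 a b) * w) +
                 w * (vertical_tensor QV beta x (pair2 a b) * mu)).
  by rewrite /coupling_tensor; ring.
rewrite hE bE; congr (_ * _).
rewrite ev_wedge1_5 !ev_wedge1_4.
have D i j k h := @ev_dual3 i j k h.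
rewrite (D 2 3 4 isT) (D 1 3 4 isT) (D 1 2 4 isT) (D 1 2 3 isT) (D 0 3 4 isT).
rewrite (D 0 2 4 isT) (D 0 2 3 isT) (D 0 1 4 isT) (D 0 1 3 isT) (D 0 1 2 isT) /=.
clearbody w mu; ring.
Qed.

Notation T := (ext_d OmV x).

Let T_alt : alternating T.
Proof. exact: alternating_ext_d openT (OmV_smooth data) I. Qed.

(** The d_{1,0} component with three vertical arguments sees only the horizontal part of the fourth.
    The sign in theta cancels that of [q_mu], and moving [u] to the front while restoring the order
    of the [f] is an even permutation. *)
Lemma theta_frame (v : 'I_1 -> E) : theta g OmV QV x v * mu =
  ev T [:: v 0 - v 0 *m g x; f 2; f 3; f 4].
Proof.
set u := v 0 - _.
have sl k m (l : 'I_k) : fintype.split (lshift m l) = inl l :> 'I_k + 'I_m := unsplitK (inl l).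
have sr k m (l : 'I_m) : fintype.split (rshift k l) = inr l :> 'I_k + 'I_m := unsplitK (inr l).
have step (h : 'I_3 -> E) : (forall i, vertical pi x (h i)) ->
    contract_args (k := 3) (m := 1) (d10 g 0 OmV x) v h =
    contract_args (k := 3) (m := 1) T (fun=> u) h.
  move=> hv; pose S0 : {set 'I_(3 + 1)} := [set rshift 3 ord0]%SET.
  have c1 : #|S0| = 1%N by rewrite cards1.
  have inS (j : 'I_1) : rshift 3 j \in S0 by rewrite (ord1 j) set11.
  have ninS (j : 'I_3) : lshift 1 j \notin S0.
    by apply/set1P => /eqP; rewrite eq_lrshift.
  apply: (etrans (@bicomp_vertical R M g 4 1 (ext_d OmV) x S0 _ c1 T_alt.1 _)).
    move=> i; rewrite -[i](@splitK 3 1).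
    case: (@fintype.split 3 1 i) => j; rewrite /unsplit ?sl ?sr.
      by move=> _; exact: (vertical_fixed conn (hv _)).
    by rewrite inS.
  rewrite /contract_args; congr (ext_d OmV x); apply/funext => l.
  rewrite -[l](@splitK 3 1); case: (@fintype.split 3 1 l) => j; rewrite /unsplit ?sl ?sr.
    by rewrite (negbTE (ninS j)).
  by rewrite inS (ord1 j).
have C : contract (m := 1) (QV x) (d10 g 0 OmV x) v = q * ev T [:: f 4; f 3; f 2; u].
  apply: (contract_det (k := 3) (m := 1) (h := fun j : 'I_3 => f (2 + j))).
  - apply: bicomp_ml; exact: T_alt.1.
  - exact: QV_det.
  move=> s; rewrite step; last first.
    by move=> i; apply: fver; rewrite leq_addr /= -[5%N]/(2 + 3)%N ltn_add2l.
  have Ca : alternating (contract_args (k := 3) (m := 1) T (fun=> u)).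
    exact: (@alternating_contract_args R 5 3 1 T (fun=> u) T_alt).
  have eT : contract_args (k := 3) (m := 1) T (fun=> u) (fun j : 'I_3 => f (2 + j)) =
      ev T [:: f 4; f 3; f 2; u].
    apply: (@ev_eq _ _ 4 T) => l; case: (splitP (m := 3) (n := 1) l) => j -> /=.
      by case: j => [[|[|[|j]]] H].
    by rewrite (ord1 j).
  rewrite -eT; exact: (alt_perm s (fun j : 'I_3 => f (2 + j)) Ca).
have s1 := @ev_swap _ _ 4 T [:: f 4; f 3] (f 2) u [::] T_alt erefl.
have s2 := @ev_swap _ _ 4 T [:: f 4] (f 3) u [:: f 2] T_alt erefl.
have s3 := @ev_swap _ _ 4 T [::] (f 4) u [:: f 3; f 2] T_alt erefl.
have s4 := @ev_swap _ _ 4 T [:: u] (f 4) (f 3) [:: f 2] T_alt erefl.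
have s5 := @ev_swap _ _ 4 T [:: u; f 3] (f 4) (f 2) [::] T_alt erefl.
have s6 := @ev_swap _ _ 4 T [:: u] (f 3) (f 2) [:: f 4] T_alt erefl.
rewrite /theta C mulNr mulrAC q_mu mulN1r opprK.
by rewrite s1 s2 s3 s4 s5 s6 !opprK.
Qed.

(** On two horizontal and two vertical arguments d_{2,-1} is the full derivative. The value of [QH]
    on the dual basis is -1/w, and restoring the order of [f 0], [f 1] gives a second sign. *)
Lemma rho_frame a b : vertical pi x a -> vertical pi x b ->
  rho g OmV QH x (fun l : 'I_2 => nth 0 [:: a; b] l) * w = ev T [:: f 0; f 1; a; b].
Proof.
move=> va vb; pose r := QH x (fun i : 'I_2 => d i).
have sl k m (l : 'I_k) : fintype.split (lshift m l) = inl l :> 'I_k + 'I_m := unsplitK (inl l).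
have sr k m (l : 'I_m) : fintype.split (rshift k l) = inr l :> 'I_k + 'I_m := unsplitK (inr l).
have QH_det c : QH x c = r * \det (\matrix_(i < 2, j < 2) pairing (c i) (f j)).
  apply: alt_restrict; first exact: (QH_smooth data).1 x I.
    by move=> i j; rewrite pairingC fd 1?eq_sym // (leq_trans (ltn_ord _)).
  move=> c' i cf; apply: (QH_horizontal data (i := i)) => v /horizontal_span ->.
  rewrite pairingC pairingDl -[_ *: f 1]addr0 pairingDl.
  rewrite ![pairing (f _) _]pairingC (cf 0) (cf 1) !mulr0 !add0r.
  by rewrite /pairing big1 // => l _; rewrite mxE mul0r.
have V := alternating_OmH pi_smooth om_area.1 x.
have rw : r * w = -1.
  have := congr1 (fun F => F (fun=> 0 : E)) (QH_def data x).
  rewrite (contract_alt (k := 2) (m := 0) (fun=> 0) V QH_det) => e.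
  have e3 : contract_args (k := 2) (m := 0) (OmH pi om x) (fun=> 0) (fun j : 'I_2 => f j) =
      ev (OmH pi om x) [:: f 1; f 0].
    apply: (@ev_eq _ _ 2 (OmH pi om x)) => l.
    case: (splitP (m := 2) (n := 0) l) => [i -> /=|[]//].
    by case: i => [[|[|i]] H].
  have s1 := @ev_swap _ _ 2 (OmH pi om x) [::] (f 1) (f 0) [::] V erefl.
  by move: e; rewrite e3 s1 mulrN -/w => <-; rewrite opprK.
set v := (fun l : 'I_2 => _).
have vv i : vertical pi x (v i) by rewrite /v; case: (ord2P i) => ->.
have step (h : 'I_2 -> E) : (forall i, horizontal g x (h i)) ->
    contract_args (k := 2) (m := 2) (d2m1 g 0 OmV x) v h =
    contract_args (k := 2) (m := 2) T v h.
  move=> hh; pose S0 : {set 'I_(2 + 2)} := [set lshift 2 i | i : 'I_2]%SET.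
  have c2 : #|S0| = 2%N by rewrite card_imset ?card_ord //; exact: lshift_inj.
  have inS (j : 'I_2) : lshift 2 j \in S0 by exact: imset_f.
  have ninS (j : 'I_2) : rshift 2 j \notin S0.
    by apply/imsetP => -[i _ /eqP]; rewrite eq_rlshift.
  apply: (etrans (@bicomp_vertical R M g 4 2 (ext_d OmV) x S0 _ c2 T_alt.1 _)).
    move=> i; rewrite -[i](@splitK 2 2).
    case: (@fintype.split 2 2 i) => j; rewrite /unsplit ?sl ?sr.
      by rewrite inS.
    by move=> _; exact: (vertical_fixed conn (vv _)).
  rewrite /contract_args; congr (ext_d OmV x); apply/funext => l.
  rewrite -[l](@splitK 2 2); case: (@fintype.split 2 2 l) => j; rewrite /unsplit ?sl ?sr.
    by rewrite inS (hh _) subr0.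
  by rewrite (negbTE (ninS j)).
have C : contract (m := 2) (QH x) (d2m1 g 0 OmV x) v = r * ev T [:: f 1; f 0; a; b].
  apply: (contract_det (k := 2) (m := 2) (h := fun j : 'I_2 => f j)).
  - apply: bicomp_ml; exact: T_alt.1.
  - exact: QH_det.
  move=> s; rewrite step; last by move=> i; exact: fhor.
  have Ca : alternating (contract_args (k := 2) (m := 2) T v).
    exact: (@alternating_contract_args R 5 2 2 T v T_alt).
  have eT : contract_args (k := 2) (m := 2) T v (fun j : 'I_2 => f j) =
      ev T [:: f 1; f 0; a; b].
    apply: (@ev_eq _ _ 4 T) => l; case: (splitP (m := 2) (n := 2) l) => j -> /=.
      by case: j => [[|[|j]] H].
    by case: j => [[|[|j]] H].
  rewrite -eT; exact: (alt_perm s (fun j : 'I_2 => f j) Ca).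
have s1 := @ev_swap _ _ 4 T [::] (f 1) (f 0) [:: a; b] T_alt erefl.
by rewrite /rho C mulrAC rw s1 mulrN mulN1r opprK.
Qed.

Notation dk := (differential kappa x).

Lemma rho_eq a b : vertical pi x a -> vertical pi x b ->
  kappa x ^+ 2 * rho g OmV QH x (fun l : 'I_2 => nth 0 [:: a; b] l) =
  pairing dk a * pairing bt b - pairing dk b * pairing bt a.
Proof.
move=> va vb; have B1 := (triple_beta triple).1 x I.
have sk : smooth_at x kappa := smooth_atP openT (triple_kappa triple) I.
have kA : alternating (ext_d (fn_form kappa) x).
  exact: alternating_ext_d openT (smooth_fn_form (triple_kappa triple)) I.
have k1 u : vertical pi x u -> d01 g 0 (fn_form kappa) x (fun=> u) = pairing dk u.
  move=> vu; apply: (etrans (bicomp_vertical (cards0 _) kA.1 _)).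
    by move=> i _ /=; exact: (vertical_fixed conn vu).
  rewrite (differential_pairing _ sk) /ext_d big_ord1 expr0 mul1r; congr (dir _ _ _).
  by rewrite finset.in_set0.
have b1 u : beta x (fun=> u) = pairing bt u by rewrite covector_pairing //; exact: B1.1.
have := triple_eq3 triple x (fun l : 'I_2 => nth 0 [:: a; b] l).
rewrite -[wedge_prod _ _ _]/(ev _ [:: a; b]) wedge_prod11 /= !k1 // !b1.
by move/eqP; rewrite subr_eq0 => /eqP <-.
Qed.

Lemma ext_d_beta_vertical a b : vertical pi x a -> vertical pi x b ->
  ev (ext_d beta x) [:: a; b] = 0.
Proof.
move=> va vb; have bA : alternating (ext_d beta x).
  exact: alternating_ext_d openT (triple_beta triple) I.
rewrite -[RHS](beta_closed x (fun l : 'I_2 => nth 0 [:: a; b] l)) /d01.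
rewrite (bicomp_vertical (cards0 _) bA.1); last first.
  move=> i _; case: (ord2P i) => ->; first exact: (vertical_fixed conn va).
  exact: (vertical_fixed conn vb).
by congr (ext_d beta x _); apply/funext => i; rewrite finset.in_set0.
Qed.

Lemma smooth_dual3 : smooth_form setT dual3.
Proof.
apply: smooth_form_add openT _ _.
  exact: smooth_form_scale openT (triple_kappa triple) (OmV_smooth data).
apply: smooth_form_wedge1 openT (triple_beta triple) _.
exact: smooth_OmH pi_smooth om_area.1.
Qed.

(** Since the pulled back area form is closed, beta contributes d beta /\ pi^* omega. With [a] and
    [b] vertical only the term d beta (a, b) could survive, and it vanishes because d_{0,1} beta =
    0. *)
Lemma ext_d_dual3 v0 v1 a b : vertical pi x a -> vertical pi x b ->
  ev (ext_d dual3 x) [:: v0; v1; a; b] =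
  ev (wedge1 dk (OmV x)) [:: v0; v1; a; b] + kappa x * ev T [:: v0; v1; a; b].
Proof.
move=> va vb; have sH := smooth_OmH pi_smooth om_area.1.
have sk : smooth_at x kappa := smooth_atP openT (triple_kappa triple) I.
have s1 := smooth_form_scale openT (triple_kappa triple) (OmV_smooth data).
have s2 := smooth_form_wedge1 openT (triple_beta triple) sH.
rewrite {1}/ev (ext_d_add _ openT s1 s2 I) (ext_d_scale _ openT sk (OmV_smooth data) I).
have -> : ext_d (fun y => wedge1 (covector (beta y)) (OmH pi om y)) x
    (fun l : 'I_4 => nth 0 [:: v0; v1; a; b] l) = 0; last by rewrite addr0.
apply: (etrans (ext_d_wedge1_closed v0 v1 a b openT (triple_beta triple) sH I _)).
  by move=> v; exact: (OmH_closed pi_smooth om_area.1).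
have wv u c : vertical pi x c -> ev (OmH pi om x) [:: u; c] = 0.
  by move=> vc; exact: (OmH_vertical0 (i := 1)).
have alg (db l : E -> E -> R) : db a b = 0 -> (forall u, l u a = 0) -> (forall u, l u b = 0) ->
    db v0 v1 * l a b - db v0 a * l v1 b + db v0 b * l v1 a
    + db v1 a * l v0 b - db v1 b * l v0 a + db a b * l v0 v1 = 0.
  by move=> d0 la lb; rewrite !la !lb d0 !mulr0 mul0r !(addr0, subr0).
apply: (alg (fun c e => ev (ext_d beta x) [:: c; e]) (fun c e => ev (OmH pi om x) [:: c; e])).
- exact: ext_d_beta_vertical.
- by move=> u; exact: wv.
- by move=> u; exact: wv.
Qed.

(** Here [eta] stands for df0 when a modular field is compared with a Hamiltonian one, and for ds /
    s when the volume form is rescaled by [s]. *)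
Definition defect (eta : E) : ('I_4 -> E) -> R :=
  fun v => ext_d dual3 x v + wedge1 eta (dual3 x) v.

Lemma alternating_defect eta : alternating (defect eta).
Proof.
apply: alternating_add; first exact: alternating_ext_d openT smooth_dual3 I.
by apply: alternating_wedge1; exact: alternating_dual3.
Qed.

Lemma defect_horizontal eta i : (i < 2)%N -> ev (defect eta) [:: f i; f 2; f 3; f 4] =
  kappa x * ev T [:: f i; f 2; f 3; f 4] + (p dk i + kappa x * p eta i) * mu.
Proof.
move=> i2; rewrite -[LHS]/(ev (ext_d dual3 x) _ + ev (wedge1 eta (dual3 x)) _).
have v3 : vertical pi x (f 3) by exact: fver.
have v4 : vertical pi x (f 4) by exact: fver.
rewrite (ext_d_dual3 _ _ v3 v4) !ev_wedge1_4.
have ijk j k : (2 <= j < k)%N && (k < 5)%N -> (i < j < k)%N && (k < 5)%N by lia.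
rewrite !ev_OmV ?ijk // !ev_dual3 ?ijk //= (_ : (i == 2%N) = false); last by lia.
by rewrite !mulr0 !(addr0, subr0); ring.
Qed.

Lemma defect_vertical eta a b : (2 <= a < b)%N && (b < 5)%N ->
  ev (defect eta) [:: f 0; f 1; f a; f b] =
  kappa x * ev T [:: f 0; f 1; f a; f b] + w * (p eta a * p bt b - p eta b * p bt a).
Proof.
move=> ab; rewrite -[LHS]/(ev (ext_d dual3 x) _ + ev (wedge1 eta (dual3 x)) _).
have va : vertical pi x (f a) by apply: fver; lia.
have vb : vertical pi x (f b) by apply: fver; lia.
rewrite (ext_d_dual3 _ _ va vb) !ev_wedge1_4.
have i1 : (1 < a < b)%N && (b < 5)%N by lia.
have i2 : (0 < a < b)%N && (b < 5)%N by lia.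
have i3 : (0 < 1 < b)%N && (b < 5)%N by lia.
have i4 : (0 < 1 < a)%N && (a < 5)%N by lia.
rewrite (ev_OmV i1) (ev_OmV i2) (ev_OmV i3) (ev_OmV i4).
rewrite (ev_dual3 i1) (ev_dual3 i2) (ev_dual3 i3) (ev_dual3 i4) /=.
have -> : (a == 1%N) = false by lia.
by ring.
Qed.

(** The hypotheses exhaust the five ways to omit one frame vector, so all components of the 4-form
    vanish. *)
Lemma defect_frame eta :
  (forall i, (i < 2)%N -> ev (defect eta) [:: f i; f 2; f 3; f 4] = 0) ->
  (forall a b, (2 <= a < b)%N && (b < 5)%N -> ev (defect eta) [:: f 0; f 1; f a; f b] = 0) ->
  forall a v, wedge1 a (defect eta) v = 0.
Proof.
move=> N1 N2 a v; apply: (top_ext (S := fun=> 0)).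
- by apply: alternating_wedge1; exact: alternating_defect.
- by split=> // *; rewrite mulr0 addr0.
rewrite frame_list -[wedge1 _ _ _]/(ev _ _) ev_wedge1_5 !N1 // !N2 //.
by rewrite !mulr0 !(addr0, subr0).
Qed.

Lemma theta_horizontal (la : E) :
  (forall v : 'I_1 -> E, theta g OmV QV x v = - pairing la (v 0 - v 0 *m g x)) <->
  (forall i, (i < 2)%N -> ev T [:: f i; f 2; f 3; f 4] = - p la i * mu).
Proof.
have [_ _ m0] := wmu_neq0; split=> [th i i2|Tf v].
  have := theta_frame (fun=> f i); rewrite th.
  by rewrite (fhor i2 : f i *m g x = 0) subr0 => <-; rewrite mulNr.
apply: (mulIf m0); rewrite theta_frame.
have := horizontal_span (horizontal_part conn x (v 0)).
set u := v 0 - _; move=> ->.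
rewrite -[pairing u (d 1) *: f 1]addr0 !(ev_cons_lin _ _ _ _ (T_alt.1)).
rewrite !(pairingC la) !pairingDl -![pairing (f _) la]pairingC !Tf //.
have -> : ev T [:: 0; f 2; f 3; f 4] = 0.
  by apply: (ml_zero (i := ord0)) => //; exact: T_alt.1.
have -> : pairing 0 la = 0 by rewrite /pairing big1 // => i _; rewrite mxE mul0r.
by ring.
Qed.

(** On the three-dimensional vertical space P_beta (la, b) is a triple product of beta, [la] and
    [b]; it vanishes for all [b] iff the cross product of beta and [la] does. The covectors [d 2],
    [d 3], [d 4] extract its components. *)
Lemma Pbeta_zero (la : E) :
  (forall b, vertical_tensor QV beta x (pair2 la b) = 0) <->
  (forall i j, (2 <= i < j)%N && (j < 5)%N -> p la i * p bt j - p la j * p bt i = 0).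
Proof.
have [_ _ m0] := wmu_neq0.
have dp i k : (i < 5)%N -> (k < 5)%N -> p (d k) i = (i == k)%:R.
  by move=> i5 k5; rewrite pairingC fd.
split=> [P0 i j ij|L b].
  have H k : (k < 5)%N -> p bt 2 * (p la 3 * (4 == k)%:R - p la 4 * (3 == k)%:R)
      - p bt 3 * (p la 2 * (4 == k)%:R - p la 4 * (2 == k)%:R)
      + p bt 4 * (p la 2 * (3 == k)%:R - p la 3 * (2 == k)%:R) = 0.
    move=> k5; have := Pbeta_frame la (d k); rewrite P0 mul0r => ->.
    by rewrite !dp.
  have /= H2 := H 2%N isT; have /= H3 := H 3%N isT; have /= H4 := H 4%N isT.
  have [[-> ->]|[[-> ->]|[-> ->]]] : (i = 2%N /\ j = 3%N) \/ (i = 2%N /\ j = 4%N) \/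
      (i = 3%N /\ j = 4%N) by lia.
  - by rewrite -[RHS]oppr0 -H4; ring.
  - by rewrite -[RHS]H3; ring.
  - by rewrite -[RHS]oppr0 -H2; ring.
apply: (mulIf m0); rewrite Pbeta_frame mul0r.
have := L 2%N 3%N isT; have := L 2%N 4%N isT; have := L 3%N 4%N isT => L1 L2 L3.
transitivity (- p b 2 * (p la 3 * p bt 4 - p la 4 * p bt 3)
  + p b 3 * (p la 2 * p bt 4 - p la 4 * p bt 2) - p b 4 * (p la 2 * p bt 3 - p la 3 * p bt 2)).
  by ring.
by rewrite L1 L2 L3 !mulr0 addr0 subr0.
Qed.

(** Multiplying by the dual covector [d k] isolates, up to sign, the component that omits [f k]. *)
Lemma frame_components (S : ('I_4 -> E) -> R) :
  (forall k, ev (wedge1 (d k) S) [:: f 0; f 1; f 2; f 3; f 4] = 0) ->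
  [/\ ev S [:: f 1; f 2; f 3; f 4] = 0, ev S [:: f 0; f 2; f 3; f 4] = 0,
      ev S [:: f 0; f 1; f 3; f 4] = 0, ev S [:: f 0; f 1; f 2; f 4] = 0 &
      ev S [:: f 0; f 1; f 2; f 3] = 0].
Proof.
move=> S0; have dp i k : (i < 5)%N -> (k < 5)%N -> p (d k) i = (i == k)%:R.
  by move=> i5 k5; rewrite pairingC fd.
have {}S0 k (k5 : (k < 5)%N) := etrans (esym (ev_wedge1_5 (d k) S (f 0) (f 1) (f 2) (f 3) (f 4)))
  (S0 k).
have /= e0 := S0 0%N isT; have /= e1 := S0 1%N isT; have /= e2 := S0 2%N isT.
have /= e3 := S0 3%N isT; have /= e4 := S0 4%N isT.
rewrite !dp //= in e0 e1 e2 e3 e4.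
split; [rewrite -[RHS]e0; ring|rewrite -[RHS]oppr0 -e1; ring|rewrite -[RHS]e2; ring|
  rewrite -[RHS]oppr0 -e3; ring|rewrite -[RHS]e4; ring].
Qed.

(** [NH] and [NV] give the components of [defect] up to nonzero factors: those with three vertical
    vectors measure theta + la, those with two measure la /\ beta. *)
Lemma defect_criterion (eta : E) : kappa x != 0 ->
  let la := (kappa x)^-1 *: dk + eta in
  (forall a v, wedge1 a (defect eta) v = 0) <->
  (forall b, vertical_tensor QV beta x (pair2 la b) = 0) /\
  (forall v : 'I_1 -> E, theta g OmV QV x v = - pairing la (v 0 - v 0 *m g x)).
Proof.
move=> k0 la; have [_ w0 m0] := wmu_neq0.
have laE u : kappa x * pairing la u = pairing dk u + kappa x * pairing eta u.
  by rewrite /la pairingDl mulrDr mulrA mulfV // mul1r.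
have NH i : (i < 2)%N -> ev (defect eta) [:: f i; f 2; f 3; f 4] =
    kappa x * (ev T [:: f i; f 2; f 3; f 4] - - p la i * mu).
  by move=> i2; rewrite defect_horizontal // -laE; ring.
have NV a b : (2 <= a < b)%N && (b < 5)%N ->
    ev (defect eta) [:: f 0; f 1; f a; f b] = w * (p la a * p bt b - p la b * p bt a).
  move=> ab; have va : vertical pi x (f a) by apply: fver; lia.
  have vb : vertical pi x (f b) by apply: fver; lia.
  (* The extra factor kappa produces [kappa x ^+ 2] times rho, which the third equation of the
     triple replaces by d kappa /\ beta. *)
  apply: (mulfI k0); rewrite defect_vertical // -(rho_frame va vb).
  transitivity (w * ((kappa x * p la a) * p bt b - (kappa x * p la b) * p bt a)); last by ring.
  rewrite !laE; have := rho_eq va vb; set rh := rho _ _ _ _ _ => e.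
  transitivity (w * (kappa x ^+ 2 * rh) +
    kappa x * w * (p eta a * p bt b - p eta b * p bt a)); first by ring.
  by rewrite e; ring.
rewrite theta_horizontal Pbeta_zero; split=> [N0|[LV LH]].
  have [e0 e1 e2 e3 e4] := frame_components (fun k => N0 (d k) _).
  split.
    move=> i j ij; apply: (mulfI w0).
    apply: etrans (esym (NV i j ij)) _; apply: etrans _ (esym (mulr0 _)).
    have [[-> ->]|[[-> ->]|[-> ->]]] : (i = 2%N /\ j = 3%N) \/ (i = 2%N /\ j = 4%N) \/
      (i = 3%N /\ j = 4%N) by lia.
    - exact: e4.
    - exact: e3.
    - exact: e2.
  move=> i i2; apply/eqP; rewrite -subr_eq0; apply/eqP; apply: (mulfI k0).
  apply: etrans (esym (NH i i2)) _; apply: etrans _ (esym (mulr0 _)).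
  have [->|->] : i = 0%N \/ i = 1%N by lia.
    exact: e1.
  exact: e0.
apply: defect_frame => [i i2|a b ab]; first by rewrite NH // LH // subrr mulr0.
by rewrite NV // LV // mulr0.
Qed.

Lemma defect_null_frame a v : kappa x = 0 -> dk = 0 -> wedge1 a (defect 0) v = 0.
Proof.
move=> k0 dk0; move: a v.
have p0 u : pairing 0 u = 0 :> R by rewrite /pairing big1 // => i _; rewrite mxE mul0r.
apply: defect_frame => [i i2|b c bc].
  by rewrite defect_horizontal // k0 dk0 p0 !mul0r addr0 mul0r addr0.
by rewrite defect_vertical // k0 !p0 !mul0r subrr mulr0 addr0.
Qed.

End AtPoint.

Notation cpl := (coupling_tensor pi g QV psi kappa beta).
Notation Pb := (vertical_tensor QV beta).

Lemma coupling_dual_at x a b v :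
  cpl x (pair2 a b) * Om x v = wedge_const * wedge1 a (wedge1 b (dual3 x)) v.
Proof.
have [f [d [fd fspan fhor fhv fver]]] := adapted_frame bundle conn x.
exact: (coupling_dual fd fspan fhor fhv fver).
Qed.

Lemma wedge_const_neq0 (x : M) : wedge_const != 0.
Proof.
have [f [d [fd fspan fhor fhv fver]]] := adapted_frame bundle conn x.
by have [] := wmu_neq0 fd fspan fhor fhv fver.
Qed.

Lemma defect_criterion_at x eta : kappa x != 0 ->
  let la := (kappa x)^-1 *: differential kappa x + eta in
  (forall a v, wedge1 a (defect x eta) v = 0) <->
  (forall b, Pb x (pair2 la b) = 0) /\
  (forall v : 'I_1 -> E, theta g OmV QV x v = - pairing la (v 0 - v 0 *m g x)).
Proof.
have [f [d [fd fspan fhor fhv fver]]] := adapted_frame bundle conn x.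
exact: (defect_criterion fd fspan fhor fhv fver).
Qed.

Lemma defect_null x a v : kappa x = 0 -> differential kappa x = 0 ->
  wedge1 a (defect x 0) v = 0.
Proof.
have [f [d [fd fspan fhor fhv fver]]] := adapted_frame bundle conn x.
exact: (defect_null_frame fd fhor fver).
Qed.

Lemma alternating_vertical_tensor x : alternating (Pb x).
Proof.
have -> : Pb x = fun a => -1 * insert (covector (beta x)) (QV x) a.
  by apply/funext => a; rewrite mulN1r.
by apply: alternating_scale; apply: alternating_insert; exact: (QV_smooth data).1 x I.
Qed.

Lemma alternating_coupling x : alternating (cpl x).
Proof.
apply: alternating_add; last exact: alternating_vertical_tensor.
apply: alternating_scale.
apply: (@alternating_precomp _ _ _ _ (psi (pi x))
  (fun a => \row_j pairing a (hor_vec pi g x (basis_vec R j)))).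
  exact: (psi_smooth data).1 (pi x) I.
by move=> c u w; apply/rowP => j; rewrite !mxE pairingDl.
Qed.

Definition weighted (s : M -> R) : dform M 5 := fun y v => s y * Om y v.

(** * Rescaled volume forms *)

Section Divergence.
Variables (U : set M) (s : M -> R).
Hypotheses (oU : open U) (sU : smooth U s) (s0 : forall y, U y -> s y != 0).

Lemma weighted_volume : volume_form U (weighted s).
Proof.
split; first exact: smooth_form_scale oU sU (smooth_form_sub (@subsetT _ U) Om_volume.1).
move=> y Uy; have [v v0] := Om_volume.2 y I; exists v.
by rewrite mulf_neq0 // s0.
Qed.

Let sc : smooth U (fun y => wedge_const * s y).
Proof. by apply: smooth_mul oU _ sU; exact: smooth_cst. Qed.

Let dual3U : smooth_form U dual3.
Proof. exact: smooth_form_sub (@subsetT _ U) smooth_dual3. Qed.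

(** Rescaling the volume form by [s] rescales the dual 3-form by [s]; the constant is absorbed as
    well, so that [ham_divergence] applies literally. *)
Let A : dform M 3 := fun y v => wedge_const * s y * dual3 y v.

Let AU : smooth_form U A. Proof. exact: smooth_form_scale oU sc dual3U. Qed.

Let PA y : U y -> forall b1 b2 v,
  cpl y (pair2 b1 b2) * weighted s y v = wedge1 b1 (wedge1 b2 (A y)) v.
Proof.
move=> Uy b1 b2 v; rewrite /A !wedge1Zr mulrCA coupling_dual_at; ring.
Qed.

Lemma smooth_ham_coupling f : smooth U f -> smooth_vfield U (ham cpl f).
Proof.
by apply: (smooth_ham oU weighted_volume AU _ PA) => y _; exact: alternating_coupling.
Qed.

(** The Leibniz rule gives d (s A) = s (dA + eta /\ A) with eta the logarithmic differential of [s],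
    given by an equation without division. *)
Lemma weighted_divergence f x v eta : smooth U f -> U x -> differential s x = s x *: eta ->
  lie (ham cpl f) (weighted s) x v =
  wedge_const * s x * wedge1 (differential f x) (defect x eta) v.
Proof.
move=> fU Ux ds.
rewrite (ham_divergence oU weighted_volume AU _ PA v fU Ux); last first.
  by move=> y _; exact: alternating_coupling.
have sx := smooth_atP oU sU Ux.
have -> : ext_d A x = fun u => wedge_const * s x * defect x eta u.
  apply/funext => u; rewrite (ext_d_scale u oU (smooth_atP oU sc Ux) dual3U Ux) /defect.
  rewrite (differential_mul (smooth_at_cst _ _) sx) differential_cst scaler0 addr0 ds.
  by rewrite scalerA wedge1Zl; ring.
by rewrite wedge1Zr.
Qed.

End Divergence.

(** * Unimodularity and invariant volumes through the defect *)

Section Coupling.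
Variable U : set M.
Hypothesis oU : open U.

(** The divergence contributes df /\ dA. The derivative of [f] along the Hamiltonian field of [f0]
    is - Pi (df, df0), which by duality contributes df /\ df0 /\ A. *)
Lemma modular_defect f f0 x v : smooth U f -> smooth U f0 -> U x ->
  lie (ham cpl f) Om x v - dir f x (ham cpl f0 x) * Om x v =
  wedge_const * wedge1 (differential f x) (defect x (differential f0 x)) v.
Proof.
move=> fU f0U Ux.
have -> : lie (ham cpl f) Om x v = wedge_const * wedge1 (differential f x) (ext_d dual3 x) v.
  have OmE : Om = weighted (fun=> 1).
    by apply/funext => y; apply/funext => u; rewrite /weighted mul1r.
  have n0 (y : M) : U y -> (1 : R) != 0 by move=> _; exact: oner_neq0.
  have d0 : differential (fun=> 1 : R) x = 1 *: 0 by rewrite differential_cst scaler0.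
  rewrite {1}OmE (weighted_divergence oU (smooth_cst U 1) n0 v fU Ux d0) mulr1.
  congr (_ * wedge1 _ _ _); apply/funext => u.
  by rewrite /defect -(scale0r (0 : E)) wedge1Zl mul0r addr0.
have P := alternating_coupling x.
rewrite (ham_dir _ P.1); last exact: smooth_atP oU fU Ux.
rewrite (pair2C _ _ P) mulNr opprK coupling_dual_at -mulrDr.
by rewrite /defect wedge1Dr.
Qed.

(** A modular field gives the equation only for [a] of the form df; [prescribed_differential]
    supplies such an [f] for every covector. Conversely the Hamiltonian field of [f0] serves as
    modular field. *)
Lemma unimodular_defect : unimodular U Om cpl <-> exists f0, smooth U f0 /\
  forall x, U x -> forall a v, wedge1 a (defect x (differential f0 x)) v = 0.
Proof.
split=> [[Z [[_ Zdiv] [f0 [sf0 Zf0]]]]|[f0 [sf0 N0]]].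
  exists f0; split=> // x Ux a v; have [f [sf <-]] := prescribed_differential x a.
  have sfU : smooth U f by exact: smooth_sub (@subsetT _ U) sf.
  apply: (mulfI (wedge_const_neq0 x)); rewrite mulr0 -(modular_defect v sfU sf0 Ux).
  by rewrite (Zdiv f sfU x Ux v) Zf0 // subrr.
have s1 (y : M) : U y -> (1 : R) != 0 by move=> _; exact: oner_neq0.
exists (ham cpl f0); split; last by exists f0.
split; first exact (smooth_ham_coupling oU (smooth_cst U 1) s1 sf0).
move=> f sf x Ux v; apply/eqP; rewrite -subr_eq0.
by rewrite (modular_defect v sf sf0 Ux) N0 // mulr0.
Qed.

Lemma invariant_weighted s : smooth U s -> (forall x, U x -> s x != 0) ->
  (forall x, U x -> exists eta, differential s x = s x *: eta /\
     forall a v, wedge1 a (defect x eta) v = 0) ->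
  invariant_volume U cpl (weighted s).
Proof.
move=> sU s0 H; have wU := weighted_volume oU sU s0; split=> // f sf.
apply: flow_invariant_lie oU wU.1 (smooth_ham_coupling oU sU s0 sf) _ => x v Ux.
have [eta [ds N0]] := H x Ux.
by rewrite (weighted_divergence oU sU s0 v sf Ux ds) N0 mulr0.
Qed.

End Coupling.

(** * The coupling domain and the interior of the zero set *)

Notation dom := [set x : M | kappa x != 0].
Notation admissible h := (casimir dom Pb h /\
  forall x, dom x -> forall v, theta g OmV QV x v = - d10 g 0 (fn_form h) x v).

Lemma kappa_at x : smooth_at x kappa.
Proof. exact: smooth_atP openT (triple_kappa triple) I. Qed.

Lemma coupling_domain_open : open dom.
Proof.
rewrite openE => x kx; have c := smooth_continuous openT (triple_kappa triple) (I : setT x).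
exact: cvgr_neq0 c kx.
Qed.

Lemma d10_function h x v : smooth_at x h ->
  d10 g 0 (fn_form h) x v = pairing (differential h x) (v 0 - v 0 *m g x).
Proof.
move=> hx; have [W [oW Wx hW]] := hx.
have dA : alternating (ext_d (fn_form h) x).
  exact: alternating_ext_d oW (smooth_fn_form hW) Wx.
have cT : #|[set: 'I_1]%SET| = 1%N by rewrite cardsT card_ord.
apply: (etrans (bicomp_vertical cT dA.1 _)); first by move=> i; rewrite finset.in_setT.
rewrite (differential_pairing _ hx) /ext_d big_ord1 expr0 mul1r /fn_form.
by rewrite finset.in_setT.
Qed.

(** With eta = dh - d kappa / kappa the covector lambda of [defect_criterion_at] is exactly dh: its
    two conditions become the Casimir property and theta = - d_{1,0} h. *)
Lemma admissible_defect h : smooth dom h ->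
  admissible h <-> forall x, dom x -> forall a v,
    wedge1 a (defect x (differential h x - (kappa x)^-1 *: differential kappa x)) v = 0.
Proof.
move=> sh; have hx x (Dx : dom x) : smooth_at x h := smooth_atP coupling_domain_open sh Dx.
have Pm x := (alternating_vertical_tensor x).1.
split=> [[[_ hc] hth] x Dx|N0].
  apply/(defect_criterion_at _ Dx); rewrite addrC subrK; split=> [|v].
    by apply/(ham_eq0 _ (Pm x)); exact: hc.
  by rewrite hth // d10_function //; exact: hx.
have N1 x (Dx : dom x) := (defect_criterion_at _ Dx).1 (N0 x Dx).
split=> [|x Dx v].
  split=> // x Dx; apply/(ham_eq0 _ (Pm x)).
  by have [] := N1 x Dx; rewrite addrC subrK.
have [_] := N1 x Dx; rewrite addrC subrK => ->.
by rewrite d10_function //; exact: hx.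
Qed.

Lemma smooth_ln_kappa : smooth dom (fun y => ln `|kappa y|).
Proof.
apply: smooth_lnabs coupling_domain_open _ _ => //.
exact: smooth_sub (@subsetT _ _) (triple_kappa triple).
Qed.

Lemma unimodular_admissible : unimodular dom Om cpl <-> exists h, admissible h.
Proof.
have oD := coupling_domain_open. have sl := smooth_ln_kappa.
rewrite (unimodular_defect oD); split=> [[f0 [sf0 N0]]|[h ah]].
  pose h y := f0 y + ln `|kappa y|; exists h.
  have sh : smooth dom h by exact: smooth_add oD sf0 sl.
  apply/(admissible_defect sh) => x Dx a v.
  rewrite (differential_add (smooth_atP oD sf0 Dx) (smooth_atP oD sl Dx)).
  by rewrite (differential_lnabs (kappa_at x) Dx) addrK N0.
have sh := ah.1.1; exists (fun y => h y + -1 * ln `|kappa y|); split.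
  by apply: (smooth_add oD sh); apply: (smooth_mul oD _ sl); exact: smooth_cst.
move=> x Dx a v; have c1 := smooth_at_cst (-1) x; have lx := smooth_atP oD sl Dx.
rewrite (differential_add (smooth_atP oD sh Dx) (smooth_at_mul c1 lx)).
rewrite (differential_mul c1 lx) differential_cst scaler0 addr0 scaleN1r.
rewrite (differential_lnabs (kappa_at x) Dx).
exact: ((admissible_defect sh).1 ah x Dx).
Qed.

(** The logarithmic differential of e^h / kappa is dh - d kappa / kappa, the covector of
    [admissible_defect]. *)
Lemma invariant_admissible h : admissible h ->
  invariant_volume dom cpl (weighted (fun y => expR (h y) / kappa y)).
Proof.
move=> ah; have oD := coupling_domain_open; have sh := ah.1.1.
have sk : smooth dom kappa by exact: smooth_sub (@subsetT _ _) (triple_kappa triple).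
have sV : smooth dom (fun y => (kappa y)^-1) by exact: smooth_inv.
have ss := smooth_mul oD (smooth_expR oD sh) sV.
apply: (invariant_weighted oD ss) => [x Dx|x Dx].
  by rewrite mulf_neq0 ?invr_neq0 // gt_eqF // expR_gt0.
exists (differential h x - (kappa x)^-1 *: differential kappa x).
split; last exact: ((admissible_defect sh).1 ah x Dx).
have hx := smooth_atP oD sh Dx; have sx := smooth_atP oD ss Dx.
(* Instead of a quotient rule, the product kappa times (e^h / kappa), equal to e^h on the open
   domain, is differentiated and the equation is solved. *)
have := differential_mul (kappa_at x) sx.
have -> : differential (fun y => kappa y * (expR (h y) / kappa y)) x =
    differential (fun y => expR (h y)) x.
  apply/rowP => i; rewrite !differentialE; apply: eq_dir.
  apply: filterS (open_nbhs_nbhs (conj oD Dx)) => y Dy.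
  by rewrite mulrC divfK.
rewrite (differential_expR hx) => e; apply: (scalerI Dx).
have -> : kappa x *: differential (fun z => expR (h z) / kappa z) x =
    expR (h x) *: differential h x - (expR (h x) / kappa x) *: differential kappa x.
  by rewrite e addrK.
rewrite !scalerBr !scalerA; congr (_ *: _ - _ *: _); first by rewrite mulrC divfK.
by rewrite [kappa x * _]mulrC divfK.
Qed.

(** In the interior kappa vanishes on a neighbourhood, so its differential vanishes together with
    its value. *)
Lemma null_set_defect x : interior [set y : M | kappa y = 0] x ->
  forall a v, wedge1 a (defect x 0) v = 0.
Proof.
move=> Nx a v; have k0 : kappa x = 0 := nbhs_singleton Nx.
apply: defect_null => //; rewrite -[RHS](differential_cst 0 x).
by apply/rowP => i; rewrite !differentialE; exact: eq_dir.
Qed.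

End PointwiseGeometry.

Theorem theorem5p3 (R : realType) (M : manifold R 5) (B : manifold R 2)
    (pi : M -> B) (Om : dform M 5) (om : dform B 2)
    (bundle : fiber_bundle pi)
    (Om_volume : volume_form setT Om) (om_area : volume_form setT om)
    (g : M -> 'M[R]_5) (kappa : M -> R) (beta : dform M 1)
    (OmV : dform M 3) (QH : mvector M 2) (QV : mvector M 3) (psi : mvector B 2)
    (data : bundle_data pi Om om g OmV QH QV psi)
    (triple : poisson_triple pi g OmV QH QV kappa beta)
    (beta_closed : forall x v, d01 g 0 beta x v = 0) :
  let Pi := coupling_tensor pi g QV psi kappa beta in
  let Pbeta := vertical_tensor QV beta in
  let Omega := fun x => wedge_prod (OmH pi om x) (OmV x) in
  let dom := [set x : M | kappa x != 0] in
  let nul := interior [set x : M | kappa x = 0] in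
  let admissible := fun h : M -> R =>
    casimir dom Pbeta h /\
    (forall x, dom x -> forall v,
       theta g OmV QV x v = - d10 g 0 (fn_form h) x v) in
  ((unimodular dom Om Pi <-> exists h, admissible h) /\
   (forall h, admissible h ->
      invariant_volume dom Pi
        (fun x v => expR (h x) / kappa x * Omega x v))) /\
  ((forall x, nul x -> Pi x = Pbeta x) /\
   unimodular nul Om Pi /\
   invariant_volume nul Pi Omega).
Proof.
have OmE x : Om x = wedge_prod (OmH pi om x) (OmV x) := OmV_def data x.
have nul0 x : interior [set y : M | kappa y = 0] x -> kappa x = 0 by exact: nbhs_singleton.
move=> Pi Pbeta Omega dom nul admissible; have oN : open nul := open_interior _.
split; last split; last split.
- split=> [|h ah].
    exact: (unimodular_admissible bundle Om_volume om_area data triple beta_closed).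
  have -> : (fun x v => expR (h x) / kappa x * Omega x v) =
      weighted Om (fun x => expR (h x) / kappa x).
    by apply/funext => x; apply/funext => v; rewrite /weighted OmE.
  exact: (invariant_admissible bundle Om_volume om_area data triple beta_closed ah).
- by move=> x /nul0 kx; apply/funext => a; rewrite /Pi /coupling_tensor kx mul0r add0r.
- apply/(unimodular_defect bundle Om_volume om_area data triple oN).
  exists (fun=> 0); split=> [|x Nx a v]; first exact: smooth_cst.
  rewrite differential_cst.
  exact: (null_set_defect bundle om_area data triple beta_closed Nx).
- have -> : Omega = weighted Om (fun=> 1).
    by apply/funext => x; apply/funext => v; rewrite /weighted mul1r OmE.
  apply: (invariant_weighted bundle Om_volume om_area data triple oN) => [|x _|x Nx].
  + exact: smooth_cst.
  + exact: oner_neq0.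
  exists 0; split; first by rewrite differential_cst scaler0.
  by move=> a v; exact: (null_set_defect bundle om_area data triple beta_closed Nx).
Qed.
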